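(* Let $Q/I$ be a minimal regular presentation for $R$, and assume that $I$ is minimally generated by $n$ monomials in some regular sequence of $Q$. For each $R$-complex $M$ with $\operatorname{H}(M)$ nonzero and finitely generated, there is an inequality \[ \dim \mathrm V_R(M)\geqslant n-\operatorname{height}(I). \] In particular, $\dim \mathrm V_R(M)>0$ when $R$ is not complete intersection.
   Context: Minimal regular presentation. One of two cases holds. Local case: $R$ is a commutative noetherian local ring with residue field $k$, $(Q,\mathfrak m,k)$ is a regular local ring, $I\subseteq \mathfrak m^2$ is an ideal, and $\widehat R\cong Q/I$. Graded case: $Q$ is a polynomial ring in finitely many variables of positive degree over a field $k$, $\mathfrak m$ is its homogeneous maximal ideal, $I\subseteq\mathfrak m^2$ is a homogeneous ideal and $R=Q/I$; here all elements, ideals, sequences, modules and complexes are taken to be homogeneous/graded. In either case $Q/I$ is called a minimal regular presentation of $R$; $R$ is complete intersection if $I$ is generated by a $Q$-regular sequence. A monomial in a regular sequence $x_1,\dots,x_d\in\mathfrak m$ of $Q$ is an element $x_1^{a_1}\cdots x_d^{a_d}$ with all $a_i\geqslant 0$. Cohomological support. Let $f_1,\dots,f_n$ be minimal generators of $I$, let $E=Q[e_1,\dots,e_n\mid \partial e_i=f_i]$ be the Koszul complex on them (a dg algebra), and let $\mathcal S=k[\chi_1,\dots,\chi_n]$ with each $\chi_i$ of cohomological degree $2$. An $R$-complex $M$ (replaced by $\widehat R\otimes_R M$ in the local case) is a dg $E$-module through the augmentation $E\to Q/I$. If $\operatorname{H}(M)$ is finitely generated over $R$, there is a dg $E$-module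 $F$ that is a bounded complex of finite rank free $Q$-modules and is quasi-isomorphic to $M$ as a dg $E$-module, and $\operatorname{Ext}_E(M,k)$ is, as a graded $\mathcal S$-module, the homology of $\mathcal S\otimes_k\operatorname{Hom}_Q(F,k)$ with differential $1\otimes\partial^{\operatorname{Hom}_Q(F,k)}+\sum_{i}\chi_i\otimes e_i$ (independent of $F$). The cohomological support variety of $M$ is \[ \mathrm V_R(M)=\operatorname{Supp}_{\mathcal S}\operatorname{Ext}_E(M,k)=\{\mathfrak p : \mathfrak p\supseteq \operatorname{ann}_{\mathcal S}\operatorname{Ext}_E(M,k)\}, \] a closed subset of the space of homogeneous primes of $\mathcal S$ (including the irrelevant ideal), identified with the corresponding conical closed subset of affine space $\mathbb A^n_k=\operatorname{Spec}\mathcal S$; $\dim$ denotes its dimension there. *)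

(* Defs.v *)
From HB Require Import structures.
From mathcomp Require Import all_boot all_order all_algebra.
From mathcomp Require Import mpoly.
From mathcomp Require Import boolp classical_sets constructive_ereal.
From Stdlib Require Import Relation_Operators.

Set Implicit Arguments.
Unset Strict Implicit.
Unset Printing Implicit Defensive.

Import Order.TTheory GRing.Theory Num.Theory.
Local Open Scope ring_scope.
Local Open Scope classical_set_scope.

Section Ideals.
Context {A : comNzRingType}.
Implicit Types (I J p m : set A).

Definition ideal J : Prop :=
  [/\ J 0, (forall x y, J x -> J y -> J (x + y)) & forall a x, J x -> J (a * x)].

Definition ideal_gen (X : set A) : set A :=
  [set a | forall J, ideal J -> X `<=` J -> J a].

Definition ideal_exp J (n : nat) : set A :=
  ideal_gen [set z | exists2 y : 'I_n -> A, forall i, J (y i) & z = \prod_i y i].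

Definition prime_ideal p : Prop :=
  [/\ ideal p, ~ p 1 & forall x y, p (x * y) -> p x \/ p y].

Definition maximal_ideal m : Prop :=
  [/\ ideal m, ~ m 1 & forall J, ideal J -> ~ J 1 -> m `<=` J -> J = m].

Definition local_ring m : Prop :=
  maximal_ideal m /\ forall J, maximal_ideal J -> J = m.

(* Combinatorial dimension of a set of primes, in Z u {-oo, +oo}; it is -oo on
   the empty set. *)
Definition has_chain (X : set (set A)) (l : nat) : Prop :=
  exists p : nat -> set A,
    (forall i, (i <= l)%N -> X (p i)) /\
    (forall i, (i < l)%N -> p i `<` p i.+1).

Definition chain_dim (X : set (set A)) : \bar int :=
  supremum (-oo)%E [set (Posz l)%:E | l in has_chain X].

Definition prime_height p : \bar int :=
  chain_dim [set q | prime_ideal q /\ q `<=` p].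

Definition height I : \bar int :=
  infimum (+oo)%E (prime_height @` [set p | prime_ideal p /\ I `<=` p]).

Definition regular_sequence (d : nat) (x : 'I_d -> A) : Prop :=
  (forall (i : 'I_d) a, ideal_gen (x @` [set j : 'I_d | (j < i)%N]) (x i * a) ->
      ideal_gen (x @` [set j : 'I_d | (j < i)%N]) a) /\
  ~ ideal_gen (range x) 1.

Definition monomial_in (d : nat) (x : 'I_d -> A) (z : A) : Prop :=
  exists a : 'I_d -> nat, z = \prod_j x j ^+ a j.

End Ideals.

Definition noetherian (A : comNzRingType) : Prop :=
  forall J : set A, ideal J -> exists s : seq A, J = ideal_gen [set` s].

Definition krull_dim (A : comNzRingType) : \bar int :=
  chain_dim (@prime_ideal A).

Definition regular_local_ring (Q : comNzRingType) (m : set Q) : Prop :=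
  [/\ noetherian Q, local_ring m &
      exists (d : nat) (x : 'I_d -> Q),
        m = ideal_gen (range x) /\ krull_dim Q = (Posz d)%:E].

(* pi identifies B with A/J. *)
Definition quotient_map (A B : comNzRingType) (J : set A)
    (pi : {rmorphism A -> B}) : Prop :=
  (forall b, exists a, pi a = b) /\ (forall a, pi a = 0 <-> J a).

(* The A-algebra c : A -> B is isomorphic to lim_n A/m^n.  A map from B to the
   limit is given by phi, where phi b n represents the n-th component of the
   image of b; the clauses say that these components form a compatible family,
   that the map is a ring morphism under A, injective, and surjective. *)
Definition adic_completion (A B : comNzRingType) (m : set A)
    (c : {rmorphism A -> B}) : Prop :=
  exists phi : B -> nat -> A,
  [/\ forall b n, ideal_exp m n (phi b n.+1 - phi b n),
      forall b b' n, ideal_exp m n (phi (b + b') n - (phi b n + phi b' n)) /\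
                     ideal_exp m n (phi (b * b') n - phi b n * phi b' n),
      forall a n, ideal_exp m n (phi (c a) n - a),
      forall b, (forall n, ideal_exp m n (phi b n)) -> b = 0 &
      forall a : nat -> A, (forall n, ideal_exp m n (a n.+1 - a n)) ->
        exists b, forall n, ideal_exp m n (phi b n - a n)].

(* Rings, modules and complexes carry an internal grading by an abelian group D:
   gr a is the set of elements of internal degree a.  The ungraded theory is the
   case of the trivial group D = 'I_1, with everything in degree 0. *)
Definition ungraded (A : comNzRingType) : 'I_1 -> set A := fun=> setT.

Definition homogeneous (D : Type) (A : comNzRingType) (gr : D -> set A) (x : A)
  : Prop := exists a, gr a x.

Definition wgrading (k : fieldType) (r : nat) (w : 'I_r -> nat)
    (a : int) : set {mpoly k[r]} :=
  [set q | forall mon : 'X_{1..r}, mon \in msupp q ->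
     Posz (\sum_(i < r) w i * mon i)%N = a].

Section Presentations.
Context (D : Type) {Q : comNzRingType} (gr : D -> set Q).
Implicit Types (I m : set Q).

Definition homogeneous_ideal I : Prop :=
  ideal I /\ I = ideal_gen (I `&` homogeneous gr).

Definition minimal_generators I (n : nat) (f : 'I_n -> Q) : Prop :=
  [/\ forall i, homogeneous gr (f i),
      I = ideal_gen (range f) &
      forall i, I <> ideal_gen (f @` [set j | j != i])].

Definition minimally_generated_by_monomials m I (n : nat) : Prop :=
  exists (d : nat) (x : 'I_d -> Q) (g : 'I_n -> Q),
  [/\ forall j, homogeneous gr (x j) /\ m (x j),
      regular_sequence x,
      forall i, monomial_in x (g i) &
      minimal_generators I g].

(* For the ring Q/I. *)
Definition complete_intersection I : Prop :=
  exists (c : nat) (y : 'I_c -> Q),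
  [/\ forall j, homogeneous gr (y j), regular_sequence y &
      I = ideal_gen (range y)].

End Presentations.

(* V is the internal direct sum of the subgroups G t. *)
Definition direct_sum (T : eqType) (V : zmodType) (G : T -> set V) : Prop :=
  [/\ forall t, G t 0 /\ (forall x y, G t x -> G t y -> G t (x - y)),
      forall x, exists (s : seq T) (y : T -> V),
        (forall t, G t (y t)) /\ x = \sum_(t <- s) y t &
      forall (s : seq T) (y : T -> V), uniq s -> (forall t, G t (y t)) ->
        \sum_(t <- s) y t = 0 -> forall t, t \in s -> y t = 0].

(* A complex is encoded by the direct sum of its terms: cx_gr i a is the set of
   elements of homological degree i and internal degree a. *)
Record complex (D : zmodType) (A : comNzRingType) (gr : D -> set A) := Complex {
  cx_mod :> lmodType A;
  cx_gr : int -> D -> set cx_mod;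
  cx_d : {linear cx_mod -> cx_mod};
  cx_direct : direct_sum (fun t : int * D => cx_gr t.1 t.2);
  cx_scale : forall a i b (r : A) (x : cx_mod),
        gr a r -> cx_gr i b x -> cx_gr i (a + b) (r *: x);
  cx_d_deg : forall i a x, cx_gr i a x -> cx_gr (i - 1) a (cx_d x);
  cx_dd : forall x, cx_d (cx_d x) = 0 }.

Arguments cx_gr {D A gr} c.
Arguments cx_d {D A gr} c.

Section Homology.
Context (D : zmodType) (A : comNzRingType) (gr : D -> set A).

Definition homology_nonzero (M : complex gr) : Prop :=
  exists z : M, cx_d M z = 0 /\ ~ exists y, z = cx_d M y.

Definition homology_fg (M : complex gr) : Prop :=
  exists s : seq M, (forall z, z \in s -> cx_d M z = 0) /\
    forall z : M, cx_d M z = 0 ->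
      exists (a : M -> A) (y : M), z = \sum_(x <- s) a x *: x + cx_d M y.

End Homology.

(* N is the base change of M along c: M -> N is the universal c-semilinear map,
   i.e. N = B (x)_A M, with the induced grading and differential. *)
Definition base_change (D : zmodType) (A B : comNzRingType)
    (grA : D -> set A) (grB : D -> set B) (c : {rmorphism A -> B})
    (M : complex grA) (N : complex grB) : Prop :=
  exists b : {linear M -> N | c \; *:%R},
  [/\ forall i a x, cx_gr M i a x -> cx_gr N i a (b x),
      forall x, b (cx_d M x) = cx_d N (b x) &
      forall (P : lmodType B) (g : {linear M -> P | c \; *:%R}),
        exists h : {linear N -> P}, (forall x, h (b x) = g x) /\
          forall h' : {linear N -> P}, (forall x, h' (b x) = g x) -> h' =1 h].

Section CohomologicalSupport.
Context (D : zmodType) (Q : comNzRingType) (gr : D -> set Q).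
Context (n : nat) (f : 'I_n -> Q).

(* A dg module over E = Q[e_1, ..., e_n | de_i = f_i]: E is generated over Q by
   the e_i subject to e_i e_j = - e_j e_i and e_i^2 = 0, and the action of e_i
   has homological degree 1 and the internal degree of f_i. *)
Record dgmod := DGMod {
  dg_cx :> complex gr;
  dg_e : 'I_n -> {linear dg_cx -> dg_cx};
  dg_e_deg : forall l a i b (x : dg_cx), gr a (f l) -> cx_gr dg_cx i b x ->
        cx_gr dg_cx (i + 1) (a + b) (dg_e l x);
  dg_e_anti : forall l l' x, dg_e l (dg_e l' x) = - dg_e l' (dg_e l x);
  dg_e_sq : forall l x, dg_e l (dg_e l x) = 0;
  dg_e_leibniz : forall l x, cx_d dg_cx (dg_e l x) = f l *: x - dg_e l (cx_d dg_cx x) }.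

Definition dg_morphism (X Y : dgmod) (u : {linear X -> Y}) : Prop :=
  [/\ forall i a x, cx_gr X i a x -> cx_gr Y i a (u x),
      forall x, u (cx_d X x) = cx_d Y (u x) &
      forall l x, u (dg_e X l x) = dg_e Y l (u x)].

Definition homology_bijective (X Y : dgmod) (u : {linear X -> Y}) : Prop :=
  (forall z, cx_d X z = 0 -> (exists y, u z = cx_d Y y) ->
     exists x, z = cx_d X x) /\
  (forall w, cx_d Y w = 0 ->
     exists z y, cx_d X z = 0 /\ w = u z + cx_d Y y).

Definition quasi_isomorphic : dgmod -> dgmod -> Prop :=
  clos_refl_sym_trans dgmod (fun X Y =>
    exists u : {linear X -> Y}, dg_morphism u /\ homology_bijective u).

(* G is the complex N of A-modules, seen as a dg E-module through the
   augmentation E -> Q/(f) followed by Q/(f) -> A. *)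
Definition restriction_of (A : comNzRingType) (grA : D -> set A)
    (pi : {rmorphism Q -> A}) (N : complex grA) (G : dgmod) : Prop :=
  exists u : N -> G,
  [/\ bijective u,
      forall q x y, u (pi q *: x + y) = q *: u x + u y,
      forall i a x, cx_gr N i a x <-> cx_gr G i a (u x),
      forall x, u (cx_d N x) = cx_d G (u x) &
      forall l x, dg_e G l (u x) = 0].

Definition finite_free (F : dgmod) : Prop :=
  exists (r : nat) (b : 'I_r -> F),
    (forall j, exists i a, cx_gr F i a (b j)) /\
    forall x, exists! c : {ffun 'I_r -> Q}, x = \sum_j c j *: b j.

Context (k : fieldType) (eps : {rmorphism Q -> k}).

Local Notation S := {mpoly k[n]}.

(* For F finite free over Q, S (x)_k Hom_Q(F, k) is the S-module of eps-
   semilinear maps h : F -> S.  twisted_d h i x is the value at x in F_i of the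
   image of h under the differential; as |h| is i - 1 on the summand h \o d and
   i + 1 on the summands h \o e_l, the signs come from
   d(h) = -(-1)^|h| h \o d and e_l h = (-1)^|h| h \o e_l in Hom_Q(F, k). *)
Definition twisted_d (F : dgmod) (h : {linear F -> S | eps \; *:%R})
    (i : int) (x : F) : S :=
  (-1) ^+ absz (i + 1) * (\sum_(l < n) 'X_l * h (dg_e F l x) - h (cx_d F x)).

Definition ann_Ext (F : dgmod) : set S :=
  [set s | forall h : {linear F -> S | eps \; *:%R},
     (forall i a x, cx_gr F i a x -> twisted_d h i x = 0) ->
     exists g : {linear F -> S | eps \; *:%R},
       forall i a x, cx_gr F i a x -> s * h x = twisted_d g i x].

(* Doubling all degrees, as |chi_i| = 2 asks for, does not affect homogeneity. *)
Definition homogeneous_prime (p : set S) : Prop :=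
  prime_ideal p /\ forall s, p s -> forall d, p (pihomog mdeg d s).

Definition Supp_Ext (F : dgmod) : set (set S) :=
  [set p | homogeneous_prime p /\ ann_Ext F `<=` p].

(* V is the cohomological support of the complex N, computed from some F; it
   does not depend on the choice of F. *)
Definition cohomological_support (A : comNzRingType) (grA : D -> set A)
    (pi : {rmorphism Q -> A}) (N : complex grA) (V : set (set S)) : Prop :=
  exists G F : dgmod,
  [/\ restriction_of pi N G, quasi_isomorphic G F, finite_free F &
      V = Supp_Ext F].

End CohomologicalSupport.

(* Dimension in Spec S of the conical closed subset corresponding to a closed
   set V of homogeneous primes. *)
Definition support_dim (k : fieldType) (n : nat) (V : set (set {mpoly k[n]}))
  : \bar int :=
  chain_dim [set p | prime_ideal p /\ exists2 q, V q & q `<=` p].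

(* Main.v *)
Require Import Defs.
From HB Require Import structures.
From mathcomp Require Import all_boot all_order all_algebra.
From mathcomp Require Import mpoly.
From mathcomp Require Import ring zify.
From mathcomp Require Import boolp classical_sets constructive_ereal.
From Stdlib Require Import Relation_Operators.

Set Implicit Arguments.
Unset Strict Implicit.
Unset Printing Implicit Defensive.

Import Order.TTheory GRing.Theory Num.Theory.
Local Open Scope ring_scope.
Local Open Scope classical_set_scope.

(* Let J be the annihilator of Ext_E(M, k).  If every f_l lies in the ideal of h
   members x_1, ..., x_h of the regular sequence, f_l = \sum_c b_lc x_c, then there is
   a chain of n - h primes above J.  Otherwise Noether normalization gives h + 1
   elements t_0, ..., t_h of Q[chi_1, ..., chi_n] whose images in S lie in J and whose
   powers form a regular sequence with Q-linearly split quotients.  Consider families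
   of Q-linear maps from Q[chi] to M (x) K, where K is the Koszul complex on generators
   of m, with the differential D = \sum_l chi_l e_l - (correction through K) - d, the
   correction making D square to zero.  A power of each t_j annihilates the homology:
   on a finite free model F, t_j is null-homotopic modulo m, the homotopy lifts to
   Q[chi] with the help of an adjugate matrix, and this is invariant under
   quasi-isomorphism.  For M itself the e_l vanish and D - (-d) is a combination of only
   h anticommuting operators of square zero, so that words of length h + 1 in them are
   zero; dividing successively by t_0, ..., t_h shows that 1 annihilates the homology.
   In the lowest degree this contradicts Nakayama's lemma for H(F).

   A prime containing I contains a set of x_c generating an ideal that contains I, and
   regular sequences in m can be permuted, so its height is at least the size of that
   set; this gives the inequality with height I.  If no two generators share an x_c,
   they form a regular sequence; otherwise n - 1 of the x_c suffice. *)

(** * Complexes with Koszul operators *)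

(** For a module that is not free over Q, such as M itself, Hom into k loses information, so the
    vanishing of the [e_l] on M cannot be exploited on S (x) Hom(-, k). The covariant families
    remedy this: Q[chi] is projective over Q, so they respect quasi-isomorphisms. The price is that
    [f_l] no longer acts as 0 and the twisted differential squares to [- \sum_l chi_l f_l]. As [f_l]
    lies in the ideal of the [x_c], hence in m, the Koszul generators of K can cancel this
    curvature, and they enter only through h elements, one for each [x_c].

    This fixes the number h + 1: dividing by one [t_j] spends one letter of a word in h
    anticommuting letters. It also forces powers. Passing to the quotient by a [t_j] squares an
    annihilator, since the new homology is an extension of two pieces of the old; building a
    homotopy over k and lifting it to Q needs further powers. Hence Noether normalization has to
    deliver sequences that stay split for all exponents. Families are bounded below because the
    twist mixes the degrees i - 1 and i + 1; the lower bound starts the inductive constructions. *)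

Definition mklin (Q : comNzRingType) (U V : lmodType Q) (g : U -> V)
    (gl : linear g) : {linear U -> V} :=
  HB.pack g (GRing.isLinear.Build Q U V *:%R g gl).

Record kmod (Q : comNzRingType) := KMod {
  km_sort :> lmodType Q;
  km_gr : int -> set km_sort;
  km_d : {linear km_sort -> km_sort};
  km_op : nat -> {linear km_sort -> km_sort} }.

Arguments km_gr {Q} k.
Arguments km_d {Q} k.
Arguments km_op {Q} k.

(* A complex with operators e_l, 0 <= l < N, satisfying the relations of the Koszul
   complex on sc 0, ..., sc (N - 1). *)
Record koszul (Q : comNzRingType) (N : nat) (sc : nat -> Q) (Y : kmod Q) : Prop :=
  Koszul {
  km_gr0 : forall i, km_gr Y i 0;
  km_grP : forall i q x y, km_gr Y i x -> km_gr Y i y -> km_gr Y i (q *: x + y);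
  km_d_gr : forall i x, km_gr Y i x -> km_gr Y (i - 1) (km_d Y x);
  km_dd : forall x, km_d Y (km_d Y x) = 0;
  km_op_gr : forall l i x, (l < N)%N -> km_gr Y i x -> km_gr Y (i + 1) (km_op Y l x);
  km_anti : forall l l' x, (l < N)%N -> (l' < N)%N ->
    km_op Y l (km_op Y l' x) = - km_op Y l' (km_op Y l x);
  km_sq : forall l x, (l < N)%N -> km_op Y l (km_op Y l x) = 0;
  km_leib : forall l x, (l < N)%N ->
    km_d Y (km_op Y l x) = sc l *: x - km_op Y l (km_d Y x) }.

Section GradedSubmodules.
Variables (Q : comNzRingType) (N : nat) (sc : nat -> Q) (Y : kmod Q).
Hypothesis kY : koszul N sc Y.

Lemma km_grD i x y : km_gr Y i x -> km_gr Y i y -> km_gr Y i (x + y).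
Proof. by move=> hx hy; rewrite -[x]scale1r; exact: km_grP kY _ _ _ _ hx hy. Qed.

Lemma km_grZ i q x : km_gr Y i x -> km_gr Y i (q *: x).
Proof.
by move=> hx; rewrite -[q *: x]addr0; exact: km_grP kY _ _ _ _ hx (km_gr0 kY i).
Qed.

Lemma km_grN i x : km_gr Y i x -> km_gr Y i (- x).
Proof. by move=> hx; rewrite -scaleN1r; exact: km_grZ. Qed.

Lemma km_grB i x y : km_gr Y i x -> km_gr Y i y -> km_gr Y i (x - y).
Proof. by move=> hx hy; apply: km_grD => //; exact: km_grN. Qed.

Lemma km_gr_sum (T : Type) (r : seq T) (P : pred T) (F : T -> Y) i :
  (forall t, P t -> km_gr Y i (F t)) -> km_gr Y i (\sum_(t <- r | P t) F t).
Proof. by move=> h; apply: big_ind => //; [exact: km_gr0 kY _|exact: km_grD]. Qed.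

End GradedSubmodules.

Definition kmorph (Q : comNzRingType) (N : nat) (X Y : kmod Q)
    (u : {linear X -> Y}) : Prop :=
  [/\ forall i x, km_gr X i x -> km_gr Y i (u x),
      forall x, u (km_d X x) = km_d Y (u x) &
      forall l x, (l < N)%N -> u (km_op X l x) = km_op Y l (u x)].

Definition kqis (Q : comNzRingType) (X Y : kmod Q) (u : {linear X -> Y}) : Prop :=
  (forall i z, km_gr X i z -> km_d X z = 0 ->
     (exists2 y, km_gr Y (i + 1) y & u z = km_d Y y) ->
     exists2 x, km_gr X (i + 1) x & z = km_d X x) /\
  (forall i w, km_gr Y i w -> km_d Y w = 0 ->
     exists z y, [/\ km_gr X i z, km_gr Y (i + 1) y, km_d X z = 0 & w = u z + km_d Y y]).

(** [P] selects the degrees where homology has to vanish: acyclicity of a finite free complex is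
    proved from below, one degree at a time. *)
Definition kacyclic (Q : comNzRingType) (P : int -> Prop) (Y : kmod Q) : Prop :=
  forall i, P i -> forall z, km_gr Y i z -> km_d Y z = 0 ->
    exists2 x, km_gr Y (i + 1) x & z = km_d Y x.

(** * Mapping cones *)

Section Cone.
Variables (Q : comNzRingType) (N : nat) (sc : nat -> Q) (X Y : kmod Q).
Variable (u : {linear X -> Y}).

Definition cone_d_fun (v : Y * X) : Y * X := (km_d Y v.1 + u v.2, - km_d X v.2).

Fact cone_d_linear : linear cone_d_fun.
Proof.
move=> q [a b] [a' b']; rewrite /cone_d_fun /=.
congr pair; first by rewrite !linearP /= scalerDr addrACA.
by rewrite [km_d X _]linearP /= opprD scalerN.
Qed.

Definition cone_op_fun l (v : Y * X) : Y * X := (km_op Y l v.1, - km_op X l v.2).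

Fact cone_op_linear l : linear (cone_op_fun l).
Proof.
move=> q [a b] [a' b']; rewrite /cone_op_fun /=.
congr pair; first by rewrite [km_op Y l _]linearP.
by rewrite [km_op X l _]linearP /= opprD scalerN.
Qed.

Definition cone_gr (i : int) : set (Y * X) :=
  [set v | km_gr Y i v.1 /\ km_gr X (i - 1) v.2].

Definition cone : kmod Q :=
  @KMod Q (Y * X)%type cone_gr (mklin cone_d_linear) (fun l => mklin (cone_op_linear l)).

Hypotheses (kX : koszul N sc X) (kY : koszul N sc Y) (hu : kmorph N u).

Lemma cone_koszul : koszul N sc cone.
Proof.
case: hu => ugr ud uop.
split.
- by move=> i; split; [exact: km_gr0 kY _|exact: km_gr0 kX _].
- move=> i q [a b] [a' b'] [/= ha hb] [/= ha' hb'].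
  by split; [exact: km_grP kY _ _ _ _ _ _|exact: km_grP kX _ _ _ _ _ _].
- move=> i [a b] [/= ha hb]; split => /=.
    by apply: (km_grD kY); [exact: km_d_gr kY _ _ _|exact: ugr].
  by apply: (km_grN kX); exact: km_d_gr kX _ _ _.
- move=> [a b]; rewrite /= /cone_d_fun /=; congr pair.
    by rewrite linearD (km_dd kY) add0r linearN /= ud subrr.
  by rewrite linearN /= (km_dd kX) oppr0 oppr0.
- move=> l i [a b] hl [/= ha hb]; split => /=; first exact: km_op_gr kY _ _ _ _ _.
  apply: (km_grN kX); have -> : i + 1 - 1 = i - 1 + 1 by ring.
  exact: km_op_gr kX _ _ _ _ _.
- move=> l l' [a b] hl hl'; rewrite /= /cone_op_fun /=; congr pair.
    exact: km_anti kY _ _ _ _ _.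
  by rewrite [km_op X l (- _)]linearN [km_op X l' (- _)]linearN !opprK (km_anti kX).
- move=> l [a b] hl; rewrite /= /cone_op_fun /=; congr pair.
    exact: km_sq kY _ _ _.
  by rewrite [km_op X l (- _)]linearN opprK; exact: km_sq kX _ _ _.
- move=> l [a b] hl; rewrite /= /cone_op_fun /cone_d_fun /=; congr pair.
    by rewrite (km_leib kY) // linearN /= [km_op Y l (_ + _)]linearD uop //= opprD addrA.
  rewrite [km_d X (- _)]linearN [km_op X l (- _)]linearN (km_leib kX) //.
  by rewrite !opprK.
Qed.

Lemma cone_acyclic : kqis u -> kacyclic (fun=> True) cone.
Proof.
case=> uinj usurj i _ [a b] [/= ha hb] [dab /eqP]; rewrite oppr_eq0 => /eqP db.
case: hu => ugr ud uop.
have [|x hx bx] := uinj _ _ hb db.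
  exists (- a); last by rewrite linearN; apply/eqP; rewrite -addr_eq0 addrC dab.
  by rewrite subrK; exact: (km_grN kY).
rewrite subrK in hx.
have [||z [y [hz hy dz e]]] := usurj i (a + u x).
- by apply: (km_grD kY) => //; exact: ugr.
- by rewrite linearD /= -ud -bx dab.
exists (y, z - x).
  by split => //=; rewrite addrK; exact: (km_grB kX).
rewrite /= /cone_d_fun /=; congr pair.
  by rewrite linearB addrA [_ + u z]addrC -e addrK.
by rewrite linearB /= dz sub0r opprK.
Qed.

End Cone.

(** * Twisted families over an extension of the base ring *)

(** The diagonal is a separate hypothesis because antisymmetry only says that twice [g l l] is 0. *)
Lemma alternating_sum (V : zmodType) (N : nat) (g : nat -> nat -> V) :
  (forall l m, (l < N)%N -> (m < N)%N -> g l m = - g m l) ->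
  (forall l, (l < N)%N -> g l l = 0) ->
  \sum_(l < N) \sum_(m < N) g l m = 0.
Proof.
elim: N => [|N IH] anti sq; first by rewrite big_ord0.
rewrite big_ord_recr /= [X in _ + X]big_ord_recr /= sq // addr0.
under eq_bigr do rewrite big_ord_recr /=.
rewrite big_split /= IH ?add0r -?big_split /=; first last.
- by move=> l hl; apply: sq; exact: ltnW.
- by move=> l m hl hm; apply: anti; exact: ltnW.
by rewrite big1 // => l _; rewrite anti ?addNr // ltnW //= ltnS.
Qed.

Section Families.
Variables (Q B : comNzRingType) (iota : {rmorphism Q -> B}).

(** Q-linearity of maps out of B, whose Q-module structure exists only through [iota]. *)
Definition ilin (V : lmodType Q) (g : B -> V) : Prop :=
  forall q b b', g (iota q * b + b') = q *: g b + g b'.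

Section Ilin.
Variables (V : lmodType Q) (g : B -> V).
Hypothesis gl : ilin g.

Lemma ilinD b b' : g (b + b') = g b + g b'.
Proof. by have := gl 1 b b'; rewrite rmorph1 mul1r scale1r. Qed.

Lemma ilin0 : g 0 = 0.
Proof. by have /eqP := ilinD 0 0; rewrite addr0 -subr_eq0 opprD addNKr oppr_eq0 => /eqP. Qed.

Lemma ilinZ q b : g (iota q * b) = q *: g b.
Proof. by rewrite -[iota q * b]addr0 gl ilin0 addr0. Qed.

Lemma ilin_sum (T : Type) (r : seq T) (P : pred T) (F : T -> B) :
  g (\sum_(t <- r | P t) F t) = \sum_(t <- r | P t) g (F t).
Proof. exact: (big_morph _ ilinD ilin0). Qed.

Lemma ilinM s : ilin (fun b => g (s * b)).
Proof. by move=> q b b'; rewrite mulrDr mulrCA gl. Qed.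

End Ilin.

Variables (N : nat) (sc : nat -> Q) (a : nat -> B).

Section OneModule.
Variable Y : kmod Q.

(* [TT] is the degreewise completed version of Hom_Q(B, Y): the component [y i]
   takes values in degree [i] and vanishes for [i] small. *)
Definition TT (y : int -> B -> Y) : Prop :=
  [/\ forall i b, km_gr Y i (y i b), forall i, ilin (y i) &
      exists i0, forall i, i < i0 -> forall b, y i b = 0].

(** The operators raise and [km_d] lowers the homological degree, so component [i] collects
    contributions from [i - 1] and [i + 1]. Multiplication by [a l] acts on the argument of a
    family. *)
Definition DD (y : int -> B -> Y) (i : int) (b : B) : Y :=
  \sum_(l < N) km_op Y l (y (i - 1) (a l * b)) - km_d Y (y (i + 1) b).

Definition vanish (I : set B) (y : int -> B -> Y) : Prop :=
  forall i b, I b -> y i b = 0.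

(* [s] annihilates the homology of the families vanishing on [I]. *)
Definition Kill (I : set B) (s : B) : Prop :=
  forall y, TT y -> vanish I y -> (forall i b, DD y i b = 0) ->
  exists w, [/\ TT w, vanish I w & forall i b, y i (s * b) = DD w i b].

Lemma DDB y y' i b : DD (fun i b => y i b - y' i b) i b = DD y i b - DD y' i b.
Proof.
rewrite /DD linearB /=; under eq_bigr do rewrite linearB.
by rewrite sumrB !opprD addrACA.
Qed.

Lemma DDD y y' i b : DD (fun i b => y i b + y' i b) i b = DD y i b + DD y' i b.
Proof.
rewrite /DD linearD /= opprD; under eq_bigr do rewrite linearD.
by rewrite big_split /= addrACA.
Qed.

Lemma DDN y i b : DD (fun i b => - y i b) i b = - DD y i b.
Proof.
rewrite /DD linearN opprB opprK addrC; congr (_ + _).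
by rewrite -sumrN; apply: eq_bigr => l _; rewrite linearN.
Qed.

Lemma DDM y s i b : DD (fun i b => y i (s * b)) i b = DD y i (s * b).
Proof. by rewrite /DD; congr (_ - _); apply: eq_bigr => l _; rewrite mulrCA. Qed.

Hypothesis kY : koszul N sc Y.

Lemma TT0 : TT (fun _ _ => 0).
Proof.
split; [by move=> *; exact: km_gr0 kY _| |by exists 0].
by move=> i q b b'; rewrite scaler0 addr0.
Qed.

Lemma TTD y y' : TT y -> TT y' -> TT (fun i b => y i b + y' i b).
Proof.
move=> [yg yl [i0 y0]] [yg' yl' [i0' y0']]; split.
- by move=> i b; exact: (km_grD kY).
- by move=> i q b b'; rewrite yl yl' scalerDr addrACA.
exists (Num.min i0 i0') => i; rewrite lt_min => /andP[h h'] b.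
by rewrite y0 // y0' // addr0.
Qed.

Lemma TTN y : TT y -> TT (fun i b => - y i b).
Proof.
move=> [yg yl [i0 y0]]; split.
- by move=> i b; exact: (km_grN kY).
- by move=> i q b b'; rewrite yl opprD scalerN.
by exists i0 => i hi b; rewrite y0 // oppr0.
Qed.

Lemma TTB y y' : TT y -> TT y' -> TT (fun i b => y i b - y' i b).
Proof. by move=> h h'; exact: (TTD h (TTN h')). Qed.

Lemma TTM y s : TT y -> TT (fun i b => y i (s * b)).
Proof.
move=> [yg yl [i0 y0]]; split=> [//|i|]; first exact: ilinM.
by exists i0 => i hi b; rewrite y0.
Qed.

Lemma TT_DD y : TT y -> TT (DD y).
Proof.
move=> [yg yl [i0 y0]]; split.
- move=> i b; apply: (km_grB kY).
    apply: (km_gr_sum kY) => l _; rewrite -{1}[i](subrK 1).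
    exact: km_op_gr kY _ _ _ _ _.
  by rewrite -{1}[i](addrK 1); exact: km_d_gr kY _ _ _.
- move=> i q b b'; rewrite /DD yl linearP /= scalerBr scaler_sumr opprD addrACA.
  congr (_ + _); rewrite -big_split /=; apply: eq_bigr => l _.
  by rewrite (ilinM (yl _)) linearP.
exists (i0 - 1) => i hi b.
rewrite /DD y0; last by lia.
by rewrite raddf0 subr0 big1 // => l _; rewrite y0 ?raddf0 //; lia.
Qed.

Hypothesis asc : \sum_(l < N) a l * iota (sc l) = 0.

(** The terms with two operators cancel in pairs, and the Leibniz rule leaves only multiplication by
    the sum in [asc]. *)
Lemma DD_DD y i b : TT y -> DD (DD y) i b = 0.
Proof.
move=> [yg yl _].
have E1 : \sum_(l < N) \sum_(m < N)
    km_op Y l (km_op Y m (y (i - 1 - 1) (a m * (a l * b)))) = 0.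
  apply: (@alternating_sum Y N (fun l m => km_op Y l (km_op Y m (y (i - 1 - 1) (a m * (a l * b)))))).
    by move=> l m hl hm; rewrite (km_anti kY) // mulrCA.
  by move=> l hl; rewrite (km_sq kY).
have E2 : \sum_(l < N) sc l *: y i (a l * b) = 0.
  have -> : \sum_(l < N) sc l *: y i (a l * b)
          = y i ((\sum_(l < N) a l * iota (sc l)) * b).
    rewrite mulr_suml (ilin_sum (yl i)); apply: eq_bigr => l _.
    by rewrite -(ilinZ (yl i)); congr (y i _); rewrite mulrCA mulrA.
  by rewrite asc mul0r (ilin0 (yl i)).
rewrite /DD !subrK !addrK linearB /= (km_dd kY) subr0.
under eq_bigr do rewrite linearB linear_sum /=.
rewrite sumrB E1 sub0r [km_d Y _]linear_sum /=.
have -> : \sum_(l < N) km_d Y (km_op Y l (y i (a l * b))) =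
    \sum_(l < N) (sc l *: y i (a l * b) - km_op Y l (km_d Y (y i (a l * b)))).
  by apply: eq_bigr => l _; rewrite (km_leib kY).
by rewrite sumrB E2 sub0r opprK addNr.
Qed.

End OneModule.

(** Projectivity of B over Q, phrased for Q-linear relations instead of surjections: a relation
    solvable at every point has a Q-linear solution. The relation can then carry degree conditions,
    as graded pieces are mere predicates. *)
Definition fam_proj : Prop :=
  forall (V W : lmodType Q) (R : V -> W -> Prop),
  (forall q r x r' x', R r x -> R r' x' -> R (q *: r + r') (q *: x + x')) ->
  forall g : B -> V, ilin g -> (forall b, exists x, R (g b) x) ->
  exists w : B -> W, ilin w /\ forall b, R (g b) (w b).

Hypothesis Bproj : fam_proj.
Hypothesis asc : \sum_(l < N) a l * iota (sc l) = 0.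

(** * Twisted families with values in an acyclic complex *)

Section Acyclic.
Variables (C : kmod Q) (kC : koszul N sc C) (Cac : kacyclic (fun=> True) C).
Variables (y : int -> B -> C) (yT : TT y) (yD : forall i b, DD y i b = 0).

Let rhs (i : int) (u : B -> C) (b : B) : C :=
  \sum_(l < N) km_op C l (u (a l * b)) - y i b.

(** Each equation links the components of degrees [i - 1] and [i + 1], so the recursion carries two
    consecutive components [u] and [v], with the cycle conditions that make the next two equations
    solvable. *)
Let good (i : int) (u v : B -> C) : Prop :=
  [/\ ilin u, forall b, km_gr C (i - 1) (u b), ilin v, forall b, km_gr C i (v b) &
      forall b, km_d C (rhs i u b) = 0 /\ km_d C (rhs (i + 1) v b) = 0].

Let rhs_gr i u b : (forall b, km_gr C (i - 1) (u b)) -> km_gr C i (rhs i u b).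
Proof.
case: yT => yg _ _ ug; apply: (km_grB kC) => //.
apply: (km_gr_sum kC) => l _; rewrite -[i](subrK 1).
exact: km_op_gr kC _ _ _ _ _.
Qed.

Let rhs_lin i u : ilin u -> ilin (rhs i u).
Proof.
case: yT => _ yl _ ul q b b'; rewrite /rhs yl scalerBr scaler_sumr opprD addrACA.
congr (_ + _); rewrite -big_split /=; apply: eq_bigr => l _.
by rewrite (ilinM ul) linearP.
Qed.

Let extend i u v : good i u v ->
  exists w, good (i + 1) v w /\ forall b, km_d C (w b) = rhs i u b.
Proof.
case: yT => yg yl _ [ul ug vl vg dr].
have [|||w [wl wR]] := @Bproj C C (fun r x => km_gr C (i + 1) x /\ km_d C x = r) _ (rhs i u).
- move=> q r x r' x' [gx <-] [gx' <-]; rewrite linearP.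
  by split=> //; exact: km_grP kC _ _ _ _ _ _.
- exact: rhs_lin.
- by move=> b; have [x gx ->] := Cac I (rhs_gr b ug) (dr b).1; exists x.
exists w; split=> [|b]; last by have [] := wR b.
split=> [//|b|//|b|b]; rewrite ?addrK //; first by have [] := wR b.
split; first by have [] := dr b.
rewrite /rhs linearB /= linear_sum /=.
under eq_bigr do rewrite (km_leib kC) //.
rewrite sumrB; have -> : \sum_(l < N) sc l *: w (a l * b) = 0.
  have -> : \sum_(l < N) sc l *: w (a l * b)
          = w ((\sum_(l < N) a l * iota (sc l)) * b).
    rewrite mulr_suml (ilin_sum wl); apply: eq_bigr => l _.
    by rewrite -(ilinZ wl); congr (w _); rewrite mulrCA mulrA.
  by rewrite asc mul0r (ilin0 wl).
under eq_bigr do rewrite (wR _).2 /rhs linearB linear_sum /=.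
rewrite sumrB (@alternating_sum C N (fun l m => km_op C l (km_op C m (u (a m * (a l * b)))))).
- have := yD (i + 1) b; rewrite /DD !addrK => /eqP; rewrite subr_eq0 => /eqP ->.
  by rewrite !sub0r opprK subrr.
- by move=> l m hl hm; rewrite (km_anti kC) // mulrCA.
- by move=> l hl; rewrite (km_sq kC).
Qed.

(** The equation of degree [i] is solved for the component of degree [i + 1], starting from zero
    components at the lower bound of [y]. *)
Lemma TT_acyclic : exists w, TT w /\ forall i b, y i b = DD w i b.
Proof.
have [yg yl [i0 y0]] := yT.
have /choice[nx nxP] : forall t : int * ((B -> C) * (B -> C)), exists w,
    good t.1 t.2.1 t.2.2 ->
    good (t.1 + 1) t.2.2 w /\ forall b, km_d C (w b) = rhs t.1 t.2.1 b.
  move=> [i [u v]] /=; have [/extend[w wP]|ng] := pselect (good i u v); first by exists w.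
  by exists u.
(* [W j] holds the components of degrees [i0 + j - 1] and [i0 + j]. *)
pose W := fix W (j : nat) : (B -> C) * (B -> C) := if j is j'.+1
  then ((W j').2, nx (i0 + j'%:Z, W j')) else (fun=> 0, fun=> 0).
have gW j : good (i0 + j%:Z) (W j).1 (W j).2.
  elim: j => [|j IH] /=; last first.
    have [+ _] := nxP (_, W j) IH; by have -> : i0 + Posz j.+1 = i0 + Posz j + 1 by lia.
  rewrite addr0; split=> [q b b'|b|q b b'|b|b]; rewrite ?scaler0 ?addr0 //;
    try exact: km_gr0 kC _.
  have := yD (i0 - 1) b; rewrite /DD subrK big1 ?sub0r => [|l _]; last first.
    by rewrite y0 ?linear0 //; lia.
  have := yD i0 b; rewrite /DD big1 ?sub0r => [|l _]; last by rewrite y0 ?linear0 //; lia.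
  by move=> e1 e2; rewrite /rhs !big1 ?sub0r ?linearN // => l _; rewrite linear0.
have dW j b : km_d C ((W j.+1).2 b) = rhs (i0 + j%:Z) (W j).1 b.
  by have [_] := nxP (_, W j) (gW j); apply.
pose w (i : int) := if i0 <= i then (W `|i - i0|%N).2 else (fun=> 0).
have w1 j : w (i0 + j%:Z - 1) =1 (W j).1.
  move=> b; rewrite /w; case: j => [|j]; first by rewrite ifN //; lia.
  rewrite ifT; last by lia.
  by have -> : `|(i0 + j.+1%:Z - 1 - i0)%R|%N = j by lia.
exists w; split.
  split.
  - move=> i b; rewrite /w; case: ifPn => [h|_]; last exact: km_gr0 kC _.
    have [_ _ _ + _] := gW `|i - i0|%N => /(_ b).
    by have -> : i0 + Posz `|i - i0|%N = i by lia.
  - move=> i; rewrite /w; case: ifPn => [h|_] q b b'; last by rewrite scaler0 addr0.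
    by have [_ _ wl _ _] := gW `|i - i0|%N; exact: wl.
  - by exists i0 => i hi b; rewrite /w ifN // -ltNge.
move=> i b; have [hi|hi] := leP i0 i; last first.
  rewrite y0 // /DD big1 ?sub0r => [|l _]; last first.
    by rewrite /w ifN ?linear0 // -ltNge; lia.
  rewrite /w; case: ifPn => [h|_]; last by rewrite linear0 oppr0.
  have e : i + 1 - i0 = 0 by lia.
  by rewrite e /= linear0 oppr0.
have [j ->] : exists j : nat, i = i0 + j%:Z by exists `|i - i0|%N; lia.
rewrite /DD.
have -> : w (i0 + j%:Z + 1) = (W j.+1).2.
  rewrite /w ifT; last by lia.
  by have -> : `|(i0 + j%:Z + 1 - i0)%R|%N = j.+1 by lia.
rewrite dW /rhs opprB; under eq_bigr do rewrite w1.
by rewrite [RHS]addrC subrK.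
Qed.

End Acyclic.

(** * Invariance of annihilators under quasi-isomorphisms *)

Section Invariance.
Variables (X Y : kmod Q) (kX : koszul N sc X) (kY : koszul N sc Y).
Variables (u : {linear X -> Y}) (hu : kmorph N u) (qu : kqis u).

Lemma DD_morph y i b : u (DD y i b) = DD (fun i b => u (y i b)) i b.
Proof.
case: hu => _ ud uop; rewrite /DD linearB linear_sum /= ud; congr (_ - _).
by apply: eq_bigr => l _; rewrite uop.
Qed.

Lemma TT_morph y : TT y -> TT (fun i b => u (y i b)).
Proof.
case: hu => ug _ _ [yg yl [i0 y0]]; split=> [i b|i q b b'|]; first exact: ug.
  by rewrite yl linearP.
by exists i0 => i hi b; rewrite y0 // linear0.
Qed.

Let coneT (y : int -> B -> Y) (x : int -> B -> X) : int -> B -> cone u :=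
  fun i b => (y i b, x (i - 1) b).

Let cone_split (w : int -> B -> cone u) : TT w ->
  TT (fun i b => (w i b).1) /\ TT (fun i b => (w (i + 1) b).2).
Proof.
move=> [wg wl [i0 w0]]; split; split.
- by move=> i b; have [] := wg i b.
- by move=> i q b b'; rewrite wl.
- by exists i0 => i hi b; rewrite w0.
- by move=> i b; have [] := wg (i + 1) b; rewrite addrK.
- by move=> i q b b'; rewrite wl.
- by exists (i0 - 1) => i hi b; rewrite w0 //; lia.
Qed.

Let pair_sum (T : Type) (r : seq T) (F : T -> Y * X) :
  \sum_(t <- r) F t = (\sum_(t <- r) (F t).1, \sum_(t <- r) (F t).2).
Proof.
by elim: r => [|t r IH]; rewrite ?big_nil // !big_cons IH; case: (F t).
Qed.

Let DD_cone (w : int -> B -> cone u) i b : DD w i b =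
  (DD (fun i b => (w i b).1) i b - u (w (i + 1) b).2,
   - DD (fun i b => (w (i + 1) b).2) (i - 1) b).
Proof.
rewrite /DD pair_sum; congr pair; first by rewrite /= opprD addrA.
rewrite /= !subrK opprB opprK addrC; congr (_ + _).
by rewrite -sumrN.
Qed.

Let TT_coneT w y : TT w -> TT y -> TT (coneT w y).
Proof.
move=> [wg wl [i0 w0]] [yg yl [i1 y0]]; split.
- by move=> i b; split=> /=.
- by move=> i q b b'; rewrite /coneT wl yl.
exists (Num.min i0 i1) => i; rewrite lt_min => /andP[h1 h2] b.
by rewrite /coneT w0 // y0 //; lia.
Qed.

(** The pair of [w] and [y] is a cycle of families in the cone, hence a boundary. For a given [y]
    this yields injectivity on twisted homology, and with [y = 0] surjectivity. *)
Let cone_boundary w y : TT w -> TT y ->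
  (forall i b, DD w i b = u (y i b)) -> (forall i b, DD y i b = 0) ->
  exists v x, [/\ TT v, TT x, forall i b, w i b = DD v i b + u (x i b) &
                 forall i b, y i b = DD x i b].
Proof.
move=> wT yT wy y0.
have [i b|q [qT qE]] := TT_acyclic (cone_koszul kX kY hu) (cone_acyclic kX kY hu qu)
  (TT_coneT wT yT).
  rewrite DD_cone /coneT /= addrK; congr pair; first by rewrite -wy subrr.
  have -> : (fun i b => y (i + 1 - 1) b) = y by apply/funext => j; rewrite addrK.
  by rewrite y0 oppr0.
have [qT1 qT2] := cone_split qT.
exists (fun i b => (q i b).1), (fun i b => - (q (i + 1) b).2).
split=> [//||i b|i b]; first exact: TTN kX _ _.
  by have := qE i b; rewrite DD_cone => -[-> _]; rewrite linearN.
have := qE (i + 1) b; rewrite DD_cone /coneT !addrK => -[_ ->].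
by rewrite DDN.
Qed.

Lemma qis_boundary_lift y w : TT y -> (forall i b, DD y i b = 0) ->
  TT w -> (forall i b, u (y i b) = DD w i b) ->
  exists v, TT v /\ forall i b, y i b = DD v i b.
Proof.
move=> yT yD wT wD.
have [v [x [_ xT _ xE]]] := cone_boundary wT yT (fun i b => esym (wD i b)) yD.
by exists x.
Qed.

Lemma qis_cycle_lift w : TT w -> (forall i b, DD w i b = 0) ->
  exists y v, [/\ TT y, TT v, forall i b, DD y i b = 0 &
                 forall i b, w i b = u (y i b) + DD v i b].
Proof.
move=> wT wD; have z0 : forall i b, @DD X (fun _ _ => 0) i b = 0.
  by move=> i b; rewrite /DD linear0 subr0 big1 // => l _; rewrite linear0.
have [|v [x [vT xT wE xE]]] := cone_boundary wT (TT0 kX) _ z0.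
  by move=> i b; rewrite linear0.
by exists x, v; split=> // i b; rewrite addrC.
Qed.

Lemma Kill_qis s : Kill X [set 0] s <-> Kill Y [set 0] s.
Proof.
have van0 (Z : kmod Q) (y : int -> B -> Z) : TT y -> vanish [set 0] y.
  by move=> [_ yl _] i b ->; exact: ilin0.
split=> K y yT _ yD.
  have [x [v [xT vT xD yE]]] := qis_cycle_lift yT yD.
  have [x' [x'T _ x'E]] := K x xT (van0 _ _ xT) xD.
  exists (fun i b => u (x' i b) + v i (s * b)).
  have T1 := TT_morph x'T; have T2 := TTM s vT.
  split; [exact: (TTD kY)|exact/van0/(TTD kY)|move=> i b].
  by rewrite DDD DDM -DD_morph -x'E yE.
have [i b|w [wT _ wE]] := K _ (TT_morph yT) (van0 _ _ (TT_morph yT)).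
  by rewrite -DD_morph yD linear0.
have [|x [xT xE]] := qis_boundary_lift (TTM s yT) _ wT wE.
  by move=> i b; rewrite DDM yD.
by exists x; split=> //; exact: van0.
Qed.

End Invariance.

End Families.

(** * The ghost lemma *)

Section Words.
Variables (Q : comNzRingType) (V : lmodType Q) (h : nat) (xi : nat -> {linear V -> V}).

Fixpoint killed (m : nat) (v : V) : Prop :=
  if m is m'.+1 then forall c, (c < h)%N -> killed m' (xi c v) else v = 0.

Lemma killed0 m : killed m 0.
Proof. by elim: m => //= m IH c _; rewrite linear0. Qed.

Lemma killedD m v w : killed m v -> killed m w -> killed m (v + w).
Proof.
elim: m v w => [|m IH] v w /=; first by move=> -> ->; rewrite addr0.
by move=> kv kw c hc; rewrite linearD; apply: IH; [exact: kv|exact: kw].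
Qed.

Lemma killedN m v : killed m v -> killed m (- v).
Proof.
elim: m v => [|m IH] v /=; first by move=> ->; rewrite oppr0.
by move=> kv c hc; rewrite linearN; apply: IH; exact: kv.
Qed.

Hypotheses (xi_anti : forall c c' v, (c < h)%N -> (c' < h)%N ->
    xi c (xi c' v) = - xi c' (xi c v))
  (xi_sq : forall c v, (c < h)%N -> xi c (xi c v) = 0).

(** Pigeonhole: [A] collects letters already known to annihilate the current vector. Applying a
    letter outside [A] enlarges [A], since anticommutation preserves the old ones; applying a letter
    of [A] gives 0. *)
Lemma killed_anti v : killed h.+1 v.
Proof.
suff K m (A : {set 'I_h}) w : (forall c, c \in A -> xi c w = 0) -> (h < m + #|A|)%N -> killed m w.
  by apply: (K h.+1 finset.set0) => [c|]; rewrite ?inE // cards0 addn0.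
elim: m A w => [|m IH] A w Aw hA; first by move: (leq_trans hA (max_card _)); rewrite card_ord ltnn.
move=> c hc; have [cA|cA] := boolP (Ordinal hc \in A).
  by have := Aw _ cA => /= ->; exact: killed0.
apply: (IH (Ordinal hc |: A)%SET) => [c'|].
  rewrite !inE => /orP[/eqP->|c'A]; first exact: xi_sq.
  by rewrite xi_anti // Aw // linear0 oppr0.
by rewrite cardsU1 cA add1n addnS -addSn.
Qed.

End Words.

Section Ghost.
Variables (Q B : comNzRingType) (iota : {rmorphism Q -> B}).

Definition ext_ideal (I : set B) (t : B) : set B :=
  [set x | exists b c, I c /\ x = t * b + c].

Lemma ext_idealP I t : ideal I -> ideal (ext_ideal I t).
Proof.
move=> [I0 ID IM]; split.
- by exists 0, 0; rewrite mulr0 addr0.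
- move=> _ _ [b [c [Ic ->]]] [b' [c' [Ic' ->]]].
  by exists (b + b'), (c + c'); split; [exact: ID|rewrite mulrDr addrACA].
- move=> x _ [b [c [Ic ->]]]; exists (x * b), (x * c); split; first exact: IM.
  by rewrite mulrDr mulrCA.
Qed.

(* A regular sequence modulo [I] whose multiplications admit Q-linear left
   inverses [rho] modulo the preceding elements. *)
Fixpoint split_regular (I : set B) (l : seq (B * (B -> B))) : Prop :=
  if l is (t, rho) :: l' then
    [/\ forall q b b', rho (iota q * b + b') = iota q * rho b + rho b',
        forall b, I b -> I (rho b), forall b, I (rho (t * b) - b) &
        split_regular (ext_ideal I t) l']
  else True.

Variables (N : nat) (sc : nat -> Q) (a : nat -> B) (Y : kmod Q).
Hypotheses (kY : koszul N sc Y) (asc : \sum_(l < N) a l * iota (sc l) = 0).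

Local Notation TT := (@TT Q B iota Y).
Local Notation DD := (@DD Q B N a Y).
Local Notation Kill := (@Kill Q B iota N a Y).

Lemma vanish_DD I y : ideal I -> vanish I y -> vanish I (DD y).
Proof.
move=> [_ _ IM] yI i b Ib; rewrite /DD (yI (i + 1)) // linear0 subr0 big1 // => l _.
by rewrite yI ?linear0 //; exact: IM.
Qed.

Lemma TT_comp y (rho : B -> B) :
  (forall q b b', rho (iota q * b + b') = iota q * rho b + rho b') ->
  TT y -> TT (fun i b => y i (rho b)).
Proof.
move=> rl [yg yl [i0 y0]]; split=> [//|i q b b'|]; first by rewrite rl yl.
by exists i0 => i hi b; rewrite y0.
Qed.

Section Step.
Variables (I : set B) (t : B) (rho : B -> B).
Hypotheses (idI : ideal I)
  (rl : forall q b b', rho (iota q * b + b') = iota q * rho b + rho b')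
  (rI : forall b, I b -> I (rho b)) (rt : forall b, I (rho (t * b) - b)).

Let sub_ext b : I b -> ext_ideal I t b.
Proof. by exists 0, b; rewrite mulr0 add0r. Qed.

Let comp_section y i b : TT y -> vanish I y -> y i (rho (t * b)) = y i b.
Proof.
move=> [_ yl _] yI; have -> : rho (t * b) = b + (rho (t * b) - b) by rewrite addrC subrK.
by rewrite (ilinD (yl i)) (yI i (_ - b)) ?addr0.
Qed.

Let vanish_ext y : TT y -> vanish I y -> (forall i b, y i (t * b) = 0) ->
  vanish (ext_ideal I t) y.
Proof.
by move=> [_ yl _] yI yt i _ [b [c [Ic ->]]]; rewrite (ilinD (yl i)) yt yI // addr0.
Qed.

(** Families vanishing on [ext_ideal I t] are the kernel of multiplication by [t] on the families
    vanishing on [I], and composition with [rho] shows this multiplication to be surjective. The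
    homology of the kernel is thus an extension of two pieces annihilated by [s]. *)
Lemma Kill_ext s : Kill I s -> Kill (ext_ideal I t) (s * s).
Proof.
move=> K z zT zI zD; have zI' : vanish I z by move=> i b /sub_ext; exact: zI.
have [w [wT wI wE]] := K z zT zI' zD.
have [i b|i b|v [vT vI vE]] := K (fun i b => w i (t * b)) (TTM t wT).
- by move=> Ib; apply: wI; case: idI => _ _; apply.
- rewrite DDM -wE; apply: zI; exists (s * b), 0; split; first by case: idI.
  by rewrite addr0 mulrCA.
have vT' := TT_comp rl vT; have DvT := TT_DD a kY vT'.
exists (fun i b => w i (s * b) - DD (fun i b => v i (rho b)) i b); split.
- exact: (TTB kY (TTM s wT) DvT).
- apply: vanish_ext; first exact: (TTB kY (TTM s wT) DvT).
    move=> i b Ib; rewrite wI ?sub0r; last by case: idI => _ _; apply.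
    by rewrite (vanish_DD idI) ?oppr0 // => j c Ic; apply: vI; exact: rI.
  move=> i b; rewrite -DDM mulrCA vE; apply/eqP; rewrite subr_eq0; apply/eqP.
  congr (DD _ _ _); apply/funext => j; apply/funext => c.
  by rewrite comp_section.
- by move=> i b; rewrite DDB DDM -wE (DD_DD kY asc) ?subr0 ?mulrA // TT_comp.
Qed.

(** [DD] of [z] composed with [rho] represents the connecting homomorphism of the same exact
    sequence; it is injective on homology because [t] acts there as 0. *)
Lemma ghost_lift z : Kill I t -> TT z -> vanish I z -> (forall i b, DD z i b = 0) ->
  [/\ TT (DD (fun i b => z i (rho b))),
      vanish (ext_ideal I t) (DD (fun i b => z i (rho b))) &
      (exists v, [/\ TT v, vanish (ext_ideal I t) v &
          forall i b, DD (fun i b => z i (rho b)) i b = DD v i b]) ->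
      exists w, [/\ TT w, vanish I w & forall i b, z i b = DD w i b]].
Proof.
move=> K zT zI zD; have zT' := TT_comp rl zT.
have zI' : vanish I (fun i b => z i (rho b)) by move=> i b Ib; apply: zI; exact: rI.
split; first exact: (TT_DD a kY zT').
- apply: vanish_ext; [exact: (TT_DD a kY zT')|exact: vanish_DD|move=> i b].
  rewrite -DDM -[RHS](zD i b); congr (DD _ _ _); apply/funext => j; apply/funext => c.
  by rewrite comp_section.
move=> [v [vT vI vE]].
have [||i b|w [wT wI wE]] := K (fun i b => z i (rho b) - v i b).
- exact: (TTB kY).
- by move=> i b Ib; rewrite zI' // vI ?subr0 //; exact: sub_ext.
- by rewrite DDB vE subrr.
exists w; split=> // i b; rewrite -wE comp_section // vI ?subr0 //.
by exists b, 0; rewrite addr0; split=> //; case: idI.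
Qed.

End Step.

Fixpoint KillAll (I : set B) (l : seq (B * (B -> B))) : Prop :=
  if l is (t, _) :: l' then Kill I t /\ KillAll (ext_ideal I t) l' else True.

(** Element number [j] is used after [j] passages to a quotient, each of which squares the
    annihilator; hence the exponent [2 ^ j]. *)
Lemma KillAll_pow I l : ideal I -> split_regular I l ->
  (forall j, (j < size l)%N ->
     exists r, Kill I r /\ (nth (0, id) l j).1 = r ^+ (2 ^ j)) ->
  KillAll I l.
Proof.
elim: l I => //= -[t rho] l IH I idI [rl rI rt sr] h; split.
  by have [r [Kr /= ->]] := h 0 isT.
apply: IH => // [|j hj]; first exact: ext_idealP.
have [r [Kr /= ->]] := h j.+1 hj; exists (r * r); split; first exact: Kill_ext rI rt _ _.
by rewrite -expr2 -exprM expnS.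
Qed.

Variables (h : nat) (xi : nat -> {linear Y -> Y}) (eta : nat -> B).
Hypothesis DDxi : forall y i b, TT y ->
  DD y i b = \sum_(c < h) xi c (y (i - 1) (eta c * b)) - km_d Y (y (i + 1) b).

Local Notation killed := (killed h xi).

Lemma ghost I l m z : ideal I -> split_regular I l -> KillAll I l -> (m <= size l)%N ->
  TT z -> vanish I z -> (forall i b, DD z i b = 0) ->
  (forall i b, killed m (z i b)) ->
  exists w, [/\ TT w, vanish I w & forall i b, z i b = DD w i b].
Proof.
elim: l I m z => [|[t rho] l IH] I [|m] z idI //=; try by
  move=> _ _ _ _ _ _ z0; exists (fun _ _ => 0); split=> //;
  [exact: TT0 kY|move=> i b; rewrite z0 /DD linear0 subr0 big1 // => ? _; rewrite linear0].
move=> [rl rI rt sr] [Kt Kl] hm zT zI zD kz.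
have [T1 V1] := ghost_lift idI rl rI rt Kt zT zI zD; apply.
apply: (IH _ m) => //; first exact: ext_idealP.
  by move=> i b; apply: (DD_DD kY asc); exact: TT_comp.
move=> i b; rewrite DDxi; last exact: TT_comp.
(* The cycle equation of [z] at [rho b] trades [km_d] for the operators [xi], so every value of the
   connecting image is a combination of letters applied to values of [z]: one letter has been
   spent. *)
have /eqP := zD i (rho b); rewrite DDxi // subr_eq0 => /eqP <-.
apply: killedD; last apply: killedN.
  by apply: big_ind => [||c _]; [exact: killed0|exact: killedD|exact: kz].
by apply: big_ind => [||c _]; [exact: killed0|exact: killedD|exact: kz].
Qed.

Lemma Kill_one l : split_regular [set 0] l -> (forall v, killed (size l) v) ->
  (forall j, (j < size l)%N ->
     exists r, Kill [set 0] r /\ (nth (0, id) l j).1 = r ^+ (2 ^ j)) ->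
  Kill [set 0] 1.
Proof.
move=> sr kv h2 z zT zI zD.
have id0 : ideal [set (0 : B)].
  by split=> [//|x y -> ->|x y ->]; rewrite ?addr0 ?mulr0.
have [w [wT wI wE]] := ghost id0 sr (KillAll_pow id0 sr h2) (leqnn _) zT zI zD (fun i b => kv _).
by exists w; split=> // i b; rewrite mul1r.
Qed.

End Ghost.

(** * Tensor products with Koszul complexes *)

Section ZCone.
Variables (Q : comNzRingType) (sc : nat -> Q).

Section OneZCone.
Variables (N : nat) (Y : kmod Q).

Fact zop_linear : linear (fun v : Y * Y => (0 : Y, v.1)).
Proof. by move=> q [x y] [x' y']; congr pair; rewrite /= scaler0 addr0. Qed.

Fact zscale_linear : linear (fun v : Y => sc N *: v).
Proof. by move=> q x y; rewrite scalerDr !scalerA mulrC. Qed.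

(* The tensor product of Y with the Koszul complex on [sc N]. *)
Definition zcone : kmod Q :=
  let C := cone (mklin zscale_linear) in
  @KMod Q C (km_gr C) (km_d C) (fun l => if l == N then mklin zop_linear else km_op C l).

Hypothesis kY : koszul N sc Y.

Lemma zcone_koszul : koszul N.+1 sc zcone.
Proof.
have ku : kmorph N (mklin zscale_linear).
  split=> [i x hx|x|l x hl] /=; [exact: (km_grZ kY)| |]; by rewrite linearZ.
have [g0 gP dg dd og oa os ol] := cone_koszul kY kY ku.
split=> //.
- move=> l i [x y] hl [hx hy]; rewrite /=; case: eqP => [e|ne].
    by split=> /=; [exact: km_gr0 kY _|rewrite addrK].
  by apply: og; [lia|].
- move=> l l' [x y] hl hl' /=; case: (eqVneq l N) => [e|ne]; case: (eqVneq l' N) => [e'|ne'] /=.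
  + by congr pair; rewrite oppr0.
  + by rewrite /cone_op_fun /=; congr pair; rewrite ?linear0 ?oppr0 ?opprK.
  + by rewrite /cone_op_fun /=; congr pair; rewrite ?linear0 ?oppr0.
  by apply: oa; lia.
- move=> l [x y] hl /=; case: (eqVneq l N) => [//|ne].
  by apply: os; lia.
- move=> l [x y] hl /=; case: (eqVneq l N) => [->|ne]; last by apply: ol; lia.
  rewrite /cone_d_fun /=; congr pair; first by rewrite linear0 add0r subr0.
  transitivity (sc N *: y - (km_d Y x + sc N *: y)); last by [].
  by rewrite opprD addrCA subrr addr0.
Qed.

Lemma zcone_acyclic_below i : kacyclic (fun j => j < i) Y -> kacyclic (fun j => j < i) zcone.
Proof.
move=> ac j hj [x y] [/= hx hy]; rewrite /cone_d_fun /= => -[e1 /eqP].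
rewrite oppr_eq0 => /eqP e2.
have [|y1 hy1 ey] := ac (j - 1) _ y hy e2; first by lia.
rewrite subrK in hy1.
have [||x1 hx1 ex] := ac j hj (x + sc N *: y1).
- by apply: (km_grD kY) => //; exact: (km_grZ kY).
- by rewrite linearD linearZ /= -ey.
exists (x1, - y1); first by split=> //=; rewrite addrK; exact: (km_grN kY).
by rewrite /= /cone_d_fun /=; congr pair; rewrite -?ex ?scalerN ?addrK ?linearN ?opprK.
Qed.

End OneZCone.

Section ZConeMap.
Variables (N : nat) (X Y : kmod Q) (kX : koszul N sc X) (kY : koszul N sc Y).
Variables (u : {linear X -> Y}) (hu : kmorph N u).

Fact zmap_linear : linear (fun v : X * X => (u v.1, u v.2)).
Proof. by move=> q [x y] [x' y']; congr pair; rewrite /= linearP. Qed.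

Definition zmap : {linear zcone N X -> zcone N Y} := mklin zmap_linear.

Lemma zmap_morph : kmorph N.+1 zmap.
Proof.
case: hu => ug ud uop; split.
- by move=> i [x y] [hx hy]; split; exact: ug.
- by move=> [x y]; rewrite /= /cone_d_fun /=; congr pair; rewrite ?linearD ?linearN ?linearZ /= ?ud.
- move=> l [x y] hl /=; case: eqP => [e|ne] /=; first by rewrite linear0.
  by rewrite /cone_op_fun /=; congr pair; rewrite ?linearN /= uop //; lia.
Qed.

(** The five lemma for the two layers of the cone, carried out on elements to keep track of
    degrees. *)
Lemma zmap_qis : kqis u -> kqis zmap.
Proof.
case: hu => ug ud uop [uinj usurj]; split.
  move=> i [a b] [/= ha hb]; rewrite /cone_d_fun /= => -[e1 /eqP].
  rewrite oppr_eq0 => /eqP e2 [[y0 y1] [/= hy0 hy1] [ea eb]].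
  rewrite addrK in hy1.
  have [|x1 hx1 bx] := uinj _ _ hb e2.
    by exists (- y1); [rewrite subrK; exact: (km_grN kY)|rewrite linearN].
  rewrite subrK in hx1.
  have [||x2 [y2 [hx2 hy2 dx2 e3]]] := usurj i (y1 + u x1).
  - by apply: (km_grD kY) => //; exact: ug.
  - by rewrite linearD /= -ud -bx eb addrN.
  have [|||x0 hx0 ex0] := uinj i (a + sc N *: x1 - sc N *: x2).
  - by apply: (km_grB kX); [apply: (km_grD kX)|] => //; exact: (km_grZ kX).
  - by rewrite linearB linearD !linearZ /= dx2 oppr0 scaler0 addr0 -bx.
  - exists (y0 + sc N *: y2); first by apply: (km_grD kY) => //; exact: (km_grZ kY).
    rewrite [u (_ - _)]linearB [u (_ + _)]linearD [u (_ *: x1)]linearZ [u (_ *: x2)]linearZ.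
    rewrite [km_d Y (_ + _)]linearD [km_d Y (_ *: _)]linearZ /= ea -addrA -addrA.
    congr (_ + _); rewrite -scalerBr -scalerDr; congr (_ *: _).
    by rewrite addrA e3 addrAC subrr add0r.
  exists (x0, x2 - x1); first by split=> //=; rewrite addrK; exact: (km_grB kX).
  rewrite /= /cone_d_fun /=; congr pair; last by rewrite linearB /= dx2 sub0r opprK.
  by rewrite -ex0 scalerBr addrA subrK addrK.
move=> i [p q] [/= hp hq]; rewrite /cone_d_fun /= => -[e1 /eqP].
rewrite oppr_eq0 => /eqP e2.
have edp : km_d Y p = - (sc N *: q) by apply/eqP; rewrite -addr_eq0 -e1.
have [b [y1 [hb hy1 db eq]]] := usurj _ _ hq e2.
rewrite subrK in hy1.
have [|||x' hx' ex'] := uinj (i - 1) (sc N *: b).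
- exact: (km_grZ kX).
- by rewrite linearZ /= db scaler0.
- rewrite subrK; exists (- p - sc N *: y1).
    by apply: (km_grB kY); [exact: (km_grN kY)|exact: (km_grZ kY)].
  rewrite [u _]linearZ [km_d Y (_ - _)]linearB [km_d Y (- _)]linearN /=.
  by rewrite [km_d Y (_ *: _)]linearZ /= edp opprK eq scalerDr addrK.
rewrite subrK in hx'.
have [||a' [y0 [ha' hy0 da' ep]]] := usurj i (u x' + sc N *: y1 + p).
- apply: (km_grD kY) => //; apply: (km_grD kY); first exact: ug.
  exact: (km_grZ kY).
- rewrite ![km_d Y (_ + _)]linearD [km_d Y (_ *: _)]linearZ /= -ud -ex'.
  by rewrite [u _]linearZ /= -scalerDr -eq edp subrr.
exists (a' - x', b), (y0, - y1); split.
- by split=> //=; exact: (km_grB kX).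
- by split=> //=; rewrite addrK; exact: (km_grN kY).
- rewrite /= /cone_d_fun /=; congr pair; last by rewrite db oppr0.
  by rewrite linearB /= da' sub0r -ex' addNr.
rewrite /= /cone_d_fun /=; congr pair; last by rewrite [km_d Y (- _)]linearN opprK.
have -> : p = u x' + sc N *: y1 + p - (u x' + sc N *: y1) by rewrite addrAC subrr add0r.
by rewrite ep linearB scalerN opprD addrACA.
Qed.

End ZConeMap.

End ZCone.

Section IteratedCone.
Variables (Q : comNzRingType) (sc : nat -> Q).

Fixpoint iter_cone (N e : nat) (Y : kmod Q) : kmod Q :=
  if e is e'.+1 then iter_cone N.+1 e' (zcone sc N Y) else Y.

Lemma iter_cone_koszul N e Y : koszul N sc Y -> koszul (N + e) sc (iter_cone N e Y).
Proof.
elim: e N Y => [|e IH] N Y kY /=; first by rewrite addn0.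
by rewrite addnS -addSn; apply: IH; exact: zcone_koszul.
Qed.

Lemma iter_cone_op0 N e Y l : (l < N)%N -> (forall v, km_op Y l v = 0) ->
  forall v, km_op (iter_cone N e Y) l v = 0.
Proof.
elim: e N Y => [|e IH] N Y hl op0 //= v; apply: IH => [|{}v]; first exact: leqW.
by rewrite /= ifN ?ltn_eqF // /= /cone_op_fun !op0 oppr0.
Qed.

Lemma iter_cone_acyclic_below N e Y i : koszul N sc Y ->
  kacyclic (fun j => j < i) Y -> kacyclic (fun j => j < i) (iter_cone N e Y).
Proof.
elim: e N Y => [|e IH] N Y kY ac //=; apply: IH; first exact: zcone_koszul.
exact: zcone_acyclic_below.
Qed.

(** In the lowest degree, tensoring with the Koszul complex replaces [H_i(Y)] by its quotient modulo
    the elements [sc (N + m)]. The vanishing of this quotient is spelled out here with cycles as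
    coefficients. *)
Lemma iter_cone_decomp N e Y i : koszul N sc Y -> kacyclic (fun j => j < i) Y ->
  (forall v, km_gr (iter_cone N e Y) i v -> km_d (iter_cone N e Y) v = 0 ->
     exists2 w, km_gr (iter_cone N e Y) (i + 1) w & v = km_d (iter_cone N e Y) w) ->
  forall v, km_gr Y i v -> km_d Y v = 0 ->
  exists (y : Y) (c : nat -> Y), [/\ km_gr Y (i + 1) y,
     forall m, km_gr Y i (c m), forall m, km_d Y (c m) = 0 &
     v = km_d Y y + \sum_(m < e) sc (N + m)%N *: c m].
Proof.
elim: e N Y => [|e IH] N Y kY ac /= H v hv dv.
  have [y hy ->] := H v hv dv; exists y, (fun=> 0).
  by split=> // [m|m|]; rewrite ?linear0 ?big_ord0 ?addr0 //; exact: km_gr0 kY _.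
have kZ := zcone_koszul kY.
have [|||[y0 y1] [c [[/= hy0 hy1] hc dc]]] := IH _ _ kZ _ H (v, 0).
- exact: zcone_acyclic_below.
- by split=> //=; exact: km_gr0 kY _.
- by rewrite /= /cone_d_fun /= dv scaler0 linear0 oppr0 addr0.
have E (T : Type) (r : seq T) (F : T -> Y * Y) :
    \sum_(t <- r) F t = (\sum_(t <- r) (F t).1, \sum_(t <- r) (F t).2).
  by elim: r => [|t r IHr]; rewrite ?big_nil // !big_cons IHr; case: (F t).
rewrite addrK in hy1; rewrite E /= /cone_d_fun /= => -[ev /esym/eqP].
rewrite addrC subr_eq0 => /eqP e1.
have d2 m : km_d Y (c m).2 = 0.
  by have := dc m; rewrite /= /cone_d_fun => -[_ /eqP]; rewrite oppr_eq0 => /eqP.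
have d1 m : km_d Y (c m).1 = - (sc N *: (c m).2).
  by have := dc m; rewrite /= /cone_d_fun => -[/eqP + _]; rewrite addr_eq0 => /eqP.
(* The second components are cycles of degree [i - 1], where [Y] is acyclic; bounding them makes it
   possible to correct the first components to cycles. *)
have /choice[p pP] : forall m, exists p, km_gr Y i p /\ (c m).2 = km_d Y p.
  move=> m; have [|p hp ->] := ac (i - 1) _ _ (hc m).2 (d2 m); first by lia.
  by exists p; rewrite subrK in hp.
pose w := y1 - \sum_(m < e) sc (N.+1 + m)%N *: p m.
exists y0, (fun m => if m is m'.+1 then (c m').1 + sc N *: p m' else w); split => //.
- case=> [|m].
    apply: (km_grB kY) => //; apply: (km_gr_sum kY) => m _; apply: (km_grZ kY).
    exact: (pP m).1.
  apply: (km_grD kY); first exact: (hc m).1.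
  by apply: (km_grZ kY); exact: (pP m).1.
- case=> [|m]; last by rewrite linearD linearZ /= -(pP m).2 d1 addNr.
  rewrite /w linearB linear_sum /= -e1; apply/eqP; rewrite subr_eq0; apply/eqP.
  by apply: eq_bigr => m _; rewrite linearZ /= -(pP m).2.
rewrite ev big_ord_recl /= addn0 -!addrA; congr (_ + _).
have -> : \sum_(m < e) sc (N + bump 0 m)%N *: ((c m).1 + sc N *: p m) =
   \sum_(m < e) sc (N.+1 + m)%N *: (c m).1 + sc N *: \sum_(m < e) sc (N.+1 + m)%N *: p m.
  rewrite scaler_sumr -big_split /=; apply: eq_bigr => m _.
  by rewrite /bump /= add1n addnS addSn scalerDr !scalerA [sc N * _]mulrC.
by rewrite /w scalerBr -addrA; congr (_ + _); rewrite addrCA addNr addr0.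
Qed.

End IteratedCone.

(** * Closure properties of annihilators and the lowest homology *)

Section KillTools.
Variables (Q B : comNzRingType) (iota : {rmorphism Q -> B}).
Variables (N : nat) (sc : nat -> Q) (a : nat -> B) (Y : kmod Q).
Hypotheses (kY : koszul N sc Y) (asc : \sum_(l < N) a l * iota (sc l) = 0).

Local Notation Kill := (@Kill Q B iota N a Y [set 0]).

Let van0 (y : int -> B -> Y) : TT iota y -> vanish [set 0] y.
Proof. by move=> [_ yl _] i b ->; exact: ilin0. Qed.

Lemma KillD s t : Kill s -> Kill t -> Kill (s + t).
Proof.
move=> Ks Kt y yT yI yD; have [w [wT _ wE]] := Ks y yT yI yD.
have [w' [wT' _ wE']] := Kt y yT yI yD.
exists (fun i b => w i b + w' i b); split; [exact: (TTD kY)|exact/van0/(TTD kY)|].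
by move=> i b; have [_ yl _] := yT; rewrite DDD -wE -wE' mulrDl (ilinD (yl i)).
Qed.

Lemma KillM s t : Kill s -> Kill (s * t).
Proof.
move=> Ks y yT yI yD; have [w [wT _ wE]] := Ks y yT yI yD.
exists (fun i b => w i (t * b)); split; [exact: TTM|exact/van0/TTM|move=> i b].
by rewrite DDM -wE mulrA.
Qed.

Lemma Kill0 : Kill 0.
Proof.
move=> y yT yI yD; exists (fun i b => y i (0 * b)).
by split; [exact: TTM|exact/van0/TTM|move=> i b; rewrite DDM yD (van0 yT) // mul0r].
Qed.

Lemma Kill_sum (T : Type) (r : seq T) (F : T -> B) :
  (forall t, Kill (F t)) -> Kill (\sum_(t <- r) F t).
Proof. by move=> h; apply: big_ind => //; [exact: Kill0|exact: KillD]. Qed.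

(** Up to sign, [km_op Y l] is a null-homotopy of multiplication by [sc l]. *)
Lemma Kill_sc l : (l < N)%N -> Kill (iota (sc l)).
Proof.
move=> hl y yT yI yD; have [yg yl [i0 y0]] := yT.
have T1 : TT iota (fun i b => - km_op Y l (y (i - 1) b)).
  apply: (TTN kY); split.
  - move=> i b; rewrite -{1}[i](subrK 1); exact: km_op_gr kY _ _ _ _ _.
  - by move=> i q b b'; rewrite yl linearP.
  - by exists i0 => i hi b; rewrite y0 ?linear0 //; lia.
exists (fun i b => - km_op Y l (y (i - 1) b)); split=> //; first exact: van0.
move=> i b; rewrite DDN (ilinZ (yl i)) /DD addrK (km_leib kY) //.
have -> : \sum_(m < N) km_op Y m (km_op Y l (y (i - 1 - 1) (a m * b)))
        = - km_op Y l (\sum_(m < N) km_op Y m (y (i - 1 - 1) (a m * b))).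
  by rewrite linear_sum -sumrN /=; apply: eq_bigr => m _; rewrite (km_anti kY).
have := yD (i - 1) b; rewrite /DD subrK => /eqP; rewrite subr_eq0 => /eqP ->.
by rewrite opprB addrC opprK addrC subrK.
Qed.

(** The augmentation turns a cycle [v] into the family [b |-> aug b *: v], a cycle because the twist
    dies under [aug]. A family bounding it is pushed upwards until it vanishes below degree [i];
    evaluation at 1 then shows that [v] is a boundary. *)
Lemma lowest_homology (i : int) (aug : {rmorphism B -> Q}) : fam_proj iota ->
  (forall q, aug (iota q) = q) -> (forall l, (l < N)%N -> aug (a l) = 0) ->
  Kill 1 -> kacyclic (fun j => j < i) Y ->
  forall v, km_gr Y i v -> km_d Y v = 0 ->
  exists2 w, km_gr Y (i + 1) w & v = km_d Y w.
Proof.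
move=> Bproj aug1 aug0 K1 ac v hv dv.
pose y (j : int) (b : B) : Y := if j == i then aug b *: v else 0.
have yT : TT iota y.
  split.
  - by move=> j b; rewrite /y; case: eqP => [->|_]; [exact: (km_grZ kY)|exact: km_gr0 kY _].
  - move=> j q b b'; rewrite /y; case: eqP => _; last by rewrite scaler0 addr0.
    by rewrite rmorphD rmorphM aug1 scalerDl scalerA.
  - by exists i => j hj b; rewrite /y lt_eqF.
have yD j b : DD N a y j b = 0.
  rewrite /DD big1 ?sub0r => [|l _].
    rewrite /y; case: eqP => _; last by rewrite [km_d Y 0]linear0 oppr0.
    by rewrite [km_d Y _]linearZ /= dv scaler0 oppr0.
  by rewrite /y rmorphM aug0 // mul0r scale0r if_same linear0.
have [w [wT _ wE]] := K1 y yT (van0 yT) yD.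
have {}wE j b : y j b = DD N a w j b by rewrite -wE mul1r.
have [_ _ [i0 w0]] := wT.
have [k w0'] : exists k : nat, forall j, j < i - k%:Z -> forall b, w j b = 0.
  by exists `|i - i0|%N => j hj b; apply: w0; lia.
elim: k w wT wE w0' {i0 w0} => [|k IH] w wT wE w0.
  have [wg _ _] := wT; exists (- w (i + 1) 1); first exact: (km_grN kY).
  have := wE i 1; rewrite /y eqxx rmorph1 scale1r /DD big1 ?sub0r => [->|l _].
    by rewrite linearN.
  by rewrite w0 ?linear0 //; lia.
have [wg wl _] := wT.
pose j0 := i - k.+1%:Z.
have dw0 b : km_d Y (w j0 b) = 0.
  have := wE (j0 - 1) b; rewrite /y /DD lt_eqF; last by rewrite /j0; lia.
  rewrite big1 ?sub0r => [/esym/eqP|l _]; first by rewrite oppr_eq0 subrK => /eqP.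
  by rewrite w0 ?linear0 //; rewrite /j0; lia.
(* The lowest component has cycles as values, in a degree where [Y] is acyclic. Adding [DD] of a
   linear lift, placed one degree higher, removes it. *)
have [|||x [xl xP]] := @Bproj Y Y (fun r x => km_gr Y (j0 + 1) x /\ r = km_d Y x) _ (w j0).
- move=> q r z r' z' [gz ->] [gz' ->]; rewrite linearP.
  by split=> //; exact: km_grP kY _ _ _ _ _ _.
- exact: wl.
- by move=> b; have [|z hz ez] := ac j0 _ (w j0 b) (wg _ _) (dw0 b); [rewrite /j0; lia|exists z].
pose X (j : int) (b : B) : Y := if j == j0 + 1 then x b else 0.
have XT : TT iota X.
  split.
  - by move=> j b; rewrite /X; case: eqP => [->|_]; [have [] := xP b|exact: km_gr0 kY _].
  - by move=> j q b b'; rewrite /X; case: eqP => _; [exact: xl|rewrite scaler0 addr0].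
  - by exists (j0 + 1) => j hj b; rewrite /X lt_eqF.
have DXT := TT_DD a kY XT.
apply: (IH (fun j b => w j b + DD N a X j b)).
- exact: (TTD kY).
- by move=> j b; rewrite DDD (DD_DD kY asc) // addr0.
move=> j hj b; rewrite /DD /X big1 ?sub0r => [|l _]; last first.
  by rewrite ifN ?linear0 //; apply/eqP; rewrite /j0; lia.
case: eqP => [e|ne].
  have -> : j = j0 by rewrite -[j](addrK 1) e addrK.
  by rewrite -(xP b).2 subrr.
by rewrite linear0 oppr0 addr0 w0 //; move: ne; rewrite /j0; lia.
Qed.

End KillTools.

(** * Iterated polynomial rings *)

(** Iterated univariate polynomials give access to monic division in the last variable, on which
    Noether normalization and going up rely. *)
Fixpoint ipoly (A : comNzRingType) (n : nat) : comNzRingType :=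
  if n is m.+1 then {poly ipoly A m} else A.

Fixpoint iconst (A : comNzRingType) n : {rmorphism A -> ipoly A n} :=
  match n return {rmorphism A -> ipoly A n} with
  | 0 => idfun
  | m.+1 => polyC \o iconst A m
  end.

Fixpoint ivar (A : comNzRingType) n (i : nat) : ipoly A n :=
  match n return ipoly A n with
  | 0 => 0
  | m.+1 => if i == m then 'X else (ivar A m i)%:P
  end.

Fixpoint ieval (A B : comNzRingType) (c : {rmorphism A -> B}) (v : nat -> B) n :
    {rmorphism ipoly A n -> B} :=
  match n return {rmorphism ipoly A n -> B} with
  | 0 => c
  | m.+1 => horner_eval (v m) \o map_poly (ieval c v m)
  end.

Fixpoint imap (A B : comNzRingType) (c : {rmorphism A -> B}) n :
    {rmorphism ipoly A n -> ipoly B n} :=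
  match n return {rmorphism ipoly A n -> ipoly B n} with
  | 0 => c
  | m.+1 => map_poly (imap c m)
  end.

Section IteratedPolynomials.
Variables (A B : comNzRingType) (c : {rmorphism A -> B}).

Lemma rmorph_polyE (R : comNzRingType) (f g : {rmorphism {poly R} -> B}) :
  (forall a, f a%:P = g a%:P) -> f 'X = g 'X -> f =1 g.
Proof.
move=> fgC fgX p; rewrite -[p]coefK poly_def !rmorph_sum; apply: eq_bigr => i _.
by rewrite -mul_polyC !rmorphM !rmorphXn /= fgC fgX.
Qed.

Lemma ieval_const v n a : ieval c v n (iconst A n a) = c a.
Proof. by elim: n => //= n IH; rewrite map_polyC /= horner_evalE hornerC. Qed.

Lemma ieval_var v n i : (i < n)%N -> ieval c v n (ivar A n i) = v i.
Proof.
elim: n => //= n IH hi; case: eqVneq => [->|ne].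
  by rewrite map_polyX horner_evalE hornerX.
by rewrite map_polyC horner_evalE hornerC /= IH //; lia.
Qed.

Lemma ieval_eq v v' n : (forall i, (i < n)%N -> v i = v' i) -> ieval c v n =1 ieval c v' n.
Proof.
elim: n => //= n IH h p; rewrite /horner_eval h //; congr (_ .[_]).
by apply: eq_map_poly => x; apply: IH => i hi; apply: h; exact: leqW.
Qed.

Lemma ieval_unique n (f g : {rmorphism ipoly A n -> B}) :
  (forall a, f (iconst A n a) = g (iconst A n a)) ->
  (forall i, (i < n)%N -> f (ivar A n i) = g (ivar A n i)) -> f =1 g.
Proof.
elim: n f g => //= n IH f g fgC fgX; apply: rmorph_polyE.
  apply: (IH (f \o polyC) (g \o polyC)) => [a|i hi] /=; first exact: fgC.
  by have := fgX i (leqW hi); rewrite ltn_eqF.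
by have := fgX n (ltnSn n); rewrite eqxx.
Qed.

Lemma imap_const n a : imap c n (iconst A n a) = iconst B n (c a).
Proof. by elim: n => //= n IH; rewrite map_polyC /= IH. Qed.

Lemma imap_var n i : imap c n (ivar A n i) = ivar B n i.
Proof.
elim: n => [|n IH] /=; first exact: (rmorph0 c).
by case: ifP => _; rewrite ?map_polyX // map_polyC /= IH.
Qed.

Lemma imap_surj n : (forall b, exists a, c a = b) -> forall q, exists p, imap c n p = q.
Proof.
move=> cs; elim: n => //= n /choice[g gE] q.
exists (\poly_(i < size q) g q`_i); apply/polyP => i; rewrite coef_map coef_poly.
case: ltnP => h; first exact: gE.
by rewrite nth_default //; exact: (rmorph0 (imap c n)).
Qed.

End IteratedPolynomials.

Lemma fam_proj_base (Q : comNzRingType) : fam_proj (iconst Q 0).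
Proof.
move=> V W R Rlin g gl /(_ 1)[x Rx]; exists (fun q => q *: x); split.
  by move=> q b b'; rewrite scalerDl scalerA.
move=> b; have e : g b = b *: g 1 by rewrite -[in LHS](mulr1 b) (ilinZ gl).
have R0 : R 0 0 by have := Rlin (-1) _ _ _ _ Rx Rx; rewrite !scaleN1r !addNr.
by have := Rlin b _ _ _ _ Rx R0; rewrite !addr0 -e.
Qed.

Lemma fam_proj_poly (Q A : comNzRingType) (iota : {rmorphism Q -> A}) :
  fam_proj iota -> fam_proj (polyC \o iota : {rmorphism Q -> {poly A}}).
Proof.
move=> pA V W R Rlin g gl gR.
have /choice[w wP] : forall i : nat, exists w : A -> W,
    ilin iota w /\ forall b, R (g (b *: 'X^i)) (w b).
  move=> i; apply: (pA V W R Rlin (fun b => g (b *: 'X^i))) => [q b b'|b]; last exact: gR.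
  by rewrite -gl /= scalerDl -scalerA mul_polyC.
have w0 i : w i 0 = 0 by exact: (ilin0 (wP i).1).
have wE (p : {poly A}) m : (size p <= m)%N ->
    \sum_(i < size p) w i p`_i = \sum_(i < m) w i p`_i.
  move=> h; rewrite (big_ord_widen _ (fun i => w i p`_i) h) big_mkcond /=.
  by apply: eq_bigr => i _; case: ltnP => // hi; rewrite nth_default // w0.
have gE (p : {poly A}) m : (size p <= m)%N -> g p = \sum_(i < m) g (p`_i *: 'X^i).
  move=> h; rewrite -(ilin_sum gl); congr g; rewrite -poly_def; apply/polyP => i.
  by rewrite coef_poly; case: ltnP => // hi; rewrite nth_default //; exact: leq_trans hi.
exists (fun p : {poly A} => \sum_(i < size p) w i p`_i); split.
  move=> q p p'; pose m := maxn (size (iota q *: p + p')) (maxn (size p) (size p')).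
  rewrite /= mul_polyC !(@wE _ m); try by rewrite /m !leq_max leqnn ?orbT.
  rewrite scaler_sumr -big_split /=; apply: eq_bigr => i _.
  by rewrite coefD coefZ (wP i).1.
move=> p; rewrite (gE p _ (leqnn _)).
have RS (r : seq 'I_(size p)) :
    R (\sum_(i <- r) g (p`_i *: 'X^i)) (\sum_(i <- r) w i p`_i).
  elim: r => [|i r IH].
    have := Rlin (-1) _ _ _ _ ((wP 0).2 0) ((wP 0).2 0).
    by rewrite !big_nil !scaleN1r !addNr.
  by rewrite !big_cons -[g _]scale1r -[w _ _]scale1r; apply: Rlin => //; exact: (wP i).2.
exact: RS.
Qed.

Lemma fam_proj_ipoly (Q : comNzRingType) n : fam_proj (iconst Q n).
Proof. by elim: n => [|n IH]; [exact: fam_proj_base|exact: fam_proj_poly]. Qed.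

(** * Division by monic polynomials *)

Section MonicDivision.
Import Pdiv.Ring Pdiv.CommonRing Pdiv.RingMonic.
Variables (A : comNzRingType) (s : {poly A}) (sm : s \is monic).

Let s0 : s != 0. Proof. exact: monic_neq0. Qed.

Let small p : (size (rmodp p s) < size s)%N. Proof. by rewrite ltn_rmodpN0. Qed.

Let divmod_lin c p p' :
  rdivp (c%:P * p + p') s = c%:P * rdivp p s + rdivp p' s /\
  rmodp (c%:P * p + p') s = c%:P * rmodp p s + rmodp p' s.
Proof.
have hs : (size (c%:P * rmodp p s + rmodp p' s)%R < size s)%N.
  rewrite (leq_ltn_trans (size_polyD _ _)) // gtn_max small andbT mul_polyC.
  exact: leq_ltn_trans (size_scale_leq _ _) (small p).
have E : c%:P * p + p' = (c%:P * rdivp p s + rdivp p' s) * s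
                         + (c%:P * rmodp p s + rmodp p' s).
  rewrite {1}(rdivp_eq sm p) {1}(rdivp_eq sm p'); ring.
by rewrite {1 2}E rdivp_addl_mul_small // rmodp_addl_mul_small.
Qed.

Variables (Q : comNzRingType) (iota : {rmorphism Q -> A}).

Let iotaP : {rmorphism Q -> {poly A}} := polyC \o iota.

(** Modulo the monic [s], polynomials are free over [A] on the powers of ['X] below the degree of
    [s], so a left inverse over [A] can act on the coefficients of remainders. *)
Definition lift_split (x : A * (A -> A)) : {poly A} * ({poly A} -> {poly A}) :=
  (x.1%:P, fun b => \poly_(i < size s) x.2 (rmodp b s)`_i).

Let coef_lift (rho : A -> A) b i : rho 0 = 0 ->
  (\poly_(i < size s) rho (rmodp b s)`_i)`_i = rho (rmodp b s)`_i.
Proof.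
move=> r0; rewrite coef_poly; case: ltnP => // h.
by rewrite nth_default ?r0 //; apply: leq_trans h; exact: ltnW.
Qed.

Let mod_small (p : {poly A}) : (forall i, (size s <= i.+1)%N -> p`_i = 0) -> rmodp p s = p.
Proof.
move=> h; rewrite rmodp_small //; case: (posnP (size s)) => [|hs].
  by move/eqP; rewrite size_poly_eq0 (negbTE s0).
rewrite -(prednK hs) ltnS; apply/leq_sizeP => j hj; apply: h.
by rewrite -(prednK hs) ltnS.
Qed.

(** [J] is the ideal generated by [I] and [s], described by remainders. *)
Lemma lift_split_regular l (I : set A) (J : set {poly A}) : ideal I ->
  (forall b, J b <-> forall i, I (rmodp b s)`_i) ->
  split_regular iota I l -> split_regular iotaP J (map lift_split l).
Proof.
elim: l I J => [//|[t rho] l IH] I J idI JE [rl rI rt sr].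
have r0 : rho 0 = 0.
  have := rl 0 0 0; rewrite mulr0 addr0 rmorph0 mul0r add0r => e.
  by have := rl 1 0 0; rewrite rmorph1 !mul1r addr0 => /eqP; rewrite -subr_eq subrr => /eqP.
have modl b : rmodp (\poly_(i < size s) rho (rmodp b s)`_i) s
            = \poly_(i < size s) rho (rmodp b s)`_i.
  apply: mod_small => i hi; rewrite coef_lift // nth_default ?r0 //.
  by rewrite -ltnS; exact: leq_trans (small b) hi.
have rB x y : rho (x - y) = rho x - rho y.
  by have := rl (-1) y x; rewrite rmorphN rmorph1 !mulN1r addrC [- rho y + _]addrC.
split=> /=.
- move=> q b b'; apply/polyP => i; rewrite coefD coefCM !coef_lift //.
  by rewrite /iotaP /= (divmod_lin _ _ _).2 coefD coefCM rl.
- by move=> b /JE h; apply/JE => i; rewrite modl coef_lift //; exact: rI.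
- move=> b; apply/JE => i; rewrite -mulN1r -polyCN addrC (divmod_lin _ _ _).2.
  rewrite modl coefD coefCM coef_lift // -[t%:P * b]addr0 (divmod_lin _ _ _).2.
  rewrite rmod0p addr0 coefCM mulN1r addrC; exact: rt.
- apply: (IH (ext_ideal I t)) => [|b|//]; first exact: ext_idealP.
  split.
    move=> [x [y [/JE Jy ->]]] i; rewrite (divmod_lin _ _ _).2 coefD coefCM.
    by exists (rmodp x s)`_i, (rmodp y s)`_i.
  move=> h; have /choice[x xP] : forall i : nat, exists x : A * A,
      I x.2 /\ (rmodp b s)`_i = t * x.1 + x.2.
    by move=> i; have [u [v [Iv e]]] := h i; exists (u, v).
  pose u := \poly_(i < (size s).-1) (x i).1; pose v := \poly_(i < (size s).-1) (x i).2.
  have sE : rmodp b s = t%:P * u + v.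
    apply/polyP => i; rewrite coefD coefCM !coef_poly; case: ltnP => hi.
      exact: (xP i).2.
    rewrite mulr0 addr0 nth_default //; have := small b.
    by move: hi; case: (size s) => //= k hi; rewrite ltnS => /leq_trans; apply.
  exists u, (v + rdivp b s * s); split; last by rewrite addrA -sE addrC -rdivp_eq.
  apply/JE => i; rewrite rmodpD // rmodp_mull // addr0 mod_small => [|j hj].
    by rewrite coef_poly; case: ltnP => _; [exact: (xP i).1|case: idI].
  by rewrite coef_poly ifN // -leqNgt; move: hj; case: (size s).
Qed.

Lemma split_regular_monic l : split_regular iota [set 0] l ->
  split_regular iotaP [set 0] ((s, fun b : {poly A} => rdivp b s) :: map lift_split l).
Proof.
move=> sr; split=> /=.
- by move=> q b b'; rewrite (divmod_lin _ _ _).1.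
- by move=> b ->; rewrite rdiv0p.
- by move=> b; rewrite mulrC rdivp_mull // subrr.
apply: (@lift_split_regular _ [set 0]) => // [|b].
  by split=> [//|x y -> ->|x y ->]; rewrite ?addr0 ?mulr0.
split.
  by move=> [x [y [-> ->]]] i; rewrite addr0 mulrC rmodp_mull // coef0.
move=> h; exists (rdivp b s), 0; split => //.
rewrite addr0 mulrC {1}(rdivp_eq sm b); apply/eqP; rewrite -subr_eq0 addrAC subrr add0r.
by apply/eqP/polyP => i; rewrite coef0; exact: h.
Qed.

End MonicDivision.

Lemma split_regular_transport (Q A A' : comNzRingType) (iota : {rmorphism Q -> A})
    (iota' : {rmorphism Q -> A'}) (al : {rmorphism A' -> A}) (be : {rmorphism A -> A'})
    l (I : set A) (I' : set A') :
  (forall q, al (iota' q) = iota q) -> (forall q, be (iota q) = iota' q) ->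
  cancel al be -> cancel be al -> (forall b, I' b <-> I (al b)) ->
  split_regular iota I l ->
  split_regular iota' I' (map (fun x => (be x.1, fun b => be (x.2 (al b)))) l).
Proof.
move=> ali bei alK beK; elim: l I I' => [//|[t rho] l IH] I I' II [rl rI rt sr].
split=> /=.
- by move=> q b b'; rewrite rmorphD rmorphM ali rl rmorphD rmorphM bei.
- by move=> b /II h; apply/II; rewrite beK; exact: rI.
- by move=> b; apply/II; rewrite rmorphB beK rmorphM beK; exact: rt.
apply: (IH (ext_ideal I t)) => // b; split.
  move=> [x [y [/II Iy ->]]]; exists (al x), (al y); split=> //.
  by rewrite rmorphD rmorphM beK.
move=> [x [y [Iy e]]]; exists (be x), (be y); split; first by apply/II; rewrite beK.
by rewrite -[b]alK e rmorphD rmorphM.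
Qed.

(** Properness is not part of [split_regular], so a sequence of ones qualifies; it serves the
    degenerate case of Noether normalization. *)
Lemma split_regular_ones (Q A : comNzRingType) (iota : {rmorphism Q -> A}) (I : set A) m :
  ideal I -> split_regular iota I (nseq m (1, id)).
Proof.
elim: m I => //= m IH I idI; split=> //; last exact/IH/ext_idealP.
by move=> b; rewrite mul1r subrr; case: idI.
Qed.

(** * Prime ideals and going up *)

Definition submodule (A : comNzRingType) (V : lmodType A) (P : set V) : Prop :=
  [/\ P 0, forall x y, P x -> P y -> P (x + y) & forall q x, P x -> P (q *: x)].

Lemma maximal_submodule_avoiding (A : comNzRingType) (V : lmodType A) (L W : set V) :
  submodule L -> (forall x, L x -> ~ W x) ->
  exists M, [/\ submodule M, L `<=` M, forall x, M x -> ~ W x &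
    forall J, submodule J -> M `<=` J -> (forall x, J x -> ~ W x) -> J `<=` M].
Proof.
move=> mL LW.
pose good J := [/\ submodule J, L `<=` J & forall x, J x -> ~ W x].
have [F FP Ftot|M [MP Mmax]] := @Zorn_bigcup V [set J | J = set0 \/ good J].
  have [[J FJ gJ]|no] := pselect (exists2 J, F J & good J); last first.
    left; rewrite predeqE => x; split=> // -[J FJ Jx].
    by case: (FP J FJ) => [J0|gJ]; [rewrite J0 in Jx|apply: no; exists J].
  have FG K x : F K -> K x -> good K by move=> FK Kx; case: (FP K FK) => // K0; rewrite K0 in Kx.
  right; split.
  - split.
    + by exists J => //; have [[]] := gJ.
    + move=> x y [K FK Kx] [K' FK' Ky].
      have [[_ KD _] _ _] := FG _ _ FK Kx; have [[_ KD' _] _ _] := FG _ _ FK' Ky.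
      by case: (Ftot K K' FK FK') => s; [exists K'|exists K] => //;
         [apply: KD'|apply: KD] => //; exact: s.
    + move=> a x [K FK Kx]; have [[_ _ KM] _ _] := FG _ _ FK Kx.
      by exists K => //; exact: KM.
  - by move=> x Lx; exists J => //; have [_ + _] := gJ; apply.
  - by move=> x [K FK Kx]; have [_ _] := FG _ _ FK Kx; apply.
have gL : good L by split.
case: MP => [M0|[mM LM MW]].
  exfalso; apply: (Mmax L); last by right.
  by rewrite M0; split=> // /(_ 0); apply; case: mL.
exists M; split=> // J mJ MJ JW; apply: contrapT => nJM.
apply: (Mmax J); first by split.
by right; split=> //; exact: subset_trans MJ.
Qed.

Section Primes.
Variable A : comNzRingType.
Implicit Types (J L p q : set A).

Lemma ideal_sum J (T : Type) (r : seq T) (P : pred T) (F : T -> A) : ideal J ->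
  (forall t, P t -> J (F t)) -> J (\sum_(t <- r | P t) F t).
Proof. by case=> J0 JD _ h; apply: big_ind. Qed.

Lemma idealN J x : ideal J -> J x -> J (- x).
Proof. by case=> _ _ JM Jx; rewrite -mulN1r; exact: JM. Qed.

Lemma idealB J x y : ideal J -> J x -> J y -> J (x - y).
Proof. by move=> idJ Jx Jy; case: (idJ) => _ JD _; apply: JD => //; exact: idealN. Qed.

Lemma prime_exp p x n : prime_ideal p -> p (x ^+ n) -> p x.
Proof.
move=> [_ p1 pM]; elim: n => [|n IH]; first by rewrite expr0.
by rewrite exprS => /pM[].
Qed.

Lemma exists_maximal_avoiding L (W : set A) : ideal L -> (forall x, L x -> ~ W x) ->
  exists M, [/\ ideal M, L `<=` M, forall x, M x -> ~ W x &
    forall J, ideal J -> M `<=` J -> (forall x, J x -> ~ W x) -> J `<=` M].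
Proof. exact: (@maximal_submodule_avoiding A A^o). Qed.

Lemma exists_prime_avoiding L (W : set A) : ideal L -> W 1 ->
  (forall x y, W x -> W y -> W (x * y)) -> (forall x, L x -> ~ W x) ->
  exists q, [/\ prime_ideal q, L `<=` q & forall x, q x -> ~ W x].
Proof.
move=> idL W1 WM LW; have [q [idq Lq qW qmax]] := exists_maximal_avoiding idL LW.
exists q; split=> //; split=> // [q1|x y qxy]; first exact: qW q1 W1.
apply: contrapT => /not_orP[nx ny]; have [q0 qD qM] := idq.
have meet z : ~ q z -> exists a b, q b /\ W (z * a + b).
  move=> nz; apply: contrapT => no; apply: nz; apply: (qmax (ext_ideal q z)).
  - exact: ext_idealP.
  - by move=> b qb; exists 0, b; rewrite mulr0 add0r.
  - by move=> _ [a [b [qb ->]]] Wab; apply: no; exists a, b.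
  - by exists 1, 0; rewrite mulr1 addr0.
have [a [b [qb Wab]]] := meet x nx; have [c [d [qd Wcd]]] := meet y ny.
apply: (qW _ _ (WM _ _ Wab Wcd)).
have -> : (x * a + b) * (y * c + d) = a * c * (x * y) + (x * a + b) * d + y * c * b by ring.
by apply: (qD); [apply: (qD)|]; exact: qM.
Qed.

Lemma det_congr J (n : nat) (M M' : 'M[A]_n) : ideal J ->
  (forall i j, J (M i j - M' i j)) -> J (\det M - \det M').
Proof.
move=> idJ h; rewrite /determinant -sumrB; apply: ideal_sum => // s _.
rewrite -mulrBr; have [J0 JD JM] := idJ; apply: (JM).
apply: (big_ind2 (fun x y => J (x - y))) => [|x x' y y' hx hy|i _]; last exact: h.
  by rewrite subrr.
have -> : x * y - x' * y' = x * (y - y') + y' * (x - x') by ring.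
by apply: JD; exact: JM.
Qed.

Lemma has_chain_le (X : set (set A)) l m : (m <= l)%N -> has_chain X l -> has_chain X m.
Proof.
move=> hm [p [pX ps]]; exists p; split=> i hi; first by apply: pX; exact: leq_trans hm.
by apply: ps; exact: leq_trans hm.
Qed.

End Primes.

Lemma has_chain_preimage (A B : comNzRingType) (f : {rmorphism A -> B})
    (X : set (set B)) (Y : set (set A)) l : (forall b, exists a, f a = b) ->
  (forall p, X p -> Y [set a | p (f a)]) -> has_chain X l -> has_chain Y l.
Proof.
move=> fs XY [p [pX ps]]; exists (fun i => [set a | p i (f a)]); split.
  by move=> i hi; exact/XY/pX.
move=> i hi; have [s1 s2] := ps i hi; split; first by move=> a; exact: s1.
by move=> s; apply: s2 => b; have [a <-] := fs b; exact: s.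
Qed.

Lemma ideal_preimage (A B : comNzRingType) (f : {rmorphism A -> B}) (J : set B) :
  ideal J -> ideal [set a | J (f a)].
Proof.
case=> J0 JD JM; split=> /= [|x y|a x]; rewrite ?rmorph0 ?rmorphD ?rmorphM //;
  [exact: JD|exact: JM].
Qed.

Lemma prime_preimage (A B : comNzRingType) (f : {rmorphism A -> B}) (p : set B) :
  prime_ideal p -> prime_ideal [set a | p (f a)].
Proof.
move=> [idp p1 pp]; split=> /=; first exact: ideal_preimage.
  by rewrite rmorph1.
by move=> x y; rewrite rmorphM; exact: pp.
Qed.

(** * Going up along a monic polynomial *)

Section GoingUp.
Import Pdiv.Ring Pdiv.CommonRing Pdiv.RingMonic.
Variables (A : comNzRingType) (s : {poly A}) (sm : s \is monic).

Let rmodp_coef (p : set A) (f : {poly A}) i : ideal p -> (forall i, p f`_i) -> p (rmodp f s)`_i.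
Proof.
move=> idp h; rewrite -[f]coefK poly_def rmodp_sum // coef_sum.
apply: ideal_sum => // j _; rewrite rmodpZ // coefZ mulrC.
by case: idp => _ _; apply.
Qed.

(** Such a [q] exists unless a constant [w] outside [p] is congruent, coefficientwise modulo [p], to
    some [g] in [L]. The determinant trick excludes this: it puts a constant congruent to a power of
    [w] into [L], hence into [p]. *)
Lemma going_up (L : set {poly A}) (p : set A) : ideal L -> L s -> prime_ideal p ->
  (forall a, L a%:P -> p a) ->
  exists q, [/\ prime_ideal q, L `<=` q & forall a, q a%:P <-> p a].
Proof.
move=> idL Ls pp Lp; have [idp p1 pM] := pp; have [L0 LD LM] := idL.
pose L' := [set f | exists2 g, L g & forall i, p (f - g)`_i].
have idL' : ideal L'.
  have [p0 pD pA] := idp; split.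
  - by exists 0 => // i; rewrite subrr coef0.
  - move=> f f' [g Lg h] [g' Lg' h']; exists (g + g'); first exact: LD.
    by move=> i; rewrite opprD addrACA coefD; apply: pD.
  - move=> a f [g Lg h]; exists (a * g); first exact: LM.
    by move=> i; rewrite -mulrBr coefM; apply: ideal_sum => // j _; exact: pA.
have [||||q [pq L'q qW]] :=
    @exists_prime_avoiding _ L' [set f | exists2 a, ~ p a & f = a%:P].
- exact: idL'.
- by exists 1.
- move=> _ _ [a na ->] [b nb ->]; exists (a * b); last by rewrite polyCM.
  by move=> /pM[].
- move=> x [g Lg gp] [w nw ew]; rewrite ew in gp; apply: nw => {x ew}.
  have ss : (0 < size s)%N by rewrite size_poly_gt0 monic_neq0.
  (* A monic [s] of degree 0 is 1, so [L] and then [p] would contain 1. *)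
  case sE : (size s).-1 => [|N].
    exfalso; apply/p1/Lp; have -> : 1%:P = s :> {poly A}; last by [].
    have h1 : size s = 1%N by rewrite -(prednK ss) sE.
    have /size_poly1P[c c0 sc] : size s == 1%N by rewrite h1.
    by move: sm; rewrite sc monicE lead_coefC => /eqP ->.
  have sE' : size s = N.+2 by rewrite -(prednK ss) sE.
  pose r j := (w%:P - g) * 'X^j.
  have rp j i : p (r j)`_i.
    by rewrite /r coefMXn; case: ifP => _; [case: idp|exact: gp].
  (* Row [j] writes [g * 'X^j], up to a multiple of [s], in the powers of ['X] below the degree of
     [s]. Modulo [p] the matrix is [w] times the identity. *)
  pose M : 'M[A]_N.+1 := \matrix_(j, i) (w *+ (j == i) - (rmodp (r j) s)`_i).
  have MX j : L (\sum_i (M j i)%:P * 'X^i).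
    have -> : \sum_i (M j i)%:P * 'X^i = g * 'X^j + rdivp (r j) s * s.
      have e : w%:P * 'X^j = g * 'X^j + r j by rewrite /r mulrBl addrC subrK.
      have -> : \sum_i (M j i)%:P * 'X^i = w%:P * 'X^j - rmodp (r j) s.
        under eq_bigr do rewrite mxE polyCB mulrBl.
        rewrite sumrB; congr (_ - _).
          rewrite (bigD1 j) //= eqxx mulr1n big1 ?addr0 // => i ne.
          by rewrite eq_sym (negbTE ne) mulr0n mul0r.
        rewrite -[RHS](coefK) poly_def.
        have hs : (size (rmodp (r j) s) <= N.+1)%N by rewrite -ltnS -sE' ltn_rmodpN0 // monic_neq0.
        rewrite (big_ord_widen _ (fun i => (rmodp (r j) s)`_i *: 'X^i) hs) [RHS]big_mkcond /=.
        apply: eq_bigr => i _; rewrite mul_polyC; case: ltnP => // hi.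
        by rewrite nth_default // scale0r.
      by rewrite e {1}(rdivp_eq sm (r j)) addrA addrK.
    by apply: LD; [rewrite mulrC|]; exact: LM.
  have Ld : L (\det M)%:P.
    have -> : (\det M)%:P = \sum_j (\adj M 0 j)%:P * \sum_i (M j i)%:P * 'X^i.
      transitivity (\sum_i ((\adj M *m M) 0 i)%:P * 'X^i).
        rewrite mul_adj_mx (bigD1 0) //= mxE eqxx mulr1n mulr1 big1 ?addr0 // => i ne.
        by rewrite mxE eq_sym (negbTE ne) mulr0n mul0r.
      under [RHS]eq_bigr do rewrite mulr_sumr.
      rewrite exchange_big /=; apply: eq_bigr => i _; rewrite mxE rmorph_sum mulr_suml.
      by apply: eq_bigr => j _; rewrite rmorphM mulrA.
    by apply: ideal_sum => // j _; exact: LM.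
  have dw : p (\det M - \det (w%:M : 'M_N.+1)).
    apply: det_congr => // i j; rewrite !mxE addrAC subrr add0r.
    by apply: idealN => //; exact: rmodp_coef.
  rewrite det_scalar in dw; apply: (prime_exp (n := N.+1) pp).
  have -> : w ^+ N.+1 = \det M - (\det M - w ^+ N.+1) by rewrite opprB addrC subrK.
  by apply: idealB => //; exact: Lp.
exists q; split=> // [f Lf|a].
  by apply: L'q; exists f => // i; rewrite subrr coef0; case: idp.
split=> [qa|pa].
  by apply: contrapT => na; apply: (qW _ qa); exists a.
by apply: L'q; exists 0 => // i; rewrite subr0 coefC; case: ifP => // _; case: idp.
Qed.

Lemma going_up_chain (J : set {poly A}) l : ideal J -> J s ->
  has_chain [set p | prime_ideal p /\ [set a | J a%:P] `<=` p] l ->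
  has_chain [set q | prime_ideal q /\ J `<=` q] l.
Proof.
move=> idJ Js [p [pX ps]].
suff [q [q1 q2 q3]] : exists q : nat -> set {poly A},
  [/\ forall i, (i <= l)%N -> prime_ideal (q i) /\ J `<=` q i,
      forall i, (i <= l)%N -> forall a, q i a%:P <-> p i a &
      forall i, (i < l)%N -> q i `<=` q i.+1].
  exists q; split=> // i hi; split; first exact: q3.
  move=> s1; have [_] := ps i hi; apply=> a pa.
  by apply/q2; [exact: ltnW|]; apply: s1; exact/q2.
elim: l pX ps => [|l IH] pX ps.
  have [pp Jp] := pX 0%N isT; have [|q [pq Jq qp]] := going_up idJ Js pp; first by move=> a /Jp.
  by exists (fun=> q); split=> // -[|i].
have [||q [q1 q2 q3]] := IH.
- by move=> i hi; apply: pX; exact: leqW.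
- by move=> i hi; apply: ps; exact: leqW.
have [pp _] := pX l.+1 (leqnn _); have [pql Jql] := q1 l (leqnn l).
have [idql _ _] := pql.
have [|q' [pq' qq' q'p]] := going_up idql (Jql _ Js) pp.
  by move=> a /(q2 l (leqnn l)); have [+ _] := ps l (leqnn _); apply.
exists (fun i => if (i <= l)%N then q i else q'); split=> i hi.
- by case: ifP => hil; [exact: q1|split=> //; exact: subset_trans qq'].
- case: ifP => hil; first exact: q2.
  by have -> : i = l.+1 by lia.
case: ifP => hil; last by lia.
case: ifP => hil'; first by apply: q3; lia.
by have -> : i = l by lia.
Qed.

End GoingUp.

(** * Noether normalization *)

Definition nzd (A : comNzRingType) := forall x y : A, x * y = 0 -> x = 0 \/ y = 0.

Lemma nzd_poly (A : comNzRingType) : nzd A -> nzd {poly A}.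
Proof.
move=> nA p q pq; apply: contrapT => /not_orP[p0 q0].
have [|/eqP|/eqP] := nA (lead_coef p) (lead_coef q); last 2 first.
- by rewrite lead_coef_eq0 => /eqP.
- by rewrite lead_coef_eq0 => /eqP.
apply/eqP; case: eqVneq => // ne; have := lead_coef_proper_mul ne.
by rewrite pq lead_coef0 => e; rewrite -e eqxx in ne.
Qed.

Lemma nzd_ipoly (k : fieldType) n : nzd (ipoly k n).
Proof.
elim: n => [|n IH]; last exact: nzd_poly.
by move=> x y /eqP; rewrite mulf_eq0 => /orP[]/eqP; [left|right].
Qed.

Lemma zero_ideal_prime (A : comNzRingType) : nzd A -> prime_ideal [set (0 : A)].
Proof.
move=> nA; split=> //; first by split=> [//|x y -> ->|x y ->]; rewrite ?addr0 ?mulr0.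
by move=> /eqP; rewrite oner_eq0.
Qed.

(** The zero ideal goes below the preimages of a shorter chain under evaluation of the last variable
    at 0; that variable makes the first inclusion strict. *)
Lemma ipoly_chain (k : fieldType) n : has_chain (@prime_ideal (ipoly k n)) n.
Proof.
elim: n => [|n [p [pX ps]]].
  by exists (fun=> [set 0]); split=> // i _; exact: zero_ideal_prime (@nzd_ipoly k 0).
pose ev : {rmorphism {poly ipoly k n} -> ipoly k n} := horner_eval 0.
exists (fun i => if i is j.+1 then [set f | p j (ev f)] else [set 0]); split.
  case=> [|i] hi; first exact: zero_ideal_prime (@nzd_ipoly k n.+1).
  by apply: prime_preimage; exact: pX.
case=> [|i] hi.
  have [[p0 _ _] _ _] := pX 0%N isT.
  split=> [f ->|/(_ 'X)]; first by rewrite /= rmorph0.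
  rewrite /= /ev horner_evalE hornerX => /(_ p0)/eqP; rewrite polyX_eq0 //.
have [s1 s2] := ps i hi; split=> [f|s]; first exact: s1.
apply: s2 => a pa; have := s a%:P; rewrite /= /ev horner_evalE hornerC; exact.
Qed.

Lemma subn_swap (a b x y : nat) : (a + x = b + y -> y - x = a - b)%N.
Proof. by lia. Qed.

Section LeadingConstants.
Variables (k : fieldType) (A : comNzRingType) (c : {rmorphism k -> A}).

(** Degrees divisible by [N] leave room for the powers of the next substituted variable, so that
    leading terms of different summands cannot cancel. *)
Definition const_lead (N : nat) (p : {poly A}) : Prop :=
  [/\ p != 0, exists2 a, a != 0 & lead_coef p = c a & (N %| (size p).-1)%N].

Lemma rmorph_field_neq0 a : a != 0 -> c a != 0.
Proof.
move=> a0; apply/eqP => ca; have : c (a * a^-1) = 1 by rewrite divff // rmorph1.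
by rewrite rmorphM ca mul0r => /esym/eqP; rewrite oner_eq0.
Qed.

Lemma sum_distinct_sizes (P : nat -> {poly A}) m :
  (forall i j, (i < j < m)%N -> P i != 0 -> P j != 0 -> size (P i) <> size (P j)) ->
  (exists2 i, (i < m)%N & P i != 0) ->
  exists i, [/\ (i < m)%N, P i != 0, size (\sum_(j < m) P j) = size (P i) &
                lead_coef (\sum_(j < m) P j) = lead_coef (P i)].
Proof.
elim: m => [|m IH] dist ex; first by case: ex.
rewrite big_ord_recr /=.
have [ex'|no] := pselect (exists2 i, (i < m)%N & P i != 0); last first.
  have z j : (j < m)%N -> P j = 0.
    by move=> hj; apply/eqP; apply: contrapT => /negP ne; apply: no; exists j.
  rewrite big1 ?add0r; last by move=> j _; exact: z.
  exists m; split=> //; case: ex => i hi Pi.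
  by have [/z e|h] := ltnP i m; [rewrite e eqxx in Pi|have -> : m = i by lia].
have [|i [hi Pi si li]] := IH _ ex'.
  by move=> i j /andP[h1 h2]; apply: dist; rewrite h1 /= ltnW.
have [Pm|Pm] := eqVneq (P m) 0.
  by exists i; split=> //; rewrite ?Pm ?addr0 // ltnW.
have ne : size (P i) <> size (P m) by apply: dist => //; rewrite hi /=.
have [lt|le] := ltnP (size (P m)) (size (P i)).
  by exists i; split=> //; rewrite ?size_polyDl ?lead_coefDl ?si //; exact: ltnW.
have lt : (size (\sum_(j < m) P j)%R < size (P m))%N by rewrite si; lia.
by exists m; split=> //; rewrite ?size_polyDr ?lead_coefDr // addrC size_polyDl.
Qed.

Lemma const_lead_sum (N M : nat) (P W : nat -> {poly A}) (w : nat) :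
  (0 < N)%N -> (0 < w)%N -> (w * M %| N)%N ->
  (forall j, (j < M)%N -> P j = 0 \/ const_lead N (P j)) ->
  (exists2 j, (j < M)%N & P j != 0) ->
  (forall j, (j < M)%N -> W j \is monic /\ size (W j) = (j * w).+1) ->
  const_lead w (\sum_(j < M) P j * W j).
Proof.
move=> N0 w0 wMN hP [j0 hj0 Pj0] hW.
have sz j : (j < M)%N -> P j != 0 -> (size (P j * W j)).-1 = ((size (P j)).-1 + j * w)%N.
  move=> hj Pj; have [mW sW] := hW j hj.
  by rewrite size_Mmonic // sW addnS /= -subn1 addnC -addnBA ?size_poly_gt0 // addnC subn1.
have nz j : (j < M)%N -> P j * W j != 0 -> P j != 0.
  by move=> hj; apply: contraNneq => ->; rewrite mul0r.
have nz' j : (j < M)%N -> P j != 0 -> P j * W j != 0.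
  move=> hj Pj; have [mW _] := hW j hj.
  by rewrite -lead_coef_eq0 lead_coef_Mmonic // lead_coef_eq0.
have [||i [hi Pi si li]] := @sum_distinct_sizes (fun j => P j * W j) M.
- move=> i j /andP[hij hj] Pi Pj es.
  have hi := ltn_trans hij hj.
  have [Pi0 Pj0'] := (nz i hi Pi, nz j hj Pj).
  have e := congr1 predn es; rewrite !sz // in e.
  have [/eqP|[_ _ di]] := hP i hi; first by rewrite (negbTE Pi0).
  have [/eqP|[_ _ dj]] := hP j hj; first by rewrite (negbTE Pj0').
  have di' := dvdn_trans wMN di; have dj' := dvdn_trans wMN dj.
  have : (w * M %| (j - i) * w)%N.
    have -> : ((j - i) * w = (size (P i)).-1 - (size (P j)).-1)%N.
      by rewrite mulnBl; exact: subn_swap.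
    exact: dvdn_sub.
  rewrite mulnC dvdn_pmul2r // => /dvdn_leq; rewrite subn_gt0 hij => /(_ isT) h.
  by have := leq_trans h (leq_subr i j); rewrite leqNgt hj.
- by exists j0 => //; exact: nz'.
have Pi0 := nz i hi Pi; have [/eqP|[_ [a a0 ea] di]] := hP i hi.
  by rewrite (negbTE Pi0).
split.
- by rewrite -size_poly_eq0 si size_poly_eq0.
- by exists a => //; rewrite li lead_coef_Mmonic //; exact: (hW i hi).1.
rewrite si sz // dvdn_addl ?dvdn_mull //.
by apply: dvdn_trans di; apply: dvdn_trans wMN; exact: dvdn_mulr.
Qed.

Lemma horner_sum (R : comNzRingType) (p : {poly R}) (x : R) m : (size p <= m)%N ->
  p.[x] = \sum_(j < m) p`_j * x ^+ j.
Proof. exact: horner_coef_wide. Qed.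

Variable v : nat -> A.

Definition nagata_var (e : nat -> nat) (i : nat) : {poly A} := 'X^(e i) + (v i)%:P.

Let cP : {rmorphism k -> {poly A}} := polyC \o c.

(** All coefficients of a polynomial have to be served by the same exponents, whence the list [gs].
    They receive degrees divisible by [N * M], the last variable receives the exponent [N], and only
    its powers below [M] occur; so all resulting degrees differ. *)
Lemma nagata_lead n (gs : seq (ipoly k n)) (N : nat) : (0 < N)%N ->
  (forall g, g \in gs -> g != 0) ->
  exists e : nat -> nat, (forall i, (0 < e i)%N) /\
    forall g, g \in gs -> const_lead N (ieval cP (nagata_var e) n g).
Proof.
elim: n gs N => [|n IH] gs N N0 gs0.
  exists (fun=> 1%N); split=> // g /gs0 g0; rewrite /=.
  have cg0 := rmorph_field_neq0 g0.
  split; first by rewrite polyC_eq0.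
    by exists g => //; rewrite lead_coefC.
  by rewrite size_polyC cg0 dvdn0.
have gs0' : forall g : {poly ipoly k n}, g \in (gs : seq {poly ipoly k n}) -> g != 0 := gs0.
pose M := (\max_(g <- (gs : seq {poly ipoly k n})) size g).+1.
have szM (g : {poly ipoly k n}) : g \in (gs : seq {poly ipoly k n}) -> (size g <= M)%N.
  by move=> hg; rewrite /M ltnW // ltnS; apply: leq_bigmax_seq.
pose cs := [seq x <- flatten [seq polyseq g | g <- (gs : seq {poly ipoly k n})] | x != 0].
have [||e [e0 eP]] := IH cs (N * M)%N.
- by rewrite muln_gt0 N0.
- by move=> x; rewrite mem_filter => /andP[].
pose e' i := if i == n then N else e i.
exists e'; split=> [i|g hg]; first by rewrite /e'; case: ifP.
have hg' : (g : {poly ipoly k n}) \in (gs : seq {poly ipoly k n}) := hg.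
have -> : ieval cP (nagata_var e') n.+1 g =
    \sum_(j < M) ieval cP (nagata_var e) n (g : {poly ipoly k n})`_j * (nagata_var e' n) ^+ j.
  rewrite /= horner_evalE (@horner_sum _ _ _ M); last first.
    by apply: leq_trans (szM _ hg'); exact: size_poly.
  apply: eq_bigr => j _; rewrite coef_map /=; congr (_ * _); apply: ieval_eq => i hi.
  by rewrite /nagata_var /e' ltn_eqF.
have mem_cs j : (g : {poly ipoly k n})`_j != 0 -> (g : {poly ipoly k n})`_j \in cs.
  move=> ne; rewrite mem_filter ne /=; apply/flattenP.
  exists (polyseq (g : {poly ipoly k n})); first exact: map_f.
  by apply: mem_nth; rewrite ltnNge; apply: contra ne => h; rewrite nth_default.
apply: (@const_lead_sum (N * M) M (fun j => ieval cP (nagata_var e) n (g : {poly ipoly k n})`_j)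
  (fun j => nagata_var e' n ^+ j)) => //.
- by rewrite muln_gt0 N0.
- move=> j _; have [->|ne] := eqVneq (g : {poly ipoly k n})`_j 0; first by left; exact: rmorph0.
  by right; apply: eP; exact: mem_cs.
- have g0 := gs0' _ hg'; exists (size (g : {poly ipoly k n})).-1.
    have := szM _ hg'; have : (0 < size (g : {poly ipoly k n}))%N by rewrite size_poly_gt0.
    by case: (size _).
  have lg : (g : {poly ipoly k n})`_(size (g : {poly ipoly k n})).-1 != 0.
    by rewrite -lead_coefE lead_coef_eq0.
  by have [] := eP _ (mem_cs _ lg).
move=> j _; have mX : nagata_var e' n \is monic.
  by rewrite /nagata_var monicXnaddC // /e' eqxx.
split; first exact: monic_exp.
rewrite /nagata_var /e' eqxx; elim: (j : nat) => [|i IHi]; first by rewrite expr0 size_poly1.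
by rewrite exprS size_Mmonic ?monic_exp ?monicXnaddC // -?size_poly_eq0 ?size_XnaddC // IHi addnS mulSn.
Qed.

End LeadingConstants.

Lemma ieval_unique2 (A B B' C : comNzRingType) n (f : {rmorphism ipoly A n -> B})
    (g : {rmorphism B -> C}) (f' : {rmorphism ipoly A n -> B'}) (g' : {rmorphism B' -> C}) :
  (forall a, g (f (iconst A n a)) = g' (f' (iconst A n a))) ->
  (forall i, (i < n)%N -> g (f (ivar A n i)) = g' (f' (ivar A n i))) ->
  forall x, g (f x) = g' (f' x).
Proof. exact: (@ieval_unique _ _ n (g \o f) (g' \o f')). Qed.

(** The factor [u] makes the inverse a substitution of the same form, with [- u]. *)
Definition nagata_aut (A : comNzRingType) n (e : nat -> nat) (u : A) :
    {rmorphism ipoly A n.+1 -> ipoly A n.+1} :=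
  ieval (iconst A n.+1) (fun i => if i == n then ivar A n.+1 n
    else iconst A n.+1 u * ivar A n.+1 n ^+ e i + ivar A n.+1 i) n.+1.

Lemma nagata_aut_const (A : comNzRingType) n e (u a : A) :
  nagata_aut n e u (iconst A n.+1 a) = iconst A n.+1 a.
Proof. exact: ieval_const. Qed.

Lemma nagata_aut_top (A : comNzRingType) n e (u : A) :
  nagata_aut n e u (ivar A n.+1 n) = ivar A n.+1 n.
Proof. by rewrite /nagata_aut ieval_var // eqxx. Qed.

Lemma nagata_aut_var (A : comNzRingType) n e (u : A) i : (i < n)%N ->
  nagata_aut n e u (ivar A n.+1 i) =
  iconst A n.+1 u * ivar A n.+1 n ^+ e i + ivar A n.+1 i.
Proof. by move=> hi; rewrite /nagata_aut ieval_var ?ltn_eqF // ltnS ltnW. Qed.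

Lemma nagata_autK (A : comNzRingType) n e (u : A) :
  cancel (nagata_aut n e u) (nagata_aut n e (- u)).
Proof.
apply: (@ieval_unique2 _ _ _ _ _ (nagata_aut n e u) (nagata_aut n e (- u)) idfun idfun) => [a|i].
  by rewrite !nagata_aut_const.
rewrite ltnS leq_eqVlt => /orP[/eqP->|hi]; first by rewrite !nagata_aut_top.
rewrite (nagata_aut_var _ _ hi) rmorphD rmorphM rmorphXn nagata_aut_const.
by rewrite nagata_aut_top (nagata_aut_var _ _ hi) rmorphN mulNr addrA subrr add0r.
Qed.

Lemma imap_nagata (A A' : comNzRingType) (c : {rmorphism A -> A'}) n e (u : A) x :
  imap c n.+1 (nagata_aut n e u x) = nagata_aut n e (c u) (imap c n.+1 x).
Proof.
apply: (@ieval_unique2 _ _ _ _ _ (nagata_aut n e u) (imap c n.+1)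
          (imap c n.+1) (nagata_aut n e (c u))) => [a|i].
  by rewrite nagata_aut_const imap_const nagata_aut_const.
rewrite ltnS leq_eqVlt => /orP[/eqP->|hi].
  by rewrite nagata_aut_top imap_var nagata_aut_top.
rewrite imap_var !(nagata_aut_var _ _ hi) rmorphD rmorphM rmorphXn.
by rewrite imap_const !imap_var.
Qed.

Lemma nagata_monic (k : fieldType) n (g : {poly ipoly k n}) : g != 0 ->
  exists e (a : k), (iconst k n a)%:P * (nagata_aut n e 1 g : {poly ipoly k n}) \is monic.
Proof.
move=> g0; have sg : (0 < size g)%N by rewrite size_poly_gt0.
pose gs := [seq x <- polyseq g | x != 0].
have [|e [e0 eP]] := @nagata_lead k _ (iconst k n) (ivar k n) n gs (size g) sg.
  by move=> x; rewrite mem_filter => /andP[].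
have E : nagata_aut n e 1 g = \sum_(j < size g)
    ieval (polyC \o iconst k n) (nagata_var (ivar k n) e) n g`_j * 'X ^+ j :> {poly ipoly k n}.
  pose va i : {poly ipoly k n} := if i == n then ivar k n.+1 n
    else iconst k n.+1 1 * ivar k n.+1 n ^+ e i + ivar k n.+1 i.
  have van : va n = 'X by rewrite /va eqxx /= eqxx.
  transitivity (map_poly (ieval (iconst k n.+1) va n) g).[va n]; first by [].
  rewrite van (@horner_sum _ _ _ (size g)); last exact: size_poly.
  apply: eq_bigr => j _; rewrite coef_map /=; congr (_ * _); apply: ieval_eq => i hi.
  by rewrite /va /nagata_var /= ltn_eqF // eqxx rmorph1 polyC1 mul1r.
have mem_gs j : g`_j != 0 -> g`_j \in gs.
  move=> ne; rewrite mem_filter ne /=.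
  by apply: mem_nth; rewrite ltnNge; apply: contra ne => h; rewrite nth_default.
have [||||||_ [a a0 ea] _] := @const_lead_sum k _ (iconst k n) (size g) (size g)
  (fun j => ieval (polyC \o iconst k n) (nagata_var (ivar k n) e) n g`_j) (fun j => 'X ^+ j) 1.
- by [].
- by [].
- by rewrite mul1n.
- move=> j _; have [->|ne] := eqVneq g`_j 0; first by left; exact: rmorph0.
  by right; apply: eP; exact: mem_gs.
- exists (size g).-1; first by rewrite prednK.
  have lg : g`_(size g).-1 != 0 by rewrite -lead_coefE lead_coef_eq0.
  by have [] := eP _ (mem_gs _ lg).
- by move=> j _; rewrite monicXn size_polyXn muln1.
exists e, a^-1; rewrite E monicE; set p := \sum_(j < _) _ in ea *.
have e1 : lead_coef (iconst k n a^-1)%:P * lead_coef p = 1.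
  by rewrite lead_coefC ea -rmorphM mulVf // rmorph1.
by rewrite lead_coef_proper_mul e1 // oner_eq0.
Qed.

(** Induction on [n]. A nonzero member of [J] becomes monic in the last variable after a change of
    coordinates. The contraction of [J] to the other variables either carries a chain, which going
    up lifts, or supplies [h] elements, to which the monic one is added. The exponents are arbitrary
    because the powers needed are determined only later. *)
Theorem noether_normalization (Q : comNzRingType) (k : fieldType) (eps : {rmorphism Q -> k})
    (eps_surj : forall x, exists q, eps q = x) n h (J : set (ipoly k n)) : ideal J ->
  has_chain [set p | prime_ideal p /\ J `<=` p] (n - h) \/
  exists t : seq (ipoly Q n), [/\ size t = h.+1,
    forall j, (j < h.+1)%N -> J (imap eps n (nth 0 t j)) &
    forall e : nat -> nat, exists l, [/\ size l = h.+1,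
      split_regular (iconst Q n) [set 0] l &
      forall j, (j < h.+1)%N -> (nth (0, id) l j).1 = nth 0 t j ^+ e j]].
Proof.
elim: n h J => [|n IH] h J idJ.
  have [J0|/existsNP[x /not_implyP[Jx x0]]] := pselect (forall x, J x -> x = 0).
    left; exists (fun=> [set 0]); split=> // i _.
    by split; [exact: zero_ideal_prime (@nzd_ipoly k 0)|move=> x /J0].
  right; have J1 : J 1.
    have [_ _ JM] := idJ; have := JM (x^-1) x Jx.
    by rewrite mulVf //; exact/eqP.
  (* Over a field a nonzero [J] contains 1, so a sequence of ones will do. *)
  exists (nseq h.+1 1); split; first by rewrite size_nseq.
    by move=> j hj; rewrite nth_nseq hj; rewrite rmorph1.
  move=> e; exists (nseq h.+1 (1, id)); split; first by rewrite size_nseq.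
    apply: split_regular_ones.
    by split=> [//|x' y -> ->|x' y ->]; rewrite ?addr0 ?mulr0.
  by move=> j hj; rewrite !nth_nseq hj expr1n.
have [J0|/existsNP[g /not_implyP[Jg /eqP g0]]] := pselect (forall x, J x -> x = 0).
  left; apply: has_chain_le (leq_subr _ _) _.
  have [p [pX ps]] := ipoly_chain k n.+1.
  exists p; split=> // i hi; split; first exact: pX.
  by move=> x /J0 ->; have [[]] := pX i hi.
have [e [s sm Js]] : exists e, exists2 s : {poly ipoly k n}, s \is monic &
    J (nagata_aut n e (- 1) s).
  have [e [a sm]] := @nagata_monic k n g g0.
  exists e; eexists; first exact: sm.
  have [_ _ JM] := idJ; rewrite rmorphM nagata_autK.
  exact: JM.
pose al : {rmorphism ipoly k n.+1 -> ipoly k n.+1} := nagata_aut n e 1.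
pose be : {rmorphism ipoly k n.+1 -> ipoly k n.+1} := nagata_aut n e (- 1).
have alK : cancel al be by exact: nagata_autK.
have beK : cancel be al by move=> x; rewrite -[RHS](@nagata_autK _ n e (- 1)) opprK.
pose J' : set {poly ipoly k n} := [set x | J (be x)].
have idJ' : ideal J' := ideal_preimage be idJ.
pose J'' : set (ipoly k n) := [set a | J' a%:P].
have idJ'' : ideal J'' := @ideal_preimage _ _ polyC _ idJ'.
have ims := imap_surj eps_surj.
(* The leading coefficient is lifted to 1 by hand; arbitrary lifts of the other coefficients
   suffice. *)
have [sQ sQm sQE] : exists2 sQ : {poly ipoly Q n}, sQ \is monic & imap eps n.+1 sQ = s.
  have /choice[r rE] := @ims n.
  exists ('X ^+ (size s).-1 + \poly_(i < (size s).-1) r s`_i).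
    rewrite monicE lead_coefDl ?lead_coefXn // size_polyXn ltnS; exact: size_poly.
  rewrite rmorphD rmorphXn; apply/polyP => i.
  rewrite coefD -[imap eps n.+1 'X]/(map_poly (imap eps n) 'X) map_polyX.
  rewrite -[imap eps n.+1 (\poly_(_ < _) _)]/(map_poly (imap eps n) _).
  rewrite coefXn coef_map coef_poly.
  have [hi|hi] := ltnP i (size s).-1.
    by rewrite ltn_eqF // add0r; exact: rE.
  have e0 : imap eps n 0 = 0 by exact: rmorph0.
  transitivity ((i == (size s).-1)%:R : ipoly k n); first by rewrite -[RHS]addr0 -[in RHS]e0.
   case: eqVneq => [->|ne].
    by rewrite -lead_coefE (eqP sm).
  rewrite nth_default //; move: hi ne; case: (size s) => [|m] //= hi ne.
  by rewrite ltn_neqAle eq_sym ne.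
pose alQ : {rmorphism ipoly Q n.+1 -> ipoly Q n.+1} := nagata_aut n e 1.
pose beQ : {rmorphism ipoly Q n.+1 -> ipoly Q n.+1} := nagata_aut n e (- 1).
have alQK : cancel alQ beQ by exact: nagata_autK.
have beQK : cancel beQ alQ by move=> x; rewrite -[RHS](@nagata_autK _ n e (- 1)) opprK.
have imbe x : imap eps n.+1 (beQ x) = be (imap eps n.+1 x).
  by rewrite /beQ imap_nagata rmorphN rmorph1.
have imC x : imap eps n.+1 (x%:P : {poly ipoly Q n}) = (imap eps n x)%:P by exact: map_polyC.
have lift_case (t : seq (ipoly Q n)) :
    (forall j, (j < size t)%N -> J'' (imap eps n (nth 0 t j))) ->
    (forall ex : nat -> nat, exists l, [/\ size l = size t,
      split_regular (iconst Q n) [set 0] l &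
      forall j, (j < size t)%N -> (nth (0, id) l j).1 = nth 0 t j ^+ ex j]) ->
    exists t' : seq (ipoly Q n.+1), [/\ size t' = (size t).+1,
      forall j, (j < (size t).+1)%N -> J (imap eps n.+1 (nth 0 t' j)) &
    forall e : nat -> nat, exists l, [/\ size l = (size t).+1,
      split_regular (iconst Q n.+1) [set 0] l &
      forall j, (j < (size t).+1)%N -> (nth (0, id) l j).1 = nth 0 t' j ^+ e j]].
  move=> tJ tl; pose t' : seq {poly ipoly Q n} := sQ :: map polyC t.
  have st' : size t' = (size t).+1 by rewrite /= size_map.
  exists (map beQ t'); rewrite size_map st'; split=> //.
    move=> j hj; rewrite (nth_map 0) ?st' // imbe; case: j hj => [|j] hj.
      by rewrite [nth _ _ _]/= sQE.
    rewrite [nth _ _ _]/= (nth_map 0) //.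
    by rewrite imC; exact: tJ.
  (* The exponent of index 0 belongs to the monic element in front; hence the shift. *)
  move=> ex; have [l [sl lsr lE]] := tl (ex \o succn).
  have sx : sQ ^+ ex 0%N \is monic by exact: monic_exp.
  have := split_regular_monic sx lsr.
  set l' := _ :: _ => sr'.
  have sr'' := @split_regular_transport Q _ _ (iconst Q n.+1) (iconst Q n.+1) alQ beQ l'
    [set 0] [set 0] (@nagata_aut_const _ _ _ _) (@nagata_aut_const _ _ _ _) alQK beQK _ sr'.
  exists [seq (beQ x.1, fun b => beQ (x.2 (alQ b))) | x <- l']; split.
  - by rewrite size_map /= size_map sl.
  - apply: sr'' => b; split=> [->|]; first exact: rmorph0.
    by move=> /(congr1 beQ); rewrite alQK => ->; exact: rmorph0.
  move=> j hj; rewrite (nth_map (0, id)); last by rewrite /= size_map sl.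
  rewrite (nth_map 0) ?st' //; case: j hj => [|j] hj; first exact: (rmorphXn beQ).
  rewrite [nth _ _ _]/= (nth_map (0, id)) ?sl //.
  rewrite [nth 0 t' _]/= (nth_map 0) // -(rmorphXn beQ).
  by congr (beQ _); rewrite -[LHS]/((nth (0, id) l j).1%:P) lE // rmorphXn.
(* For [h = 0] the monic element alone is the whole sequence. *)
case: h lift_case => [|h] lift_case.
  right; apply: (lift_case [::]) => // ex; by exists [::].
have [ch|[t [st tJ tl]]] := IH h J'' idJ''.
  left; rewrite subSS.
  apply: (has_chain_preimage (f := al)) (going_up_chain sm idJ' Js ch).
    by move=> b; exists (be b).
  move=> p [pp J'p]; split; first exact: prime_preimage.
  by move=> x Jx; apply: J'p; have : J (be (al x)) by rewrite alK.
right; have := lift_case t; rewrite st; apply => //.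
Qed.

(** * Null-homotopies of matrix factorizations *)

Section NullHomotopy.
Variables (k : fieldType) (S : comNzRingType) (kap : {rmorphism k -> S}) (r p : nat).
Variables (G : nat -> 'M[k]_r) (c : nat -> S).
Hypotheses (G_anti : forall x y, (x < p)%N -> (y < p)%N -> G x *m G y = - (G y *m G x))
  (G_sq : forall x, (x < p)%N -> G x *m G x = 0).

Let km (m n : nat) (M : 'M[k]_(m, n)) : 'M[S]_(m, n) := map_mx kap M.

Definition twist_mx : 'M[S]_r := \sum_(x < p) c x *: km (G x).

Lemma twist_mx_sq : twist_mx *m twist_mx = 0.
Proof.
rewrite /twist_mx mulmx_suml; under eq_bigr do rewrite mulmx_sumr.
pose g x y := (c x * c y) *: km (G x *m G y).
rewrite -[RHS](@alternating_sum _ p g).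
- apply: eq_bigr => x _; apply: eq_bigr => y _.
  by rewrite -scalemxAl -scalemxAr scalerA /g /km map_mxM.
- by move=> x y hx hy; rewrite /g G_anti // /km raddfN scalerN mulrC.
- by move=> x hx; rewrite /g G_sq // /km map_mx0 scaler0.
Qed.

Let kmul (u : 'rV[k]_r) : km u *m twist_mx = \sum_(x < p) c x *: km (u *m G x).
Proof.
rewrite mulmx_sumr; apply: eq_bigr => x _.
by rewrite -scalemxAr /km map_mxM.
Qed.

(** Words of length [p + 1] in the [G x] vanish, so applying letters to a vector outside [W], as
    long as the result stays outside, must stop. *)
Let escape (W : 'M[k]_r) : (\rank W < r)%N ->
  exists v : 'rV[k]_r, ~~ (v <= W)%MS /\ forall x, (x < p)%N -> (v *m G x <= W)%MS.
Proof.
move=> hW; have [v0 hv0] : exists v : 'rV[k]_r, ~~ (v <= W)%MS.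
  apply: contrapT => no; move: hW; rewrite ltnNge => /negP; apply.
  rewrite -{1}(mxrank1 k r); apply: mxrankS; apply/row_subP => i.
  by apply: contrapT => /negP h; apply: no; exists (row i 1%:M).
have kv := @killed_anti _ _ p (fun x => mulmxr (G x) : {linear 'rV[k]_r -> 'rV[k]_r}) _ _ v0.
have {}kv : killed p (fun x => mulmxr (G x)) p.+1 v0.
  apply: kv => [x y v hx hy|x v hx] /=; rewrite -!mulmxA; first by rewrite G_anti // mulmxN.
  by rewrite G_sq // mulmx0.
elim: p.+1 v0 hv0 kv => [|m IH] v hv kv; first by rewrite kv sub0mx in hv.
have [h|/existsNP[x /not_implyP[hx /negP hvx]]] :=
  pselect (forall x, (x < p)%N -> (v *m G x <= W)%MS); first by exists v.
exact: IH hvx (kv x hx).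
Qed.

Variable s : S.
Hypothesis s_kill : forall h : 'rV[S]_r, h *m twist_mx = 0 ->
  exists g : 'rV[S]_r, s *: h = g *m twist_mx.

(* The homotopy is extended along a full flag of subspaces stable under G. *)
Lemma null_homotopic_power : exists (N : nat) (sig : 'M[S]_r),
  twist_mx *m sig + sig *m twist_mx = (s ^+ N)%:M.
Proof.
suff /(_ r (leqnn r))[W [_ rW [N [sig sE]]]] : forall m, (m <= r)%N -> exists W : 'M[k]_r,
    [/\ forall x, (x < p)%N -> (W *m G x <= W)%MS, (m <= \rank W)%N &
    exists N (sig : 'M[S]_r), forall u : 'rV[k]_r, (u <= W)%MS ->
      km u *m (twist_mx *m sig + sig *m twist_mx) = s ^+ N *: km u].
  exists N, sig; apply/row_matrixP => i.
  rewrite !rowE mul_mx_scalar; have := sE (delta_mx 0 i).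
  rewrite /km map_delta_mx; apply; apply: submx_full.
  by rewrite /row_full eqn_leq rank_leq_row.
elim=> [|m IH] hm.
  exists 0; split=> [x _||]; [by rewrite mul0mx sub0mx|by []|].
  by exists 0%N, 0 => u; rewrite submx0 => /eqP ->; rewrite /km map_mx0 mul0mx scaler0.
have [W [WG rW [N [sig sE]]]] := IH (ltnW hm).
have [hW|hW] := leqP m.+1 (\rank W); first by exists W; split=> //; exists N, sig.
have [v [vW vG]] := escape (leq_trans hW hm).
(* This functional lets the new homotopy be prescribed at [v] independently of its values on [W]. *)
have [lam [lamW lamv]] : exists lam : 'cV[k]_r, W *m lam = 0 /\ v *m lam = 1%:M.
  have [C [WC vC]] : exists C : 'M[k]_r, W *m C = 0 /\ v *m C != 0.
    by exists (cokermx W); rewrite mulmx_coker -submxE.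
  have [j hj] : exists j, (v *m C) 0 j != 0.
    apply: contrapT => no; move/eqP: vC; apply; apply/rowP => j; rewrite [RHS]mxE.
    by apply/eqP; apply: contrapT => /negP ne; apply: no; exists j.
  exists (((v *m C) 0 j)^-1 *: col j C); split.
    by rewrite -scalemxAr colE mulmxA WC mul0mx scaler0.
  rewrite -scalemxAr colE mulmxA -colE; move: (v *m C) hj => A hj.
  by apply/matrixP => a b; rewrite !ord1 !mxE eqxx mulVf.
set M := twist_mx in sE *.
have MM : M *m M = 0 by exact: twist_mx_sq.
have kM (u : 'rV[k]_r) : km u *m M = \sum_(x < p) c x *: km (u *m G x) by exact: kmul.
have ext (u : 'rV[k]_r) : (forall x, (x < p)%N -> (u *m G x <= W)%MS) ->
    km u *m M *m sig *m M = s ^+ N *: (km u *m M).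
  move=> hu; transitivity (km u *m M *m (M *m sig + sig *m M)).
    by rewrite mulmxDr !mulmxA -[km u *m M *m M]mulmxA MM mulmx0 mul0mx add0r.
  rewrite kM mulmx_suml scaler_sumr; apply: eq_bigr => x _.
  by rewrite -scalemxAl sE ?hu // !scalerA mulrC.
(* The letters map [v] into [W], where the old homotopy works; this makes [z] a cycle. Its class is
   annihilated by [s], and [g] becomes the value of the new homotopy at [v], at the cost of one more
   factor [s]. *)
pose z := s ^+ N *: km v - km v *m M *m sig.
have [g gE] : exists g, s *: z = g *m M.
  by apply: s_kill; rewrite -/M mulmxBl ext // -scalemxAl subrr.
pose sig' := s *: ((1%:M - km lam *m km v) *m sig) + km lam *m g.
have sW (u : 'rV[k]_r) : (u <= W)%MS -> km u *m sig' = s *: (km u *m sig).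
  case/submxP=> a ->; have e : km (a *m W) *m km lam = 0.
    by rewrite /km -map_mxM -mulmxA lamW mulmx0 map_mx0.
  rewrite mulmxDr -scalemxAr mulmxBl mulmxBr mul1mx !mulmxA e !mul0mx subr0 addr0 //.
have sv : km v *m sig' = g.
  have e : km v *m km lam = 1%:M by rewrite /km -map_mxM lamv map_mx1.
  by rewrite mulmxDr -scalemxAr mulmxBl mulmxBr mul1mx !mulmxA e !mul1mx subrr scaler0 add0r.
have sM (u : 'rV[k]_r) : (forall x, (x < p)%N -> (u *m G x <= W)%MS) ->
    km u *m M *m sig' = s *: (km u *m M *m sig).
  move=> hu; rewrite kM !mulmx_suml scaler_sumr; apply: eq_bigr => x _.
  by rewrite -!scalemxAl sW ?hu // !scalerA mulrC.
move: sig' sW sv sM => sig' sW sv sM.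
exists (W + v)%MS; split.
- move=> x hx; rewrite addsmxMr; apply: submx_trans (addsmxSl _ _).
  by rewrite addsmx_sub WG // vG.
- apply: leq_ltn_trans rW (rank_ltmx _); rewrite ltmxE addsmxSl /=.
  by apply: contra vW => /(submx_trans (addsmxSr _ _)).
exists N.+1, sig' => u /sub_addsmxP[[u1 u2] /= ->].
have -> : u2 *m v = u2 0 0 *: v by rewrite {1}[u2]mx11_scalar mul_scalar_mx.
rewrite {1 2}/km map_mxD map_mxZ -/(km _) -/(km _) !mulmxDl scalerDr. congr (_ + _).
  have hw : (u1 *m W <= W)%MS by exact: submxMl.
  rewrite mulmxDr !mulmxA sM; last first.
    by move=> x hx; rewrite -mulmxA; apply: submx_trans (submxMl _ _) (WG _ hx).
  by rewrite sW // -scalemxAl -scalerDr -!mulmxA -mulmxDr sE // scalerA exprS.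
rewrite -scalemxAl scalerA mulrC -scalerA; congr (_ *: _).
rewrite mulmxDr !mulmxA sM // sv -gE /z scalerBr addrC subrK scalerA exprS //.
Qed.

End NullHomotopy.

Section LiftNullHomotopy.
Variables (B K : comNzRingType) (red : {rmorphism B -> K}) (r : nat).

(* [D] is a matrix factorization, so its anticommutator with any lift of [sig]
   commutes with [D] and can be inverted up to its determinant. *)
Lemma lift_null_homotopy (D : 'M[B]_r) (w : B) (sig : 'M[K]_r) (t : K) :
  (forall x, exists b, red b = x) -> D *m D = w%:M ->
  map_mx red D *m sig + sig *m map_mx red D = t%:M ->
  exists (sig' : 'M[B]_r) (del : B),
    D *m sig' + sig' *m D = del%:M /\ red del = t ^+ (r * 2).
Proof.
move=> /choice[lift liftE] DD E.
pose s := map_mx lift sig; have sE : map_mx red s = sig.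
  by apply/matrixP => i j; rewrite !mxE liftE.
pose u := D *m s + s *m D.
have uD : u *m D = D *m u.
  rewrite mulmxDl mulmxDr !mulmxA DD -[s *m D *m D]mulmxA DD addrC scalar_mxC.
  by rewrite -!mulmxA.
(* [u] commutes with [D], but [\adj u] is shown to do so only after multiplication by [\det u],
   which may be a zero divisor; this is why the final scalar is a square. *)
have adjD : \det u *: (\adj u *m D) = \det u *: (D *m \adj u).
  rewrite -[LHS]mul_mx_scalar -(mul_mx_adj u) !mulmxA -[\adj u *m D *m u]mulmxA -uD.
  by rewrite !mulmxA mul_adj_mx mul_scalar_mx scalemxAl.
exists (\det u *: (\adj u *m s)), (\det u ^+ 2); split.
  rewrite -scalemxAr -scalemxAl mulmxA [X in X + _]scalemxAl -adjD -scalemxAl -scalerDr.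
  by rewrite -!mulmxA -mulmxDr -/u mul_adj_mx scale_scalar_mx expr2.
rewrite rmorphXn -det_map_mx /u map_mxD !map_mxM sE E det_scalar -exprM //.
Qed.

End LiftNullHomotopy.

(** * Homological degrees of dg modules *)

Section DirectSum.
Variables (T : eqType) (V : zmodType) (G : T -> set V) (dG : direct_sum G).

Let G0 t : G t 0. Proof. by case: dG => /(_ t)[]. Qed.

Let GB t x y : G t x -> G t y -> G t (x - y).
Proof. by case: dG => /(_ t)[_ +] _ _; apply. Qed.

Lemma direct_sumN t x : G t x -> G t (- x).
Proof. by move=> h; rewrite -sub0r; exact: GB. Qed.

Lemma direct_sumD t x y : G t x -> G t y -> G t (x + y).
Proof. by move=> h h'; rewrite -[y]opprK; apply: GB => //; exact: direct_sumN. Qed.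

Lemma direct_sum_ind (P : set V) : P 0 -> (forall x y, P x -> P y -> P (x + y)) ->
  (forall t x, G t x -> P x) -> forall x, P x.
Proof.
move=> P0 PD PG x; case: dG => _ /(_ x)[s [y [yG ->]]] _.
by apply: big_ind => // t _; exact: PG.
Qed.

Let decomp x (c : T -> V) (s : seq T) : Prop :=
  [/\ forall t, G t (c t), uniq s, forall t, t \notin s -> c t = 0 & x = \sum_(t <- s) c t].

Let sum_extend c (s s' : seq T) : uniq s -> uniq s' -> {subset s <= s'} ->
  (forall t, t \notin s -> c t = 0) -> \sum_(t <- s') c t = \sum_(t <- s) c t :> V.
Proof.
move=> us us' ss c0; rewrite (bigID (mem s)) /= [X in _ + X]big1 => [|t]; last exact: c0.
rewrite addr0 -big_filter; apply: perm_big; apply: uniq_perm => //; first exact: filter_uniq.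
by move=> t; rewrite mem_filter; apply: andb_idr; exact: ss.
Qed.

Let decompD x y c c' s s' : decomp x c s -> decomp y c' s' ->
  decomp (x + y) (fun t => c t + c' t) (undup (s ++ s')).
Proof.
move=> [cG us c0 ->] [cG' us' c0' ->]; split.
- by move=> t; exact: direct_sumD.
- exact: undup_uniq.
- by move=> t; rewrite mem_undup mem_cat => /norP[h h']; rewrite c0 // c0' // addr0.
have s1 : {subset s <= undup (s ++ s')} by move=> t h; rewrite mem_undup mem_cat h.
have s2 : {subset s' <= undup (s ++ s')} by move=> t h; rewrite mem_undup mem_cat h orbT.
by rewrite big_split /= (sum_extend us (undup_uniq _) s1 c0) (sum_extend us' (undup_uniq _) s2 c0').
Qed.

Let decompN x c s : decomp x c s -> decomp (- x) (fun t => - c t) s.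
Proof.
move=> [cG us c0 ->]; split=> // [t|t h|]; first exact: direct_sumN.
  by rewrite c0 // oppr0.
by rewrite sumrN.
Qed.

Let decomp_zero c s : decomp 0 c s -> forall t, c t = 0.
Proof.
move=> [cG us c0 e] t; have [h|h] := boolP (t \in s); last exact: c0.
by case: dG => _ _ /(_ s c us cG (esym e)); apply.
Qed.

Let decomp_single t x : G t x -> decomp x (fun t' => if t' == t then x else 0) [:: t].
Proof.
move=> Gx; split=> //; last by rewrite big_seq1 eqxx.
  by move=> t'; case: eqP => [->|_].
by move=> t'; rewrite inE => /negbTE ->.
Qed.

Let decomp_ex x : exists c, exists s, decomp x c s.
Proof.
apply: (direct_sum_ind (P := [set x | exists c, exists s, decomp x c s])).
- by exists (fun=> 0), [::]; split=> //; rewrite big_nil.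
- move=> a b [c [s h]] [c' [s' h']]; exists (fun t => c t + c' t), (undup (s ++ s')).
  exact: decompD.
- by move=> t a Ga; exists (fun t' => if t' == t then a else 0), [:: t]; exact: decomp_single.
Qed.

Definition component (t : T) (x : V) : V := sval (cid (decomp_ex x)) t.

Let componentP x : exists s, decomp x (component^~ x) s.
Proof. exact: svalP (cid (decomp_ex x)). Qed.

Let component_unique x c s : decomp x c s -> forall t, component t x = c t.
Proof.
move=> h t; have [s' h'] := componentP x; have h2 := decompD h' (decompN h).
by rewrite subrr in h2; have /eqP := decomp_zero h2 t; rewrite subr_eq0 => /eqP.
Qed.

Lemma component_in t x : G t (component t x).
Proof. by have [s []] := componentP x. Qed.

Lemma componentD t x y : component t (x + y) = component t x + component t y.
Proof.
have [s h] := componentP x; have [s' h'] := componentP y.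
exact: component_unique (decompD h h') t.
Qed.

Lemma component_id t x : G t x -> component t x = x.
Proof. by move=> /decomp_single/component_unique ->; rewrite eqxx. Qed.

Lemma component_other t t' x : G t x -> t' != t -> component t' x = 0.
Proof. by move=> /decomp_single/component_unique -> /negbTE ->. Qed.

Lemma component0 t : component t 0 = 0.
Proof. exact: component_id. Qed.

Lemma component_sum x : exists2 s, uniq s & x = \sum_(t <- s) component t x.
Proof. by have [s [_ us _ e]] := componentP x; exists s. Qed.

Lemma component_eq0 x : (forall t, component t x = 0) -> x = 0.
Proof. by move=> h; have [s _ ->] := component_sum x; rewrite big1. Qed.

End DirectSum.

Lemma component_morph (T T' : eqType) (V V' : zmodType) (G : T -> set V) (G' : T' -> set V')
    (dG : direct_sum G) (dG' : direct_sum G') (u : V -> V') (sh : T -> T') :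
  u 0 = 0 -> (forall x y, u (x + y) = u x + u y) -> injective sh ->
  (forall t x, G t x -> G' (sh t) (u x)) ->
  forall t x, component dG' (sh t) (u x) = u (component dG t x).
Proof.
move=> u0 uD shI uG t; apply: (direct_sum_ind dG) => [|x y ex ey|t' x Gx].
- by rewrite u0 !component0.
- by rewrite uD !componentD uD ex ey.
have [->|ne] := eqVneq t t'; first by rewrite !component_id //; exact: uG.
rewrite (component_other dG Gx) // u0 (component_other dG' (uG _ _ Gx)) //.
by apply: contra ne => /eqP/shI ->.
Qed.

(** * Complexes with the internal grading forgotten *)

Section Coarsen.
Variables (D : zmodType) (A : comNzRingType) (gr : D -> set A).
Hypothesis gr_span : forall P : set A, P 0 -> (forall x y, P x -> P y -> P (x + y)) ->
  (forall a x, gr a x -> P x) -> forall x, P x.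

(* Elements of homological degree [i], of arbitrary internal degree. *)
Definition hdeg (X : complex gr) (i : int) : set X :=
  [set x | forall P : set X, P 0 -> (forall x y, P x -> P y -> P (x + y)) ->
    (forall a x, cx_gr X i a x -> P x) -> P x].

Arguments hdeg : clear implicits.

Lemma hdeg_in (X : complex gr) i a x : cx_gr X i a x -> hdeg X i x.
Proof. by move=> h P _ _ PG; exact: PG h. Qed.

Lemma hdeg0 (X : complex gr) i : hdeg X i 0. Proof. by []. Qed.

Lemma hdegD (X : complex gr) i x y : hdeg X i x -> hdeg X i y -> hdeg X i (x + y).
Proof. by move=> hx hy P P0 PD PG; apply: (PD); [exact: hx|exact: hy]. Qed.

Lemma hdeg_ind (X : complex gr) (P : X -> Prop) i : P 0 -> (forall x y, P x -> P y -> P (x + y)) ->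
  (forall a x, cx_gr X i a x -> P x) -> forall x, hdeg X i x -> P x.
Proof. by move=> P0 PD PG x; apply. Qed.

Lemma hdeg_morph (X Y : complex gr) (u : X -> Y) (i j : int) : u 0 = 0 ->
  (forall x y, u (x + y) = u x + u y) ->
  (forall a x, cx_gr X i a x -> hdeg Y j (u x)) ->
  forall x, hdeg X i x -> hdeg Y j (u x).
Proof.
move=> u0 uD uG; apply: (hdeg_ind (P := fun x => hdeg Y j (u x))) => [|y z hy hz|].
- by rewrite u0; exact: hdeg0.
- by rewrite uD; exact: hdegD.
- exact: uG.
Qed.

Section OneComplex.
Variable X : complex gr.

(** The scalar may be inhomogeneous, so it is decomposed by [gr_span], just as [x] is by its
    internal degrees. *)
Lemma hdegZ i q x : hdeg X i x -> hdeg X i (q *: x).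
Proof.
move=> hx; move: q; apply: (gr_span (P := fun q => hdeg X i (q *: x))) => [|q1 q2 h1 h2|a r hr].
- by rewrite scale0r; exact: hdeg0.
- by rewrite scalerDl; exact: hdegD.
move: x hx; apply: (hdeg_ind (P := fun x => hdeg X i (r *: x))) => [|y z hy hz|b y hy].
- by rewrite scaler0; exact: hdeg0.
- by rewrite scalerDr; exact: hdegD.
- by apply: (@hdeg_in _ _ (a + b)); exact: cx_scale.
Qed.

Lemma hdeg_d i x : hdeg X i x -> hdeg X (i - 1) (cx_d X x).
Proof.
apply: hdeg_morph => [|y z|a y hy]; rewrite ?linear0 ?linearD //.
by apply: (@hdeg_in _ _ a); exact: cx_d_deg.
Qed.

Let dX := cx_direct X.

Lemma hdeg_component i t x : hdeg X i x -> t.1 != i -> component dX t x = 0.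
Proof.
move=> hx ne; move: x hx; apply: (hdeg_ind (P := fun x => component dX t x = 0)) => [|y z ey ez|a y hy].
- exact: component0.
- by rewrite componentD ey ez addr0.
apply: (@component_other _ _ _ dX (i, a)) => //.
by apply: contra ne => /eqP ->.
Qed.

Lemma hdeg_direct : direct_sum (hdeg X).
Proof.
split.
- move=> i; split; first exact: hdeg0.
  by move=> x y hx hy; apply: hdegD => //; rewrite -scaleN1r; exact: hdegZ.
- pose P := [set x : X | exists (s : seq int) (y : int -> X),
     [/\ uniq s, forall t, hdeg X t (y t) & x = \sum_(t <- s) y t]].
  move=> x; suff [s [y [_ h1 h2]]] : P x by exists s, y.
  apply: (direct_sum_ind dX) => [|x1 x2 [s1 [y1 [u1 h1 ->]]] [s2 [y2 [u2 h2 ->]]]|[i a] z hz].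
  + by exists [::], (fun=> 0); split=> [//|t|]; [exact: hdeg0|rewrite big_nil].
  + pose z1 t := if t \in s1 then y1 t else 0; pose z2 t := if t \in s2 then y2 t else 0.
    exists (undup (s1 ++ s2)), (fun t => z1 t + z2 t); split; first exact: undup_uniq.
      move=> t; apply: hdegD; rewrite /z1 /z2.
        by case: ifP => _; [exact: h1|exact: hdeg0].
      by case: ifP => _; [exact: h2|exact: hdeg0].
    rewrite big_split /=; congr (_ + _).
      rewrite /z1 -[RHS]big_mkcond /= -[RHS]big_filter; apply: perm_big; apply: uniq_perm => //.
        by rewrite filter_uniq // undup_uniq.
      by move=> t; rewrite mem_filter mem_undup mem_cat; case: (t \in s1).
    rewrite /z2 -[RHS]big_mkcond /= -[RHS]big_filter; apply: perm_big; apply: uniq_perm => //.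
      by rewrite filter_uniq // undup_uniq.
    by move=> t; rewrite mem_filter mem_undup mem_cat; case: (t \in s2); rewrite ?orbT.
  + exists [:: i], (fun t => if t == i then z else 0); split=> //; last by rewrite big_seq1 eqxx.
    by move=> t; case: eqP => [->|_]; [exact: hdeg_in hz|exact: hdeg0].
- move=> s y us hy e t ht; apply: (component_eq0 (dG := dX)) => -[i a].
  have [ei|ne] := eqVneq i t; last exact: hdeg_component (hy t) _.
  have := congr1 (component dX (i, a)) e; rewrite component0.
  rewrite (big_morph (component dX (i, a)) (componentD dX (i, a)) (component0 dX (i, a))).
  rewrite (bigD1_seq t) //= big1 ?addr0 // => j ne.
  by apply: hdeg_component (hy j) _; rewrite /= ei eq_sym.
Qed.

End OneComplex.

Section DGModules.
Variables (n : nat) (f : 'I_n -> A).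

Definition dg_op (X : dgmod gr f) (l : nat) : {linear X -> X} :=
  if insub l is Some i then dg_e X i
  else mklin (fun q x y => esym (etrans (addr0 _) (scaler0 _ q)) : (0 : X) = q *: 0 + 0).

Definition kmod_of (X : dgmod gr f) : kmod A :=
  @KMod A X (hdeg X) (cx_d X) (dg_op X).

Definition scal_of (l : nat) : A := if insub l is Some i then f i else 0.

Hypothesis f_hom : forall i, homogeneous gr (f i).

Lemma dg_opE (X : dgmod gr f) (l : nat) (hl : (l < n)%N) :
  dg_op X l = dg_e X (Ordinal hl).
Proof. by rewrite /dg_op insubT. Qed.

Lemma scal_ofE (l : nat) (hl : (l < n)%N) : scal_of l = f (Ordinal hl).
Proof. by rewrite /scal_of insubT. Qed.

Lemma kmod_of_koszul (X : dgmod gr f) : koszul n scal_of (kmod_of X).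
Proof.
split=> /=.
- by move=> i; exact: hdeg0.
- by move=> i q x y hx hy; apply: hdegD => //; exact: hdegZ.
- exact: hdeg_d.
- exact: cx_dd.
- move=> l i x hl; rewrite dg_opE; have [a fa] := f_hom (Ordinal hl).
  apply: hdeg_morph => [|y z|b y hy]; rewrite ?linear0 ?linearD //.
  by apply: (@hdeg_in _ _ (a + b)); exact: dg_e_deg.
- by move=> l l' x hl hl'; rewrite !dg_opE dg_e_anti.
- by move=> l x hl; rewrite !dg_opE dg_e_sq.
- by move=> l x hl; rewrite !dg_opE scal_ofE dg_e_leibniz.
Qed.

Lemma hdeg_lift (X : dgmod gr f) i z y : hdeg X i z -> z = cx_d X y ->
  exists2 y', hdeg X (i + 1) y' & z = cx_d X y'.
Proof.
move=> hz e; exists (component (hdeg_direct X) (i + 1) y); first exact: component_in.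
have := @component_morph _ _ _ _ _ _ (hdeg_direct X) (hdeg_direct X) (cx_d X)
  (fun j => j - 1) (linear0 _) (linearD _) _ (@hdeg_d X) (i + 1) y.
rewrite addrK -e => <-; last by move=> j j' /addIr.
by rewrite component_id.
Qed.

(** [homology_bijective] speaks of arbitrary elements; taking components of the preimages makes it
    degreewise. *)
Lemma dg_qis (X Y : dgmod gr f) (u : {linear X -> Y}) :
  dg_morphism u -> homology_bijective u ->
  kmorph n (u : {linear kmod_of X -> kmod_of Y}) /\
  kqis (u : {linear kmod_of X -> kmod_of Y}).
Proof.
move=> [ug ud ue] [uinj usurj].
have ug' i x : hdeg X i x -> hdeg Y i (u x).
  apply: hdeg_morph => [|y z|b y hy]; rewrite ?linear0 ?linearD //.
  by apply: (@hdeg_in _ _ b); exact: ug.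
split; first by split=> // l x hl /=; rewrite !dg_opE ue.
split=> /= [i z hz dz [y hy e]|i w hw dw].
  have [x ex] := uinj z dz (ex_intro _ y e).
  exact: hdeg_lift hz ex.
have [z [y [dz e]]] := usurj w dw.
have cd (Z : dgmod gr f) j (v : Z) : component (hdeg_direct Z) (j - 1) (cx_d Z v)
    = cx_d Z (component (hdeg_direct Z) j v).
  apply: (@component_morph _ _ _ _ _ _ (hdeg_direct Z) (hdeg_direct Z) (cx_d Z)
    (fun j => j - 1) (linear0 _) (linearD _) _ (@hdeg_d Z)).
  by move=> j1 j2 /addIr.
have cu j v : component (hdeg_direct Y) j (u v) = u (component (hdeg_direct X) j v).
  exact: (@component_morph _ _ _ _ _ _ (hdeg_direct X) (hdeg_direct Y) u id
    (linear0 _) (linearD _) (fun _ _ e => e) ug').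
exists (component (hdeg_direct X) i z), (component (hdeg_direct Y) (i + 1) y).
split; try exact: component_in.
- by rewrite -cd dz component0.
- rewrite -cu -cd addrK -componentD -e; symmetry; exact: component_id.
Qed.

End DGModules.
End Coarsen.

Arguments hdeg {D A gr} X i.

(** * Null-homotopies on twisted families *)

Section NullHomotopicFamilies.
Variables (Q B : comNzRingType) (iota : {rmorphism Q -> B}) (sc : nat -> Q) (a : nat -> B).

(** The homotopy is required on all families because the components of a cycle over a cone need not
    be cycles. Additivity and B-linearity are what the passage to a cone uses. *)
Definition NH (N : nat) (Y : kmod Q) (del : B) : Prop :=
  exists Th : (int -> B -> Y) -> (int -> B -> Y),
  [/\ forall y, TT iota y -> TT iota (Th y),
      forall y y', TT iota y -> TT iota y' -> forall i b,
        Th (fun i b => y i b + y' i b) i b = Th y i b + Th y' i b,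
      forall y s, TT iota y -> forall i b, Th (fun i b => y i (s * b)) i b = Th y i (s * b) &
      forall y, TT iota y -> forall i b,
        DD N a (Th y) i b + Th (DD N a y) i b = y i (del * b)].

Lemma NH_Kill N Y del : koszul N sc Y -> NH N Y del -> Kill iota N a Y [set 0] del.
Proof.
move=> kY [Th [ThT ThD ThM ThH]] y yT yI yD; exists (Th y).
have TyT := ThT y yT; split=> // [i b ->|i b].
  by have [_ yl _] := TyT; exact: ilin0.
rewrite -(ThH y yT) (_ : DD N a y = fun _ _ => 0); last first.
  by apply/funext => j; apply/funext => c.
have T0 := TT0 iota kY; have := ThD _ _ T0 T0 i b.
rewrite (_ : (fun _ _ => 0 + 0) = (fun _ _ => 0 : Y)); last first.
  by apply/funext => j; apply/funext => c; rewrite addr0.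
by move/eqP; rewrite -subr_eq subrr => /eqP <-; rewrite addr0.
Qed.

Lemma NH_zcone N Y del : koszul N sc Y -> NH N Y del -> NH N.+1 (zcone sc N Y) del.
Proof.
move=> kY [Th [ThT ThD ThM ThH]].
pose p0 (y : int -> B -> zcone sc N Y) (i : int) (b : B) := (y i b).1.
pose p1 (y : int -> B -> zcone sc N Y) (i : int) (b : B) := (y (i + 1) b).2.
have p0T y : TT iota y -> TT iota (p0 y).
  move=> [yg yl [i0 y0]]; split.
  - by move=> i b; have [] := yg i b.
  - by move=> i q b b'; rewrite /p0 yl.
  - by exists i0 => i hi b; rewrite /p0 y0.
have p1T y : TT iota y -> TT iota (p1 y).
  move=> [yg yl [i0 y0]]; split.
  - by move=> i b; have [_] := yg (i + 1) b; rewrite addrK.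
  - by move=> i q b b'; rewrite /p1 yl.
  - by exists (i0 - 1) => i hi b; rewrite /p1 y0 //; lia.
have psum (r : nat) (F : 'I_r -> Y * Y) :
    \sum_(t < r) F t = (\sum_(t < r) (F t).1, \sum_(t < r) (F t).2).
  by elim/big_rec3: _ => [//|t x1 x2 x3 _ ->]; case: (F t).
have D0 (y : int -> B -> zcone sc N Y) i b : (DD N.+1 a y i b).1 = DD N a (p0 y) i b - sc N *: p1 y i b.
  rewrite /DD psum /= big_ord_recr /= eqxx /= addr0 opprD addrA; congr (_ - _ - _).
  by apply: eq_bigr => l _; rewrite ltn_eqF.
have D1 (y : int -> B -> zcone sc N Y) i b :
    (DD N.+1 a y i b).2 = - DD N a (p1 y) (i - 1) b + p0 y (i - 1) (a N * b).
  rewrite /DD psum /= big_ord_recr /= eqxx /= opprK !subrK opprB.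
  rewrite -addrA addrC [p0 _ _ _ + _]addrC /p1 subrK -!addrA; congr (_ + _).
  rewrite addrC; congr (_ + _); rewrite -sumrN.
  by apply: eq_bigr => l _; rewrite ltn_eqF //= subrK.
have ThN y : TT iota y -> forall i b, Th (fun i b => - y i b) i b = - Th y i b.
  move=> yT i b; have [_ yl _] := yT; have [_ Tl _] := ThT y yT.
  have -> : (fun i b => - y i b) = (fun i b => y i (iota (-1) * b)).
    by apply/funext => j; apply/funext => c; rewrite (ilinZ (yl j)) scaleN1r.
  by rewrite ThM // (ilinZ (Tl i)) scaleN1r.
pose Th' (y : int -> B -> zcone sc N Y) : int -> B -> zcone sc N Y :=
  fun i b => (Th (p0 y) i b, - Th (p1 y) (i - 1) b).
exists Th'; split.
- move=> y yT; have [g0 l0 [i0 z0]] := ThT _ (p0T y yT).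
  have [g1 l1 [i1 z1]] := ThT _ (p1T y yT); split.
  + by move=> i b; split=> //=; exact: (km_grN kY).
  + by move=> i q b b'; rewrite /Th' l0 l1; congr pair; rewrite /= opprD scalerN.
  + exists (Num.min i0 i1) => i; rewrite lt_min => /andP[h h'] b.
    by rewrite /Th' z0 // z1 ?oppr0 //; lia.
- move=> y y' yT yT' i b; rewrite /Th' /= /p0 /p1 /=; congr pair.
    exact: (ThD _ _ (p0T y yT) (p0T y' yT')).
  rewrite -opprD; congr (- _); exact: (ThD _ _ (p1T y yT) (p1T y' yT')).
- move=> y s yT i b; rewrite /Th' /=; congr pair; first exact: (ThM _ _ (p0T y yT)).
  congr (- _); exact: (ThM _ _ (p1T y yT)).
move=> y yT i b.
have [_ l1 _] := p1T y yT; have [_ tl1 _] := ThT _ (p1T y yT).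
have T0 := p0T y yT; have T1 := p1T y yT.
have e0 : p0 (Th' y) = Th (p0 y) by [].
have e1 : p1 (Th' y) = fun i b => - Th (p1 y) i b.
  by apply/funext => j; apply/funext => c; rewrite /p1 /Th' /= addrK.
have d0 : p0 (DD N.+1 a y) =
    fun i b => DD N a (p0 y) i b + - p1 y i (iota (sc N) * b).
  by apply/funext => j; apply/funext => c; rewrite /p0 D0 (ilinZ (l1 j)).
have d1 : p1 (DD N.+1 a y) =
    fun i b => - DD N a (p1 y) i b + p0 y i (a N * b).
  by apply/funext => j; apply/funext => c; rewrite /p1 D1 addrK.
have DT0 := TT_DD a kY T0; have DT1 := TT_DD a kY T1.
rewrite (_ : y i (del * b) = ((y i (del * b)).1, (y i (del * b)).2)); last by case: (y i _).
transitivity ((DD N.+1 a (Th' y) i b).1 + (Th' (DD N.+1 a y) i b).1,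
  (DD N.+1 a (Th' y) i b).2 + (Th' (DD N.+1 a y) i b).2); first by [].
congr pair.
  rewrite D0 e0 e1 /Th' /= d0 (ThD _ _ DT0 (TTN kY (TTM _ T1))) (ThN _ (TTM _ T1)).
  rewrite (ThM _ _ T1) (ilinZ (tl1 i)) scalerN opprK addrACA subrr addr0.
  exact: ThH.
rewrite D1 e0 e1 /Th' /= d1 (ThD _ _ (TTN kY DT1) (TTM _ T0)) (ThN _ DT1) (ThM _ _ T0).
rewrite DDN opprK opprD opprK addrACA subrr addr0 (ThH _ T1).
by rewrite /p1 subrK.
Qed.

Lemma NH_iter_cone N e Y del : koszul N sc Y -> NH N Y del ->
  NH (N + e) (iter_cone sc N e Y) del.
Proof.
elim: e N Y => [|e IH] N Y kY nY /=; first by rewrite addn0.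
by rewrite addnS -addSn; apply: IH; [exact: zcone_koszul|exact: NH_zcone].
Qed.

Section Free.
Variables (N : nat) (Y : kmod Q) (kY : koszul N sc Y).
Variables (r : nat) (e : 'I_r -> Y) (dg : 'I_r -> int) (coord : Y -> 'I_r -> Q).
Hypotheses (cP : forall q x y j, coord (q *: x + y) j = q * coord x j + coord y j)
  (cE : forall x, x = \sum_j coord x j *: e j)
  (ce : forall i j, coord (e j) i = (i == j)%:R)
  (e_gr : forall j, km_gr Y (dg j) (e j))
  (c_gr : forall i x j, km_gr Y i x -> dg j != i -> coord x j = 0).

Let cD x y j : coord (x + y) j = coord x j + coord y j.
Proof. by rewrite -[x]scale1r cP mul1r scale1r. Qed.

Let c0 j : coord 0 j = 0.
Proof. by have /eqP := cD 0 0 j; rewrite addr0 -subr_eq subrr => /eqP. Qed.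

Let cZ q x j : coord (q *: x) j = q * coord x j.
Proof. by rewrite -[q *: x]addr0 cP c0 addr0. Qed.

Let cN x j : coord (- x) j = - coord x j.
Proof. by rewrite -scaleN1r cZ mulN1r. Qed.

Let c_sum (T : Type) (s : seq T) (P : pred T) (F : T -> Y) j :
  coord (\sum_(t <- s | P t) F t) j = \sum_(t <- s | P t) coord (F t) j.
Proof. exact: (big_morph (fun x => coord x j) (fun x y => cD x y j) (c0 j)). Qed.

Definition mx_of (u : {linear Y -> Y}) : 'M[Q]_r := \matrix_(i, j) coord (u (e j)) i.

Let coord_mx (u : {linear Y -> Y}) x i : coord (u x) i = \sum_j mx_of u i j * coord x j.
Proof.
rewrite {1}(cE x) linear_sum c_sum; apply: eq_bigr => j _.
by rewrite linearZ cZ mxE mulrC.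
Qed.

Lemma mx_of_anti l l' : (l < N)%N -> (l' < N)%N ->
  mx_of (km_op Y l) *m mx_of (km_op Y l') = - (mx_of (km_op Y l') *m mx_of (km_op Y l)).
Proof.
move=> hl hl'; apply/matrixP => i j; rewrite !mxE.
under eq_bigr do rewrite [mx_of (km_op Y l') _ _]mxE.
under [X in _ = - X]eq_bigr do rewrite [mx_of (km_op Y l) _ _]mxE.
by rewrite -!coord_mx (km_anti kY) // cN.
Qed.

Lemma mx_of_sq l : (l < N)%N -> mx_of (km_op Y l) *m mx_of (km_op Y l) = 0.
Proof.
move=> hl; apply/matrixP => i j; rewrite !mxE.
under eq_bigr do rewrite [X in _ * X]mxE.
by rewrite -coord_mx (km_sq kY) // c0.
Qed.

Lemma mx_of_dd : mx_of (km_d Y) *m mx_of (km_d Y) = 0.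
Proof.
apply/matrixP => i j; rewrite !mxE; under eq_bigr do rewrite [X in _ * X]mxE.
by rewrite -coord_mx (km_dd kY) c0.
Qed.

Lemma mx_of_leib l : (l < N)%N ->
  mx_of (km_d Y) *m mx_of (km_op Y l) + mx_of (km_op Y l) *m mx_of (km_d Y) = (sc l)%:M.
Proof.
move=> hl; apply/matrixP => i j; rewrite !mxE.
under eq_bigr do rewrite [X in _ * X]mxE.
under [X in _ + X]eq_bigr do rewrite [X in _ * X]mxE.
by rewrite -!coord_mx (km_leib kY) // cD cN subrK cZ ce mulr_natr.
Qed.

Definition twisted_mx : 'M[B]_r :=
  \sum_(l < N) a l *: map_mx iota (mx_of (km_op Y l)) - map_mx iota (mx_of (km_d Y)).

(** Before any correction through the Koszul complex, the twist on a free module is a matrix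
    factorization. *)
Lemma twisted_mx_sq : twisted_mx *m twisted_mx = (- \sum_(l < N) a l * iota (sc l))%:M.
Proof.
pose E l := map_mx iota (mx_of (km_op Y l)); pose d := map_mx iota (mx_of (km_d Y)).
have EE : (\sum_(l < N) a l *: E l) *m (\sum_(l < N) a l *: E l) = 0.
  rewrite mulmx_suml; under eq_bigr do rewrite mulmx_sumr.
  rewrite -[RHS](@alternating_sum _ N (fun x y => (a x * a y) *: (E x *m E y))).
  - apply: eq_bigr => x _; apply: eq_bigr => y _.
    by rewrite -scalemxAl -scalemxAr scalerA.
  - move=> x y hx hy; rewrite /E -!map_mxM (mx_of_anti hx hy) raddfN scalerN mulrC //.
  - by move=> x hx; rewrite /E -map_mxM mx_of_sq // map_mx0 scaler0.
have dd : d *m d = 0 by rewrite /d -map_mxM mx_of_dd map_mx0.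
rewrite /twisted_mx -/d -/(E _) mulmxBl !mulmxBr -/E EE dd sub0r subr0.
rewrite mulmx_suml mulmx_sumr -opprD -big_split /= [RHS]raddfN; congr (- _).
rewrite [RHS]raddf_sum /=.
apply: eq_bigr => l _; rewrite -scalemxAl -scalemxAr -scalerDr /E /d -!map_mxM -map_mxD.
by rewrite addrC mx_of_leib // map_scalar_mx scale_scalar_mx.
Qed.

(** A family amounts to one Q-linear map from B to Q for each basis element, read in the degree of
    that element. So [sig] acts on families even if it does not respect degrees. *)
Lemma NH_free (sig : 'M[B]_r) (del : B) :
  twisted_mx *m sig + sig *m twisted_mx = del%:M -> NH N Y del.
Proof.
move=> sE.
pose cf (y : int -> B -> Y) j b : Q := coord (y (dg j) b) j.
pose mk (c : 'I_r -> B -> Q) : int -> B -> Y :=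
  fun i b => \sum_(j | dg j == i) c j b *: e j.
have cf_lin y j : TT iota y -> forall q b b',
    cf y j (iota q * b + b') = q * cf y j b + cf y j b'.
  by move=> [_ yl _] q b b'; rewrite /cf yl cP.
have cf_sum y j (T : finType) (F : T -> B) : TT iota y ->
    cf y j (\sum_t F t) = \sum_t cf y j (F t).
  by move=> [_ yl _]; rewrite /cf (ilin_sum (yl _)) c_sum.
have mk_cf y : TT iota y -> forall i b, y i b = mk (cf y) i b.
  move=> [yg _ _] i b; rewrite {1}(cE (y i b)) (bigID (fun j => dg j == i)) /=.
  rewrite [X in _ + X]big1 ?addr0 => [|j hj]; last by rewrite (c_gr (yg i b)) // scale0r.
  by apply: eq_bigr => j /eqP ej; rewrite /cf ej.
have cf_mk c j b : cf (mk c) j b = c j b.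
  rewrite /cf /mk c_sum (bigD1 j) //= cZ ce eqxx mulr1 big1 ?addr0 // => i /andP[_ ne].
  by rewrite cZ ce eq_sym (negbTE ne) mulr0.
have mk_TT c : (forall j q b b', c j (iota q * b + b') = q * c j b + c j b') -> TT iota (mk c).
  move=> cl; split.
  - move=> i b; apply: (km_gr_sum kY) => j /eqP <-; exact: (km_grZ kY).
  - move=> i q b b'; rewrite /mk scaler_sumr -big_split /=; apply: eq_bigr => j _.
    by rewrite cl scalerDl scalerA.
  - exists (- \sum_j `|dg j|) => i hi b; rewrite /mk big1 // => j /eqP ej.
    have : `|dg j| <= \sum_j `|dg j| by rewrite (bigD1 j) //= lerDl sumr_ge0.
    by move: hi; rewrite -ej; lia.
have act_lin (M : 'M[B]_r) y j : TT iota y -> forall q b b',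
    \sum_j' cf y j' (M j j' * (iota q * b + b')) =
    q * (\sum_j' cf y j' (M j j' * b)) + \sum_j' cf y j' (M j j' * b').
  move=> yT q b b'; rewrite mulr_sumr -big_split /=; apply: eq_bigr => j' _.
  by rewrite mulrDr mulrCA cf_lin.
have cfD y : TT iota y -> forall j b,
    cf (DD N a y) j b = \sum_j' cf y j' (twisted_mx j j' * b).
  move=> yT j b; have [yg yl _] := yT; rewrite /cf /DD cD cN c_sum.
  under eq_bigr do rewrite coord_mx.
  rewrite coord_mx exchange_big /= -sumrB; apply: eq_bigr => j' _.
  have -> : twisted_mx j j' * b = \sum_(l < N) iota (mx_of (km_op Y l) j j') * (a l * b)
      + iota (- mx_of (km_d Y) j j') * b.
    rewrite /twisted_mx !mxE summxE mulrBl mulr_suml rmorphN mulNr; congr (_ - _).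
    by apply: eq_bigr => l _; rewrite !mxE mulrCA mulrA.
  rewrite (ilinD (yl _)) cD (ilin_sum (yl _)) c_sum (ilinZ (yl _)) cZ mulNr.
  congr (_ - _).
    apply: eq_bigr => l _; rewrite (ilinZ (yl _)) cZ.
    (* Matrix entries between basis elements of unsuitable degrees vanish, so nothing is lost by
       reading coordinate [j'] in degree [dg j']. *)
    have [->|ne] := eqVneq (dg j') (dg j - 1); first by [].
    rewrite mxE (c_gr (km_op_gr kY (ltn_ord l) (e_gr j'))) ?mul0r //.
    by apply: contra ne => /eqP ->; rewrite addrK.
  have [->|ne] := eqVneq (dg j') (dg j + 1); first by [].
  rewrite mxE (c_gr (km_d_gr kY (e_gr j'))) ?mul0r //.
  by apply: contra ne => /eqP ->; rewrite subrK.
exists (fun y => mk (fun j b => \sum_j' cf y j' (sig j j' * b))); split.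
- by move=> y yT; apply: mk_TT => j; exact: act_lin.
- move=> y y' yT yT' i b; rewrite /mk -big_split /=; apply: eq_bigr => j _.
  rewrite -scalerDl -big_split /=; congr (_ *: _); apply: eq_bigr => j' _.
  by rewrite /cf cD.
- move=> y s yT i b; rewrite /mk; apply: eq_bigr => j _; congr (_ *: _).
  by apply: eq_bigr => j' _; rewrite /cf mulrCA.
move=> y yT i b; have DT := TT_DD a kY yT.
have sT : TT iota (mk (fun j b => \sum_j' cf y j' (sig j j' * b))).
  by apply: mk_TT => j; exact: act_lin.
have mkE c i' b' : mk c i' b' = \sum_(j | dg j == i') c j b' *: e j by [].
rewrite (mk_cf _ (TTM del yT)) (mk_cf _ (TT_DD a kY sT)) !mkE -big_split /=.
apply: eq_bigr => j _; rewrite -scalerDl cfD //; congr (_ *: _).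
under [X in X + _ = _]eq_bigr do rewrite cf_mk.
under [X in _ + X = _]eq_bigr do rewrite cfD //.
rewrite exchange_big [X in _ + X]exchange_big -big_split /=.
have dE (j'' : 'I_r) : \sum_j' sig j' j'' * (twisted_mx j j' * b)
    + \sum_j' twisted_mx j' j'' * (sig j j' * b) = (del *+ (j == j'')) * b.
  have := congr1 (fun M : 'M_r => M j j'' * b) sE; rewrite !mxE => <-.
  rewrite mulrDl !mulr_suml; congr (_ + _); apply: eq_bigr => j' _; ring.
transitivity (\sum_j'' cf y j'' ((del *+ (j == j'')) * b)).
  apply: eq_bigr => j'' _; rewrite -!cf_sum // -dE.
  by have [_ yl _] := yT; rewrite /cf (ilinD (yl _)) cD.
rewrite (bigD1 j) //= eqxx mulr1n big1 ?addr0 // => j'' ne.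
by rewrite eq_sym (negbTE ne) mulr0n mul0r; have [_ yl _] := yT; rewrite /cf (ilin0 (yl _)) c0.
Qed.

End Free.
End NullHomotopicFamilies.

(** * Homogeneous primes *)

Section Homogenization.
Variables (k : fieldType) (n : nat).
Local Notation S := {mpoly k[n]}.

(* The substitution X_l |-> X_l T^(w l), which records the weight of each monomial
   in the exponent of the extra variable T. *)
Definition weigh (w : 'I_n -> nat) : {rmorphism S -> {poly S}} :=
  mmap (polyC \o @mpolyC n k : {rmorphism k -> {poly S}}) (fun l => ('X_l)%:P * 'X^(w l)).

Lemma weighC w c : weigh w c%:MP = (c%:MP)%:P.
Proof. exact: mmapC. Qed.

Lemma weigh_monomial w m : weigh w 'X_[m] = ('X_[m])%:P * 'X^(\sum_l w l * m l).
Proof.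
transitivity (mmap1 (fun l => ('X_l)%:P * 'X^(w l)) m : {poly S}); first exact: mmapX.
rewrite [in RHS]mpolyXE_id rmorph_prod expr_sum -big_split /=.
by apply: eq_bigr => i _; rewrite rmorphXn exprM -exprMn.
Qed.

Lemma weighX w l : weigh w 'X_l = ('X_l)%:P * 'X^(w l).
Proof.
by rewrite weigh_monomial (bigD1 l) //= mnm1E eqxx muln1 big1 ?addn0 // => i /negbTE ne;
   rewrite mnm1E eq_sym ne muln0.
Qed.

Lemma weighZ w c s : weigh w (c *: s) = (c%:MP)%:P * weigh w s.
Proof. by rewrite -mul_mpolyC rmorphM weighC. Qed.

Lemma weigh_coef w s d : (0 < w)%N -> (weigh (fun=> w) s)`_(w * d) = pihomog mdeg d s.
Proof.
move=> hw; elim/mpolyind: s => [|c m p _ _ IH]; first by rewrite rmorph0 coef0 pihomog0.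
rewrite (rmorphD (weigh (fun=> w))) coefD pihomogD; congr (_ + _); last exact: IH.
rewrite linearZ [RHS]/= weighZ weigh_monomial.
rewrite -big_distrr /= -mdegE !coefCM coefXn pihomogX eqn_pmul2l // eq_sym.
by case: ifP; rewrite ?mulr1 ?mulr0 ?scaler0 // mul_mpolyC.
Qed.

Lemma weigh_idem w s i : weigh w ((weigh w s)`_i) = ((weigh w s)`_i)%:P * 'X^i.
Proof.
elim/mpolyind: s => [|c m p _ _ IH]; first by rewrite !rmorph0 coef0 rmorph0 mul0r.
rewrite (rmorphD (weigh w)) coefD (rmorphD (weigh w)) polyCD mulrDl; congr (_ + _); last exact: IH.
rewrite weighZ weigh_monomial !coefCM coefXn.
case: eqVneq => [->|ne]; last by rewrite !mulr0 rmorph0 mul0r.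
by rewrite mulr1 rmorphM weighC weigh_monomial polyCM mulrA.
Qed.

Lemma weigh_at1 w s : (weigh w s).[1] = s.
Proof.
elim/mpolyind: s => [|c m p _ _ IH]; first by rewrite rmorph0 horner0.
rewrite (rmorphD (weigh w)) hornerD; congr (_ + _); last exact: IH.
by rewrite weighZ weigh_monomial !hornerM !hornerC hornerXn expr1n mulr1 mul_mpolyC.
Qed.

Definition homogeneous_core (p : set S) : set S :=
  [set s | forall d, p (pihomog mdeg d s)].

Lemma homogeneous_core_sub p : ideal p -> homogeneous_core p `<=` p.
Proof.
move=> idp s hs; rewrite -[s](weigh_at1 (fun=> 1%N)) horner_coef; apply: ideal_sum => // i _.
rewrite expr1n mulr1; have := weigh_coef s i (ltnSn 0); rewrite mul1n => ->; exact: hs.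
Qed.

(** For [x] and [y] outside the core, take their components of lowest degree outside [p]. In the
    component of [x * y] whose degree is the sum of the two, all other terms lie in [p]. *)
Lemma homogeneous_core_prime p : prime_ideal p -> homogeneous_prime (homogeneous_core p).
Proof.
move=> [idp p1 pp]; have [p0 pD pM] := idp.
have E s d : pihomog mdeg d s = (weigh (fun=> 1%N) s)`_d.
  by have := weigh_coef s d (ltnSn 0); rewrite mul1n.
have idc : ideal (homogeneous_core p).
  split=> [d|x y hx hy d|a x hx d]; first by rewrite pihomog0.
    by rewrite pihomogD; exact: pD.
  rewrite E rmorphM coefM; apply: ideal_sum => // i _.
  by apply: pM; rewrite -E; exact: hx.
split; last first.
  move=> s hs d e; have [<-|ne] := eqVneq d e; first by rewrite pihomog_id.
  by rewrite (@pihomog_ne0 _ _ _ d) ?pihomogP // eq_sym.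
split=> //; first by move=> /(homogeneous_core_sub idp).
move=> x y hxy; apply: contrapT => /not_orP[/existsNP hx /existsNP hy].
have min s : (exists d, ~ p (pihomog mdeg d s)) ->
    exists2 d, ~ p (weigh (fun=> 1%N) s)`_d & forall i, (i < d)%N -> p (weigh (fun=> 1%N) s)`_i.
  move=> [d hd]; have ex : exists d, `[< ~ p (weigh (fun=> 1%N) s)`_d >].
    by exists d; apply/asboolP; rewrite -E.
  exists (ex_minn ex); first by case: ex_minnP => i /asboolP.
  case: ex_minnP => i _ imin j hj; apply: contrapT => nj.
  by have := imin j; rewrite leqNgt hj => /(_ (asboolT nj)).
have [d hd dmin] := min x hx; have [e he emin] := min y hy.
have := hxy (d + e)%N; rewrite E rmorphM coefM.
have hde : (d < (d + e).+1)%N by rewrite ltnS leq_addr.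
rewrite (bigD1 (Ordinal hde)) //= addKn => pde.
suff : p ((weigh (fun=> 1%N) x)`_d * (weigh (fun=> 1%N) y)`_e) by move=> /pp[].
move: pde; set rest := \sum_(i | _) _ => pde.
rewrite -[_ * _](addrK rest); apply: idealB => //.
apply: ideal_sum => // i ne; have [lt|le] := ltnP i d.
  by rewrite mulrC; apply: pM; exact: dmin.
apply: pM; apply: emin; have := ltn_ord i.
have : (d < i)%N by rewrite ltn_neqAle le andbT; apply: contra ne => /eqP e'; apply/eqP/val_inj.
lia.
Qed.

Section TwistedAnnihilator.
Variables (r p : nat) (G : nat -> 'M[k]_r) (dg : 'I_r -> int).

Let kap : {rmorphism k -> S} := @mpolyC n k.

Definition mx_ann (M : 'M[S]_r) : set S :=
  [set s | forall h : 'rV[S]_r, h *m M = 0 -> exists g : 'rV[S]_r, s *: h = g *m M].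

Lemma mx_ann_ideal M : ideal (mx_ann M).
Proof.
split=> [h _|x y hx hy h hM|a x hx h hM]; first by exists 0; rewrite scale0r mul0mx.
  have [g e] := hx h hM; have [g' e'] := hy h hM.
  by exists (g + g'); rewrite scalerDl e e' mulmxDl.
by have [g e] := hx h hM; exists (a *: g); rewrite -scalerA e scalemxAl.
Qed.

Variables (E : 'I_n -> 'M[k]_r) (d : 'M[k]_r).
Hypotheses (E_deg : forall l i j, dg i != dg j + 1 -> E l i j = 0)
  (d_deg : forall i j, dg i != dg j - 1 -> d i j = 0).

Let M : 'M[S]_r := \sum_l 'X_l *: map_mx kap (E l) - map_mx kap d.

(* Giving chi_l degree 2, the differential raises the degree of
   S (x) Hom(F, k) by 1; [c j] is the degree of the j-th basis element, shifted. *)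
Lemma mx_ann_homogeneous s m : mx_ann M s -> mx_ann M (pihomog mdeg m s).
Proof.
(* Adding [C] makes the degrees of the basis elements nonnegative, so that powers of T can record
   total degrees. *)
move=> Js; pose C := \sum_j `|dg j|; pose c j := `|(dg j + C)%R|%N.
have cE j : (c j)%:Z = dg j + C.
  have : `|dg j| <= C by rewrite /C (bigD1 j) //= lerDl sumr_ge0.
  by rewrite /c; lia.
pose Th (w : 'rV[S]_r) j : {poly S} := weigh (fun=> 2%N) (w 0 j) * 'X^(c j).
have ThM w j : Th (w *m M) j = 'X * \sum_i Th w i * (M i j)%:P.
  rewrite /Th mxE rmorph_sum mulr_suml mulr_sumr; apply: eq_bigr => i _.
  rewrite rmorphM /M !mxE summxE rmorphB polyCB !mulrBr mulrBl; congr (_ - _).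
    rewrite !rmorph_sum !mulr_sumr mulr_suml; apply: eq_bigr => l _; rewrite !mxE.
    have [e|ne] := eqVneq (dg i) (dg j + 1); last first.
      by rewrite E_deg // rmorph0 mulr0 rmorph0 rmorph0 !mulr0 mul0r.
    have -> : c i = (c j).+1 by have := cE i; have := cE j; lia.
    rewrite (rmorphM (weigh (fun=> 2%N))) weighX weighC (rmorphM polyC) (exprS _ (c j)) expr2; ring.
  rewrite ?mxE weighC; have [e|ne] := eqVneq (dg i) (dg j - 1); last first.
    by rewrite d_deg // rmorph0 !mulr0 mul0r.
  have -> : c j = (c i).+1 by have := cE i; have := cE j; lia.
  rewrite exprS; ring.
pose cf w t : 'rV[S]_r := \row_j (Th w j)`_t.
have cfM w t : cf w t *m M = cf (w *m M) t.+1.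
  apply/rowP => j; rewrite !mxE ThM coefXM /= coef_sum; apply: eq_bigr => i _.
  by rewrite mxE coefMC.
(* Multiplying a homogeneous vector by [s] and taking the part [2 * m] degrees higher isolates the
   component of [s] of degree [m]. *)
have cfs w t : cf (s *: cf w t) (t + 2 * m)%N = pihomog mdeg m s *: cf w t.
  apply/rowP => j; rewrite [LHS]mxE [RHS]mxE [cf w t 0 j]mxE.
  have -> : Th (s *: cf w t) j = weigh (fun=> 2%N) s * (weigh (fun=> 2%N) (Th w j)`_t * 'X^(c j)).
    by rewrite {1}/Th mxE [cf w t 0 j]mxE (rmorphM (weigh (fun=> 2%N))) mulrA.
  have -> : weigh (fun=> 2%N) (Th w j)`_t * 'X^(c j) = ((Th w j)`_t)%:P * 'X^t.
    rewrite /Th coefMXn; case: ltnP => h; first by rewrite rmorph0 mul0r polyC0 mul0r.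
    by rewrite weigh_idem -mulrA -exprD subnK.
  by rewrite mulrA coefMXn ltnNge leq_addr /= addKn coefMC weigh_coef.
have cf_sum w : exists K, w = \sum_(t < K) cf w t.
  exists (\max_j size (Th w j)); apply/rowP => j; rewrite summxE.
  have e : (Th w j).[1] = w 0 j by rewrite /Th hornerM weigh_at1 hornerXn expr1n mulr1.
  rewrite -{1}e (@horner_coef_wide _ (\max_j size (Th w j))); last first.
    exact: (@leq_bigmax _ (fun j => size (Th w j))).
  by apply: eq_bigr => t _; rewrite expr1n mulr1 mxE.
move=> h hM.
have cfJ t : exists g : 'rV[S]_r, pihomog mdeg m s *: cf h t = g *m M.
  have [|g e] := Js (cf h t).
    by rewrite cfM hM; apply/rowP => j; rewrite !mxE /Th mxE rmorph0 mul0r coef0.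
  rewrite -cfs e; case: (t + 2 * m)%N => [|u]; last by exists (cf g u); rewrite cfM.
  by exists 0; rewrite mul0mx; apply/rowP => j; rewrite mxE [RHS]mxE ThM coefXM.
have /choice[g gE] := cfJ; have [K ->] := cf_sum h.
exists (\sum_(t < K) g t); rewrite scaler_sumr mulmx_suml; apply: eq_bigr => t _.
exact: gE.
Qed.

End TwistedAnnihilator.

Lemma mpoly_to_ipoly : exists phi : {rmorphism S -> ipoly k n},
  [/\ forall c, phi c%:MP = iconst k n c, forall l : 'I_n, phi 'X_l = ivar k n l &
      forall b, exists s, phi s = b].
Proof.
pose phi : {rmorphism S -> ipoly k n} := mmap (iconst k n) (fun l => ivar k n l).
have phiC c : phi c%:MP = iconst k n c by exact: mmapC.
have phiX (l : 'I_n) : phi 'X_l = ivar k n l.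
  by rewrite -[RHS](mmap1U (fun l : 'I_n => ivar k n l)); exact: mmapX.
exists phi; split=> // b.
pose psi := ieval (@mpolyC n k : {rmorphism k -> S})
  (fun i => if insub i is Some l then 'X_(l : 'I_n) else 0) n.
exists (psi b).
apply: (@ieval_unique2 _ _ _ _ _ psi phi idfun idfun) => [c|i hi].
  by rewrite /psi ieval_const phiC.
by rewrite /psi ieval_var // insubT phiX.
Qed.

End Homogenization.

(** * Annihilators of Ext as annihilators of matrices *)

Lemma sign_succ (R : comNzRingType) (i : int) :
  (-1) ^+ absz (i + 1) = - (-1) ^+ absz i :> R.
Proof.
case: i => m; first by rewrite -PoszD addn1 exprS mulN1r.
have -> : Negz m + 1 = - m%:Z by rewrite NegzE; lia.
by rewrite abszN /= exprS mulN1r opprK.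
Qed.

Section FreeDG.
Variables (D : zmodType) (Q : comNzRingType) (gr : D -> set Q).
Hypothesis gr_span : forall P : set Q, P 0 -> (forall x y, P x -> P y -> P (x + y)) ->
  (forall a x, gr a x -> P x) -> forall x, P x.
Variables (n : nat) (f : 'I_n -> Q).
Hypothesis f_hom : forall i, homogeneous gr (f i).
Variable F : dgmod gr f.

Definition free_basis (r : nat) (e : 'I_r -> F) (dg : 'I_r -> int) (ad : 'I_r -> D)
    (coord : F -> 'I_r -> Q) : Prop :=
  [/\ forall q x y j, coord (q *: x + y) j = q * coord x j + coord y j,
      forall x, x = \sum_j coord x j *: e j,
      forall i j, coord (e j) i = (i == j)%:R,
      forall j, cx_gr F (dg j) (ad j) (e j) &
      forall i x j, hdeg F i x -> dg j != i -> coord x j = 0].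

Lemma finite_free_basis : finite_free F -> exists r (e : 'I_r -> F) dg ad coord,
  free_basis e dg ad coord.
Proof.
move=> [r [e [/choice[dg /choice[ad eG]] /choice[c cE]]]].
have uniq x (c' : {ffun 'I_r -> Q}) : x = \sum_j c' j *: e j -> c x = c'.
  by case: (cE x) => _; apply.
exists r, e, dg, ad, (fun x j => c x j).
have cP q x y j : c (q *: x + y) j = q * c x j + c y j.
  rewrite (uniq _ [ffun j => q * c x j + c y j]) ?ffunE //.
  rewrite {1}(cE x).1 {1}(cE y).1 scaler_sumr -big_split /=.
  by apply: eq_bigr => i _; rewrite ffunE scalerDl scalerA.
split=> // [x|i j|i x j hx ne]; first by have [] := cE x.
  rewrite (uniq _ [ffun i => (i == j)%:R]) ?ffunE // (bigD1 j) //= ffunE eqxx scale1r.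
  by rewrite big1 ?addr0 // => i' ne; rewrite ffunE (negbTE ne) scale0r.
(* Taking components of degree [i] expresses [x] by the basis elements of degree [i] alone;
   uniqueness of coordinates removes the others. *)
rewrite (uniq x [ffun j => if dg j == i then c x j else 0]) ?ffunE ?(negbTE ne) //.
have dF := hdeg_direct gr_span F.
rewrite -[LHS](component_id dF hx) {1}(cE x).1.
rewrite (big_morph (component dF i) (componentD dF i) (component0 dF i)).
apply: eq_bigr => j' _; rewrite ffunE; have ge := hdeg_in (eG j').
have gce := hdegZ gr_span (c x j') ge.
case: eqVneq => [<-|ne']; first by rewrite (component_id dF gce).
by rewrite scale0r (component_other dF gce) // eq_sym.
Qed.

Variables (k : fieldType) (eps : {rmorphism Q -> k}).
Variables (r : nat) (e : 'I_r -> F) (dg : 'I_r -> int) (ad : 'I_r -> D).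
Variable coord : F -> 'I_r -> Q.
Hypothesis eB : free_basis e dg ad coord.

Local Notation S := {mpoly k[n]}.

Definition op_mx (l : nat) : 'M[k]_r :=
  map_mx eps (mx_of (Y := kmod_of F) e coord (dg_op F l)).
Definition d_mx : 'M[k]_r := map_mx eps (mx_of (Y := kmod_of F) e coord (cx_d F)).
Definition ext_mx : 'M[S]_r :=
  \sum_(l < n) 'X_l *: map_mx (@mpolyC n k) (op_mx l) - map_mx (@mpolyC n k) d_mx.

Lemma op_mx_deg (l : 'I_n) i j : dg i != dg j + 1 -> op_mx l i j = 0.
Proof.
case: eB => _ _ _ eG cG ne; rewrite !mxE (cG (dg j + 1)) ?rmorph0 //.
exact: km_op_gr (kmod_of_koszul gr_span f_hom F) _ _ _ (ltn_ord l) (hdeg_in (eG j)).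
Qed.

Lemma d_mx_deg i j : dg i != dg j - 1 -> d_mx i j = 0.
Proof.
case: eB => _ _ _ eG cG ne; rewrite !mxE (cG (dg j - 1)) ?rmorph0 //.
exact: km_d_gr (kmod_of_koszul gr_span f_hom F) _ _ (hdeg_in (eG j)).
Qed.

Fact lin_of_linear (h : 'rV[S]_r) :
  linear_for (eps \; *:%R) (fun x : F => \sum_j eps (coord x j) *: h 0 j).
Proof.
case: eB => cP _ _ _ _ q x y; rewrite /= scaler_sumr -big_split /=.
by apply: eq_bigr => j _; rewrite cP rmorphD rmorphM scalerDl scalerA.
Qed.

Definition lin_of (h : 'rV[S]_r) : {linear F -> S | eps \; *:%R} :=
  HB.pack (fun x : F => \sum_j eps (coord x j) *: h 0 j)
    (GRing.isLinear.Build Q F S (eps \; *:%R) _ (lin_of_linear h)).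

Let lin_ofE h x : lin_of h x = \sum_j eps (coord x j) *: h 0 j.
Proof. by []. Qed.

Let lin_of_basis h j : lin_of h (e j) = h 0 j.
Proof.
case: eB => _ _ ce _ _; rewrite lin_ofE (bigD1 j) //= ce eqxx rmorph1 scale1r.
by rewrite big1 ?addr0 // => i ne; rewrite ce (negbTE ne) rmorph0 scale0r.
Qed.

Let lin_expand (g : {linear F -> S | eps \; *:%R}) x :
  g x = \sum_j eps (coord x j) *: g (e j).
Proof.
case: eB => _ cE _ _ _; rewrite {1}(cE x) linear_sum; apply: eq_bigr => j _.
by rewrite linearZ_LR.
Qed.

Let row_of (g : {linear F -> S | eps \; *:%R}) : 'rV[S]_r := \row_j g (e j).

Let ext_mxE i j :
  ext_mx i j = \sum_(l < n) 'X_l * (op_mx l i j)%:MP - (d_mx i j)%:MP.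
Proof.
rewrite /ext_mx; move: op_mx d_mx => O dd; rewrite !mxE summxE; congr (_ - _).
by apply: eq_bigr => l _; rewrite !mxE.
Qed.

Let untwisted (g : {linear F -> S | eps \; *:%R}) j :
  (row_of g *m ext_mx) 0 j =
  \sum_(l < n) 'X_l * g (dg_e F l (e j)) - g (cx_d F (e j)).
Proof.
rewrite mxE; under eq_bigr do rewrite ext_mxE mulrBr mulr_sumr.
rewrite sumrB exchange_big /=; congr (_ - _); last first.
  rewrite [RHS]lin_expand; apply: eq_bigr => i _.
  by rewrite !mxE mulrC mul_mpolyC.
apply: eq_bigr => l _; rewrite [X in _ = _ * X]lin_expand mulr_sumr.
apply: eq_bigr => i _; rewrite !mxE (dg_opE F (ltn_ord l)).
have -> : Ordinal (ltn_ord l) = l by apply: val_inj.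
by rewrite mulrC -mulrA mul_mpolyC.
Qed.

Let twist_expand (g : {linear F -> S | eps \; *:%R}) x :
  \sum_(l < n) 'X_l * g (dg_e F l x) - g (cx_d F x) =
  \sum_j eps (coord x j) *: (row_of g *m ext_mx) 0 j.
Proof.
have H (u : {linear F -> F}) : g (u x) = \sum_j eps (coord x j) *: g (u (e j)).
  case: eB => _ cE _ _ _; rewrite {1}(cE x) linear_sum linear_sum.
  by apply: eq_bigr => j _; rewrite linearZ /= linearZ_LR.
under [RHS]eq_bigr do rewrite untwisted scalerBr scaler_sumr.
rewrite sumrB exchange_big /= -H; congr (_ - _); apply: eq_bigr => l _.
by rewrite H mulr_sumr; apply: eq_bigr => j _; rewrite scalerAr.
Qed.

(** [ext_mx] only connects basis elements whose degrees differ by 1, so the signs of [twisted_d] can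
    be absorbed into a change of signs of the coordinates. *)
Let sign_row (g : 'rV[S]_r) j :
  ((\row_i ((-1) ^+ absz (dg i) * g 0 i)) *m ext_mx) 0 j =
  (-1) ^+ absz (dg j + 1) * (g *m ext_mx) 0 j.
Proof.
rewrite !mxE mulr_sumr; apply: eq_bigr => i _; rewrite mxE.
have [e1|ne1] := eqVneq (dg i) (dg j + 1); first by rewrite e1 mulrA.
have [e2|ne2] := eqVneq (dg i) (dg j - 1).
  by rewrite -[dg j](subrK 1) -e2 !sign_succ opprK mulrA.
have -> : ext_mx i j = 0.
  rewrite ext_mxE d_mx_deg // rmorph0 subr0 big1 // => l _.
  by rewrite op_mx_deg // rmorph0 mulr0.
by rewrite !mulr0.
Qed.

Lemma ann_ExtP s : ann_Ext eps F s <-> mx_ann ext_mx s.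
Proof.
have [cP cE ce eG cG] := eB; split.
  move=> As h hM; have [i a x hx|g gE] := As (lin_of h).
    rewrite /twisted_d twist_expand.
    have -> : row_of (lin_of h) = h by apply/rowP => j; rewrite mxE lin_of_basis.
    by rewrite hM big1 ?mulr0 // => j _; rewrite mxE scaler0.
  exists (\row_i ((-1) ^+ absz (dg i) * row_of g 0 i)); apply/rowP => j.
  rewrite sign_row untwisted mxE -(lin_of_basis h j).
  exact: gE (eG j).
move=> As h hD.
have hM : row_of h *m ext_mx = 0.
  apply/rowP => j; rewrite untwisted [RHS]mxE; have := hD _ _ _ (eG j).
  by rewrite /twisted_d => /(congr1 (fun z => (-1) ^+ absz (dg j + 1) * z)); rewrite signrMK mulr0.
have [g gE] := As _ hM; pose g' := \row_i ((-1) ^+ absz (dg i) * g 0 i) : 'rV[S]_r.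
exists (lin_of g') => i a x hx; have hx' := hdeg_in hx.
rewrite /twisted_d twist_expand.
have -> : row_of (lin_of g') = g' by apply/rowP => j; rewrite mxE lin_of_basis.
rewrite (lin_expand h) !mulr_sumr; apply: eq_bigr => j _.
have [ej|ne] := eqVneq (dg j) i; last by rewrite (cG i) // rmorph0 !scale0r !mulr0.
rewrite /g' sign_row ej -scalerAr -scalerAr signrMK -gE !mxE //.
Qed.

End FreeDG.

(** * Chains of primes in the support *)

Lemma koszul_eq (Q : comNzRingType) N (sc sc' : nat -> Q) (Y : kmod Q) :
  (forall l, (l < N)%N -> sc l = sc' l) -> koszul N sc Y -> koszul N sc' Y.
Proof.
by move=> e [h1 h2 h3 h4 h5 h6 h7 h8]; split=> // l x hl; rewrite h8 // e.
Qed.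

Lemma iter_cone_qis (Q : comNzRingType) (sc : nat -> Q) N e (X Y : kmod Q)
    (u : {linear X -> Y}) : koszul N sc X -> koszul N sc Y -> kmorph N u -> kqis u ->
  exists u' : {linear iter_cone sc N e X -> iter_cone sc N e Y},
    kmorph (N + e) u' /\ kqis u'.
Proof.
elim: e N X Y u => [|e IH] N X Y u kX kY hu qu; first by exists u; rewrite addn0.
have [u' hu'] := IH _ _ _ (zmap sc N u) (zcone_koszul kX) (zcone_koszul kY)
  (zmap_morph sc hu) (zmap_qis kX kY hu qu).
by exists u'; rewrite addnS -addSn.
Qed.

Lemma kacyclic_qis (Q : comNzRingType) N (sc : nat -> Q) (X Y : kmod Q)
    (u : {linear X -> Y}) : koszul N sc X -> koszul N sc Y -> kmorph N u -> kqis u ->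
  kacyclic (fun=> True) X <-> kacyclic (fun=> True) Y.
Proof.
move=> kX kY [ug ud _] [uinj usurj]; split=> ac i _ z hz dz.
  have [x [y [hx hy dx ->]]] := usurj i z hz dz.
  have [x' hx' ->] := ac i I x hx dx.
  exists (u x' + y); first by apply: (km_grD kY) => //; exact: ug.
  by rewrite linearD ud.
have [y hy e] : exists2 y, km_gr Y (i + 1) y & u z = km_d Y y.
  by apply: (ac i I); [exact: ug|rewrite -ud dz linear0].
by apply: (uinj i z hz dz); exists y.
Qed.

Lemma imap_ker (Q : comNzRingType) (k : fieldType) (eps : {rmorphism Q -> k})
    (e : nat) (z : nat -> Q) :
  (forall q, eps q = 0 -> exists c : nat -> Q, q = \sum_(m < e) c m * z m) ->
  forall n (b : ipoly Q n), imap eps n b = 0 ->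
  exists c : nat -> ipoly Q n, b = \sum_(m < e) c m * iconst Q n (z m).
Proof.
move=> z_gen; elim=> [|n IH] b; first exact: z_gen.
move=> b0; have b0' i : imap eps n (b : {poly ipoly Q n})`_i = 0.
  have := congr1 (fun p : {poly ipoly k n} => p`_i) b0.
  by rewrite coef0 => <-; rewrite -[imap eps n.+1 b]/(map_poly (imap eps n) b) coef_map.
have /choice[c cE] := fun i => IH _ (b0' i).
exists (fun m => \poly_(i < size (b : {poly ipoly Q n})) c i m).
apply/polyP => i; rewrite coef_sum; under eq_bigr do rewrite coefMC coef_poly.
case: ltnP => hi; first exact: cE.
by rewrite nth_default // big1 // => m _; rewrite mul0r.
Qed.

(** * The annihilation argument *)

Section Core.
Variables (D : zmodType) (Q : comNzRingType) (gr : D -> set Q).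
Hypothesis gr_span : forall P : set Q, P 0 -> (forall x y, P x -> P y -> P (x + y)) ->
  (forall a x, gr a x -> P x) -> forall x, P x.
Variables (n : nat) (f : 'I_n -> Q).
Hypothesis f_hom : forall i, homogeneous gr (f i).
Variables (k : fieldType) (eps : {rmorphism Q -> k}).
Hypothesis eps_surj : forall x, exists q, eps q = x.
Variables (e : nat) (z : nat -> Q).
Hypothesis z_gen : forall q, eps q = 0 -> exists c : nat -> Q, q = \sum_(m < e) c m * z m.
Variables (h : nat) (x : nat -> Q) (bf : nat -> nat -> Q).
Hypotheses (x_eps : forall c, eps (x c) = 0)
  (f_x : forall l : 'I_n, f l = \sum_(c < h) bf l c * x c).

Local Notation S := {mpoly k[n]}.
Let B : comNzRingType := ipoly Q n.
Let iota : {rmorphism Q -> B} := iconst Q n.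

Let f_eps l : eps (f l) = 0.
Proof. by rewrite f_x rmorph_sum big1 // => c _; rewrite rmorphM x_eps mulr0. Qed.

Let sc (l : nat) : Q := if (l < n)%N then scal_of f l else z (l - n).

Let xz_ex : exists xz : nat -> nat -> Q, forall c, x c = \sum_(m < e) xz c m * z m.
Proof. by have /choice[xz xzE] := fun c => z_gen (x_eps c); exists xz. Qed.

Let xz : nat -> nat -> Q := sval (cid xz_ex).
Let xzE c : x c = \sum_(m < e) xz c m * z m. Proof. exact: svalP (cid xz_ex) c. Qed.

Let eta (c : nat) : B := \sum_(l < n) ivar Q n l * iota (bf l c).

(* With y_m the Koszul generators over the z_m and x_c = \sum_m xz c m * z m, the
   operators e_l - \sum_c bf l c \sum_m (xz c m) y_m have square zero and commute
   with the differential; they act on the modules where each e_l vanishes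
   through the h elements \sum_m (xz c m) y_m. *)
Let a (l : nat) : B :=
  if (l < n)%N then ivar Q n l else - \sum_(c < h) iota (xz c (l - n)) * eta c.

Let sc_lt l (hl : (l < n)%N) : sc l = f (Ordinal hl).
Proof. by rewrite /sc hl scal_ofE. Qed.

Let sc_ge m : sc (n + m)%N = z m.
Proof. by rewrite /sc ltnNge leq_addr addKn. Qed.

Let a_lt l : (l < n)%N -> a l = ivar Q n l. Proof. by rewrite /a => ->. Qed.

Let a_ge m : a (n + m)%N = - \sum_(c < h) iota (xz c m) * eta c.
Proof. by rewrite /a ltnNge leq_addr addKn. Qed.

(** The expansion of the [f l] in the [x c] turns [\sum_l chi_l f_l] into [\sum_c x_c eta_c], which
    is what the correction subtracts. *)
Let asc : \sum_(l < n + e) a l * iota (sc l) = 0.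
Proof.
rewrite big_split_ord /=.
have -> : \sum_(m < e) a (n + m)%N * iota (sc (n + m)%N)
        = - \sum_(c < h) iota (x c) * eta c.
  under eq_bigr do rewrite a_ge sc_ge mulNr mulr_suml.
  rewrite [LHS]sumrN exchange_big /=; congr (- _); apply: eq_bigr => c _.
  rewrite xzE rmorph_sum mulr_suml; apply: eq_bigr => m _.
  by rewrite rmorphM mulrAC.
apply/eqP; rewrite subr_eq0; apply/eqP.
under [RHS]eq_bigr do rewrite mulr_sumr.
rewrite exchange_big /=; apply: eq_bigr => l _.
rewrite a_lt // (sc_lt (ltn_ord l)); have -> : Ordinal (ltn_ord l) = l by apply: val_inj.
rewrite f_x rmorph_sum mulr_sumr; apply: eq_bigr => c _.
by rewrite rmorphM mulrC -mulrA mulrCA; congr (_ * _); rewrite mulrC.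
Qed.

Let Kx (X : dgmod gr f) : kmod Q := iter_cone sc n e (kmod_of X).

Let kK (X : dgmod gr f) : koszul n sc (kmod_of X).
Proof.
apply: (@koszul_eq _ _ (scal_of f)); last exact: (kmod_of_koszul gr_span f_hom X).
by move=> l hl; rewrite /sc hl.
Qed.

Let kKx (X : dgmod gr f) : koszul (n + e) sc (Kx X).
Proof. exact: iter_cone_koszul. Qed.

Let proj : fam_proj iota. Proof. exact: fam_proj_ipoly. Qed.

Lemma quasi_isomorphic_ind (P : dgmod gr f -> Prop) :
  (forall (X Y : dgmod gr f) (u : {linear X -> Y}), dg_morphism u -> homology_bijective u ->
     P X <-> P Y) ->
  forall X Y, quasi_isomorphic X Y -> P X <-> P Y.
Proof.
move=> h0 X Y; elim=> {X Y} [X Y [u [hu qu]]|//|X Y _ [h1 h2]|X Y Z _ [h1 h2] _ [h3 h4]].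
- exact: h0 hu qu.
- by split.
- by split=> [/h1/h3|/h4/h2].
Qed.

Let Kill_zigzag (X Y : dgmod gr f) s : quasi_isomorphic X Y ->
  Kill iota (n + e) a (Kx X) [set 0] s <-> Kill iota (n + e) a (Kx Y) [set 0] s.
Proof.
move: X Y; apply: quasi_isomorphic_ind => X Y u hu qu.
have [ku ku'] := dg_qis gr_span hu qu.
have [u' [hu' qu']] := iter_cone_qis e (kK X) (kK Y) ku ku'.
exact: (Kill_qis proj asc (kKx X) (kKx Y) hu' qu').
Qed.

Let kacyclic_zigzag (X Y : dgmod gr f) : quasi_isomorphic X Y ->
  kacyclic (fun=> True) (kmod_of X) <-> kacyclic (fun=> True) (kmod_of Y).
Proof.
move: X Y; apply: quasi_isomorphic_ind => X Y u hu qu.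
have [ku ku'] := dg_qis gr_span hu qu.
exact: (kacyclic_qis (kK X) (kK Y) ku ku').
Qed.

Section FreeSide.
Variables (F : dgmod gr f) (r : nat) (b : 'I_r -> F) (dg : 'I_r -> int) (ad : 'I_r -> D).
Variable coord : F -> 'I_r -> Q.
Hypothesis bB : free_basis b dg ad coord.

(** Over k the [f l] vanish, so the differential anticommutes with the operators and joins them as
    letter number [n], with coefficient -1. The flag argument then covers the whole twisted
    differential. *)
Let G (l : nat) : 'M[k]_r := if (l < n)%N then op_mx eps b coord l else d_mx eps b coord.
Let cS (l : nat) : S := if insub l is Some i then 'X_(i : 'I_n) else -1.

Let ext_twist : twist_mx (@mpolyC n k) n.+1 G cS = ext_mx eps b coord.
Proof.
rewrite /twist_mx big_ord_recr /= /ext_mx /cS /G ltnn insubN ?ltnn // scaleN1r.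
congr (_ - _); apply: eq_bigr => l _; rewrite ltn_ord.
by rewrite (valK l).
Qed.

Let G_anti l l' : (l < n.+1)%N -> (l' < n.+1)%N -> G l *m G l' = - (G l' *m G l).
Proof.
case: bB => cP cE ce _ _ hl hl'; have kF := kmod_of_koszul gr_span f_hom F.
have od i : (i < n)%N -> d_mx eps b coord *m op_mx eps b coord i
                       = - (op_mx eps b coord i *m d_mx eps b coord).
  move=> hi; apply/eqP; rewrite -addr_eq0 -!map_mxM -map_mxD.
  rewrite (mx_of_leib (Y := kmod_of F) kF cP cE ce hi) map_scalar_mx.
  by rewrite /scal_of insubT f_eps raddf0.
rewrite /G; case: ltnP => h1; case: ltnP => h2.
- by rewrite -!map_mxM (mx_of_anti (Y := kmod_of F) kF cP cE h1 h2) map_mxN.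
- by rewrite od // opprK.
- by rewrite od.
by rewrite -!map_mxM (mx_of_dd (Y := kmod_of F) kF cP cE) map_mx0 oppr0.
Qed.

Let G_sq l : (l < n.+1)%N -> G l *m G l = 0.
Proof.
case: bB => cP cE ce _ _ hl; have kF := kmod_of_koszul gr_span f_hom F.
rewrite /G; case: ltnP => h1; rewrite -!map_mxM.
  by rewrite (mx_of_sq (Y := kmod_of F) kF cP cE h1) map_mx0.
by rewrite (mx_of_dd (Y := kmod_of F) kF cP cE) map_mx0.
Qed.

Let D_mx : 'M[B]_r := twisted_mx iota a n (Y := kmod_of F) b coord.

Let D_mx_red (phi : {rmorphism S -> ipoly k n}) :
  (forall c, phi c%:MP = iconst k n c) -> (forall l : 'I_n, phi 'X_l = ivar k n l) ->
  map_mx (imap eps n) D_mx = map_mx phi (ext_mx eps b coord).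
Proof.
move=> phiC phiX; rewrite /D_mx /twisted_mx /ext_mx !map_mxB; congr (_ - _).
  rewrite !raddf_sum; apply: eq_bigr => l _; rewrite /= !map_mxZ a_lt // imap_var phiX.
  congr (_ *: _); apply/matrixP => i j; rewrite !mxE.
  exact: etrans (imap_const eps n _) (esym (phiC _)).
by apply/matrixP => i j; rewrite !mxE; exact: etrans (imap_const eps n _) (esym (phiC _)).
Qed.

(** A power of [s] is null-homotopic over k, and the lifted homotopy belongs to some [del] that
    agrees with a power of [t] modulo the [z m]. These annihilate the homology by means of the
    Koszul generators. *)
Lemma Kill_lift (phi : {rmorphism S -> ipoly k n}) s (t : B) :
  (forall c, phi c%:MP = iconst k n c) -> (forall l : 'I_n, phi 'X_l = ivar k n l) ->
  ann_Ext eps F s -> imap eps n t = phi s ->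
  exists M, Kill iota (n + e) a (Kx F) [set 0] (t ^+ M).
Proof.
move=> phiC phiX /(ann_ExtP gr_span f_hom eps bB) Js ts.
have [|N [sig sE]] := @null_homotopic_power k _ (@mpolyC n k) r n.+1 G cS G_anti G_sq s.
  by rewrite ext_twist.
rewrite ext_twist in sE; have [cP cE ce eG cG] := bB.
have sE' : map_mx (imap eps n) D_mx *m map_mx phi sig
    + map_mx phi sig *m map_mx (imap eps n) D_mx = (phi s ^+ N)%:M.
  by rewrite (D_mx_red phiC phiX) -!map_mxM -map_mxD sE map_scalar_mx rmorphXn.
have DD := twisted_mx_sq iota a (kK F) cP cE ce.
have [sig' [del [delE dr]]] := lift_null_homotopy (imap_surj eps_surj (n := n)) DD sE'.
have nF : NH iota a n (kmod_of F) del.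
  apply: (NH_free (kK F) cP cE ce _ cG delE).
  by move=> j; exact: hdeg_in (eG j).
have Kd := NH_Kill (kKx F) (NH_iter_cone e (kK F) nF).
exists (N * (r * 2))%N; have [c cE'] : exists c : nat -> B,
    t ^+ (N * (r * 2)) - del = \sum_(m < e) c m * iota (z m).
  apply: (imap_ker z_gen); rewrite rmorphB rmorphXn ts exprM.
  by apply/eqP; rewrite subr_eq0 dr.
rewrite -[t ^+ _](subrK del) cE'; apply: (KillD (kKx F)) => //.
apply: (Kill_sum (kKx F)) => m; rewrite mulrC; apply: KillM.
by rewrite -sc_ge; apply: (Kill_sc (kKx F)); rewrite ltn_add2l.
Qed.

End FreeSide.

Section TorsionSide.
Variables (X : dgmod gr f) (X0 : forall l v, dg_e X l v = 0).

Let op0 l v : (l < n)%N -> km_op (Kx X) l v = 0.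
Proof.
move=> hl; apply: iter_cone_op0 => // {}v.
by rewrite /= (dg_opE X hl) X0.
Qed.

Let xi_fun c (v : Kx X) : Kx X := - \sum_(m < e) xz c m *: km_op (Kx X) (n + m) v.

Fact xi_linear c : linear (xi_fun c).
Proof.
move=> q u v; rewrite /xi_fun scalerN -opprD; congr (- _).
rewrite scaler_sumr -big_split /=; apply: eq_bigr => m _.
by rewrite linearP scalerDr !scalerA [q * _]mulrC.
Qed.

Let xi c : {linear Kx X -> Kx X} := mklin (xi_linear c).

Let xi2 c c' v : xi c (xi c' v) =
  \sum_(m < e) \sum_(m' < e) (xz c m * xz c' m') *: km_op (Kx X) (n + m) (km_op (Kx X) (n + m') v).
Proof.
rewrite /= /xi_fun -sumrN; apply: eq_bigr => m _.
rewrite linearN scalerN opprK linear_sum scaler_sumr; apply: eq_bigr => m' _.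
by rewrite linearZ scalerA.
Qed.

Let op_anti m m' v : (m < e)%N -> (m' < e)%N ->
  km_op (Kx X) (n + m) (km_op (Kx X) (n + m') v) =
  - km_op (Kx X) (n + m') (km_op (Kx X) (n + m) v).
Proof. by move=> hm hm'; apply: (km_anti (kKx X)); rewrite ltn_add2l. Qed.

Let xi_anti c c' v : xi c (xi c' v) = - xi c' (xi c v).
Proof.
rewrite !xi2 exchange_big -sumrN; apply: eq_bigr => m _.
rewrite -sumrN; apply: eq_bigr => m' _.
by rewrite op_anti // scalerN mulrC.
Qed.

Let xi_sq c v : xi c (xi c v) = 0.
Proof.
rewrite xi2; apply: (@alternating_sum _ e (fun m m' => (xz c m * xz c m') *:
  km_op (Kx X) (n + m) (km_op (Kx X) (n + m') v))) => [m m' hm hm'|m hm].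
  by rewrite op_anti // scalerN mulrC.
by rewrite (km_sq (kKx X)) ?scaler0 // ltn_add2l.
Qed.

Let DDxi y i b : TT iota y -> DD (n + e) a y i b =
  \sum_(c < h) xi c (y (i - 1) (eta c * b)) - km_d (Kx X) (y (i + 1) b).
Proof.
move=> [_ yl _]; rewrite /DD; congr (_ - _).
rewrite big_split_ord /= big1 ?add0r => [|l _]; last exact: op0.
rewrite /xi_fun sumrN exchange_big /= -sumrN; apply: eq_bigr => m _.
rewrite a_ge -sumrN mulr_suml (ilin_sum (yl _)) linear_sum -sumrN.
apply: eq_bigr => c _.
have -> : - (iota (xz c m) * eta c) * b = iota (- xz c m) * (eta c * b).
  by rewrite rmorphN !mulNr mulrA.
by rewrite (ilinZ (yl _)) linearZ /= scaleNr.
Qed.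

Lemma Kill_torsion l : split_regular iota [set 0] l -> size l = h.+1 ->
  (forall j, (j < size l)%N -> exists r : B,
     Kill iota (n + e) a (Kx X) [set 0] r /\ (nth (0, id) l j).1 = r ^+ (2 ^ j)) ->
  Kill iota (n + e) a (Kx X) [set 0] 1.
Proof.
move=> sr sl hr; apply: (Kill_one (kKx X) asc DDxi sr) => // v; rewrite sl.
exact: killed_anti.
Qed.

End TorsionSide.

(** Nakayama's lemma for [H_i(F)] in terms of cycles and boundaries, to be proved separately in the
    local and in the graded case. *)
Definition nakayama_for (F : dgmod gr f) : Prop :=
  forall i, (forall v, hdeg F i v -> cx_d F v = 0 ->
     exists y (c : nat -> F), [/\ hdeg F (i + 1) y, forall m, hdeg F i (c m),
       forall m, cx_d F (c m) = 0 & v = cx_d F y + \sum_(m < e) z m *: c m]) ->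
  forall v, hdeg F i v -> cx_d F v = 0 -> exists2 y, hdeg F (i + 1) y & v = cx_d F y.

Lemma Kill1_acyclic (F : dgmod gr f) : finite_free F -> nakayama_for F ->
  Kill iota (n + e) a (Kx F) [set 0] 1 -> kacyclic (fun=> True) (kmod_of F).
Proof.
move=> /(finite_free_basis gr_span)[r [b [dg [ad [coord [cP cE ce eG cG]]]]]] nak K1.
(* No basis element has degree below [i0]. *)
pose i0 : int := - \sum_j `|dg j|.
have low i v : i < i0 -> hdeg F i v -> v = 0.
  move=> hi hv; rewrite (cE v) big1 // => j _; rewrite (cG i) ?scale0r //.
  have : `|dg j| <= \sum_j `|dg j| by rewrite (bigD1 j) //= lerDl sumr_ge0.
  by rewrite /i0 in hi; lia.
suff ac j : kacyclic (fun i => i < i0 + j%:Z) (kmod_of F).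
  by move=> i _; apply: (ac `|(i - i0 + 1)%R|%N); lia.
elim: j => [|j IH] i hi v hv dv.
  by exists 0; [exact: hdeg0|rewrite linear0; apply: (low i) => //; lia].
have [lt|ge] := ltP i (i0 + j%:Z); first exact: IH lt v hv dv.
have ei : i = i0 + j%:Z by lia.
rewrite -ei in IH; apply: nak => // w hw dw.
have aug0 l : (l < n + e)%N -> ieval idfun (fun=> 0 : Q) n (a l) = 0.
  have eta0 c : ieval idfun (fun=> 0 : Q) n (eta c) = 0.
    rewrite rmorph_sum big1 // => m _; rewrite rmorphM [X in X * _](_ : _ = 0) ?mul0r //.
    exact: ieval_var.
  move=> _; rewrite /a; case: ltnP => hl; first exact: ieval_var.
  by rewrite rmorphN rmorph_sum big1 ?oppr0 // => c _; rewrite rmorphM eta0 mulr0.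
have [|y [c [hy hc dc ew]]] := @iter_cone_decomp _ sc n e (kmod_of F) i (kK F) IH _ w hw dw.
  apply: (@lowest_homology _ _ iota _ sc a _ (kKx F) asc i (ieval idfun (fun=> 0 : Q) n)) => //.
    by move=> q; exact: ieval_const.
  exact: iter_cone_acyclic_below.
exists y, c; split=> //; rewrite {1}ew; congr (_ + _).
by apply: eq_bigr => m _; rewrite sc_ge.
Qed.

Theorem support_chain (X F : dgmod gr f) : (forall l v, dg_e X l v = 0) ->
  ~ kacyclic (fun=> True) (kmod_of X) ->
  quasi_isomorphic X F -> finite_free F -> nakayama_for F ->
  has_chain [set p | prime_ideal p /\ ann_Ext eps F `<=` p] (n - h).
Proof.
move=> X0 nX qXF fF nak.
have [r [b [dg [ad [coord bB]]]]] := finite_free_basis gr_span fF.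
have [phi [phiC phiX phiS]] := mpoly_to_ipoly k n.
have annP := ann_ExtP gr_span f_hom eps bB.
have [J0 JD JM] := mx_ann_ideal (ext_mx eps b coord).
pose J' : set (ipoly k n) := [set y | exists2 s, ann_Ext eps F s & phi s = y].
have idJ' : ideal J'.
  split.
  - by exists 0; [exact/annP|rewrite rmorph0].
  - move=> _ _ [s1 h1 <-] [s2 h2 <-]; exists (s1 + s2); last by rewrite rmorphD.
    by apply/annP; apply: JD; exact/annP.
  - move=> w _ [s hs <-]; have [w' <-] := phiS w; exists (w' * s); last by rewrite rmorphM.
    by apply/annP; apply: JM; exact/annP.
have [ch|[t [st tJ tl]]] := noether_normalization eps_surj h idJ'.
  apply: (has_chain_preimage (f := phi)) ch => // p [pp J'p].
  split; first exact: prime_preimage.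
  by move=> s hs; apply: J'p; exists s.
have /choice[M MK] : forall j, exists M, (j < h.+1)%N ->
    Kill iota (n + e) a (Kx F) [set 0] (nth 0 t j ^+ M).
  move=> j; have [hj|hj] := ltnP j h.+1; last by exists 0%N.
  have [s hs es] := tJ j hj.
  by have [M hM] := Kill_lift bB phiC phiX hs (esym es); exists M.
(* [M j] is the power that annihilates on [F], and [2 ^ j] is the cost of [j] passages to a
   quotient. *)
have [l [sl lsr lE]] := tl (fun j => M j * 2 ^ j)%N.
exfalso; apply: nX; apply/(kacyclic_zigzag qXF).
apply: (Kill1_acyclic fF nak); apply/(Kill_zigzag 1 qXF).
apply: (Kill_torsion X0 lsr sl) => j; rewrite sl => hj.
exists (nth 0 t j ^+ M j); split; last by rewrite lE // exprM.
by apply/(Kill_zigzag _ qXF); exact: MK.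
Qed.

End Core.

(** * Regular sequences as lists *)

(** The determinant of the identity minus [c] maps to 1 under [eps], hence is a unit, and by
    Cramer's rule it multiplies every [t i] into [P]. *)
Lemma nakayama (Q : comNzRingType) (k : comNzRingType) (eps : {rmorphism Q -> k})
    (eps_unit : forall q, eps q = 1 -> exists q', q' * q = 1)
    (V : lmodType Q) (P : set V) (P0 : P 0) (PD : forall x y, P x -> P y -> P (x + y))
    (PZ : forall q x, P x -> P (q *: x)) (r : nat) (t : 'I_r -> V) (c : 'I_r -> 'I_r -> Q) :
  (forall i j, eps (c i j) = 0) ->
  (forall i, P (t i - \sum_j c i j *: t j)) -> forall i, P (t i).
Proof.
move=> c0 ct l; pose N : 'M[Q]_r := \matrix_(i, j) ((i == j)%:R - c i j).
have NP i : P (\sum_j N i j *: t j).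
  have -> : \sum_j N i j *: t j = t i - \sum_j c i j *: t j.
    under eq_bigr do rewrite mxE scalerBl; rewrite sumrB; congr (_ - _).
    rewrite (bigD1 i) //= eqxx scale1r big1 ?addr0 // => j /negbTE ne.
    by rewrite eq_sym ne scale0r.
  exact: ct.
have [|q qN] := eps_unit (\det N).
  rewrite -det_map_mx; have -> : map_mx eps N = 1%:M.
    by apply/matrixP => i j; rewrite !mxE rmorphB c0 subr0 rmorph_nat.
  exact: det1.
suff : P (\det N *: t l) by move=> /(PZ q); rewrite scalerA qN scale1r.
have -> : \det N *: t l = \sum_i (\adj N) l i *: \sum_j N i j *: t j.
  under [RHS]eq_bigr do rewrite scaler_sumr.
  rewrite exchange_big /=; transitivity (\sum_j (\adj N *m N) l j *: t j).
    rewrite mul_adj_mx (bigD1 l) //= big1 ?addr0 => [|j /negbTE ne].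
      by rewrite mxE eqxx.
    by rewrite mxE eq_sym ne scale0r.
  apply: eq_bigr => j _; rewrite mxE scaler_suml.
  by apply: eq_bigr => i _; rewrite scalerA.
by apply: big_ind => // i _; exact: PZ.
Qed.

Section IdealGen.
Variable A : comNzRingType.
Implicit Types (J X : set A) (s l : seq A).

Lemma ideal_gen_ideal X : ideal (ideal_gen X).
Proof.
split=> [J [] //|x y hx hy J idJ XJ|a x hx J idJ XJ]; have [J0 JD JM] := idJ.
  by apply: (JD); [exact: hx|exact: hy].
by apply: (JM); exact: hx.
Qed.

Lemma ideal_gen_in X x : X x -> ideal_gen X x. Proof. by move=> h J _; apply. Qed.

Lemma ideal_gen_min X J : ideal J -> X `<=` J -> ideal_gen X `<=` J.
Proof. by move=> idJ XJ x; exact. Qed.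

Lemma ideal_gen_mono X X' : X `<=` X' -> ideal_gen X `<=` ideal_gen X'.
Proof. by move=> h x hx J idJ XJ; apply: hx => // y /h; exact: XJ. Qed.

Lemma ideal_gen_combination (n : nat) (y : 'I_n -> A) q : ideal_gen (range y) q ->
  exists c : 'I_n -> A, q = \sum_i c i * y i.
Proof.
move=> h; apply: (h [set q | exists c : 'I_n -> A, q = \sum_i c i * y i]); last first.
  move=> _ [i _ <-]; exists (fun j => (j == i)%:R).
  rewrite (bigD1 i) //= eqxx mul1r big1 ?addr0 // => j /negbTE ->.
  by rewrite mul0r.
split=> [|x z [c ->] [c' ->]|a x [c ->]].
- by exists (fun=> 0); rewrite big1 // => i _; rewrite mul0r.
- by exists (fun i => c i + c' i); rewrite -big_split; apply: eq_bigr => i _; rewrite mulrDl.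
- by exists (fun i => a * c i); rewrite mulr_sumr; apply: eq_bigr => i _; rewrite mulrA.
Qed.

Definition gen s : set A := ideal_gen [set` s].

Lemma gen_eq s s' : s =i s' -> gen s = gen s'.
Proof.
move=> e; congr ideal_gen; apply/seteqP; split=> x /=; by rewrite e.
Qed.

Lemma gen_combination s q : gen s q -> exists c : nat -> A, q = \sum_(i < size s) c i * s`_i.
Proof.
move=> h; have [|c ->] := @ideal_gen_combination _ (fun i : 'I_(size s) => s`_i) q.
  move: h; apply: ideal_gen_mono => x /= xs; have lt : (index x s < size s)%N by rewrite index_mem.
  by exists (Ordinal lt) => //=; rewrite nth_index.
exists (fun i => if insub i is Some j then c j else 0).
by apply: eq_bigr => i _; rewrite valK.
Qed.

Lemma gen_cons a s x : gen (a :: s) x -> exists b, gen s (x - a * b).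
Proof.
move=> h; apply: (h [set x | exists b, gen s (x - a * b)]); last first.
  move=> y; rewrite /= inE => /orP[/eqP ->|ys].
    by exists 1 => //; rewrite mulr1 subrr; have [] := ideal_gen_ideal [set` s].
  by exists 0 => //; rewrite mulr0 subr0; exact: ideal_gen_in.
have [g0 gD gM] := ideal_gen_ideal [set` s]; split=> [|y z [b hb] [c hc]|c y [b hb]].
- by exists 0 => //; rewrite mulr0 subr0.
- by exists (b + c) => //; rewrite mulrDr opprD addrACA; exact: gD.
- by exists (c * b) => //; rewrite mulrCA -mulrBr; exact: gM.
Qed.

Lemma gen_cons_in a b s x : gen s (x - a * b) -> gen (a :: s) x.
Proof.
move=> h; have [g0 gD gM] := ideal_gen_ideal [set` a :: s].
rewrite -[x](subrK (a * b)); apply: gD.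
  by move: h; apply: ideal_gen_mono => y /= ys; rewrite inE ys orbT.
by rewrite mulrC; apply: gM; apply: ideal_gen_in; rewrite /= inE eqxx.
Qed.

(* [l] is a regular sequence modulo the ideal generated by [s]; properness of
   the ideal is not required. *)
Fixpoint reg s l : Prop :=
  if l is a :: l' then (forall c, gen s (a * c) -> gen s c) /\ reg (a :: s) l' else True.

Lemma reg_eq s s' l : s =i s' -> reg s l -> reg s' l.
Proof.
elim: l s s' => //= a l IH s s' e [h1 h2]; split; first by rewrite -(gen_eq e).
by apply: IH h2 => x; rewrite !inE e.
Qed.

Lemma reg_cat s l l' : reg s (l ++ l') <-> reg s l /\ reg (rev l ++ s) l'.
Proof.
elim: l s => [|a l IH] s /=; first by split=> [|[]].
rewrite rev_cons cat_rcons; split=> [[h1 /IH[h2 h3]]|[[h1 h2] h3]] //.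
by split=> //; apply/IH.
Qed.

(** [good] stands for the maximal ideal in the local case and for its homogeneous elements in the
    graded case; [nak] is the form of Nakayama's lemma that both cases share. *)
Variable good : set A.
Hypothesis goodM : forall x y, good x -> good y -> good (x * y).
Hypothesis nak : forall s a, (forall t, t \in s -> good t) -> good a ->
  forall L, ideal L -> (forall c, L c -> exists2 c', L c' & gen s (c - a * c')) ->
  L `<=` gen s.

Lemma reg_swap s a b l : (forall t, t \in s -> good t) -> good a -> good b ->
  reg s [:: a, b & l] -> reg s [:: b, a & l].
Proof.
move=> gs ga gb /= [ha [hb hl]]; have idg := ideal_gen_ideal [set` s].
have [g0 gD gM] := idg.
have hb' c : gen s (b * c) -> gen s c.
  have idL : ideal [set c | gen s (b * c)].
    split=> [|x y|q x] /=; first by rewrite mulr0.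
      by rewrite mulrDr; exact: gD.
    by rewrite mulrCA; exact: gM.
  (* If [b * c] lies in [gen s], then [c] is some [a * c'] modulo [gen s] by regularity of [b], and
     [b * c'] lies in [gen s] by regularity of [a]. *)
  apply: (nak gs ga idL) => {}c hc.
  have [|c' hc'] := gen_cons (hb c _).
    apply: (gen_cons_in (b := 0)); by rewrite mulr0 subr0.
  exists c' => //=; apply: ha.
  have -> : a * (b * c') = b * c - b * (c - a * c') by ring.
  by apply: (idealB idg) => //; exact: gM.
split=> //; split; last first.
  by apply: reg_eq hl => x; rewrite !inE orbCA.
move=> c /gen_cons[c' h].
have [|c'' h'] := gen_cons (hb c' _).
  apply: (gen_cons_in (b := c)); by rewrite -opprB; exact: (idealN idg h).
apply: (gen_cons_in (b := c'')); apply: ha.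
have -> : a * (c - b * c'') = (a * c - b * c') + b * (c' - a * c'') by ring.
by apply: gD => //; exact: gM.
Qed.

Lemma reg_move s a l l' : (forall t, t \in s -> good t) ->
  (forall t, t \in l ++ a :: l' -> good t) ->
  reg s (l ++ a :: l') -> reg s (a :: l ++ l').
Proof.
elim: l s => // b l IH s gs gl /= [hb hl]; apply: reg_swap => //.
- by apply: gl; rewrite inE eqxx.
- by apply: gl; rewrite !(inE, mem_cat) eqxx !orbT.
split=> //; apply: IH => // t; rewrite ?inE.
  by case/orP => [/eqP ->|/gs //]; apply: gl; rewrite inE eqxx.
by move=> ht; apply: gl; rewrite inE ht orbT.
Qed.

Lemma reg_perm s l l' : (forall t, t \in s -> good t) -> (forall t, t \in l -> good t) ->
  perm_eq l l' -> reg s l -> reg s l'.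
Proof.
elim: l' l s => [|a l' IH] l s gs gl p hl //.
have al : a \in l by rewrite (perm_mem p) inE eqxx.
case/path.splitPr: al p gl hl => l1 l2 p gl hl; have /= [ha hl'] := reg_move gs gl hl.
have p' : perm_eq (l1 ++ l2) l'.
  rewrite -(perm_cons a); apply: perm_trans p.
  by rewrite perm_sym; apply/permPl; exact: (perm_catCA l1 [:: a] l2).
split=> //; apply: IH p' hl' => t.
  by rewrite inE => /orP[/eqP ->|/gs //]; apply: gl; rewrite mem_cat inE eqxx orbT.
by move=> ht; apply: gl; move: ht; rewrite !(mem_cat, inE) => /orP[] ->; rewrite ?orbT.
Qed.

Lemma reg_subseq s l l' : (forall t, t \in s -> good t) -> (forall t, t \in l -> good t) ->
  (exists l'', perm_eq l (l' ++ l'')) -> reg s l -> reg s l'.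
Proof. by move=> gs gl [l'' p] /(reg_perm gs gl p)/reg_cat[]. Qed.

(** At the end of a sequence the claim is that a product of two nonzerodivisors is one; permutation
    moves the factors there and back. *)
Lemma reg_mul s a b l : (forall t, t \in s -> good t) -> (forall t, t \in l -> good t) ->
  good a -> good b -> reg s (a :: l) -> reg s (b :: l) -> reg s (a * b :: l).
Proof.
move=> gs gl ga gb ra rb.
have gc c : good c -> forall t, t \in c :: l -> good t.
  by move=> gc t; rewrite inE => /orP[/eqP ->|/gl].
have last c : good c -> reg s (c :: l) <-> reg s (l ++ [:: c]).
  move=> hc; split; apply: reg_perm => //; first exact: gc.
  - by rewrite -cat1s perm_catC.
  - by move=> t; rewrite mem_cat inE orbC => ht; apply: (gc c hc); rewrite inE.
  - by rewrite -[c :: l]cat1s perm_catC.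
have gab := goodM ga gb; apply/(last _ gab)/reg_cat.
have /reg_cat[rl /= [ha _]] := (last _ ga).1 ra; have /reg_cat[_ /= [hb _]] := (last _ gb).1 rb.
by split=> //=; split=> // c; rewrite -mulrA => /ha/hb.
Qed.

(** The chain is extended downwards by a prime inside its lowest member that does not contain [a];
    it exists because [a] is a nonzerodivisor modulo [gen s]. *)
Lemma reg_chain (p : set A) s l : prime_ideal p -> gen (l ++ s) `<=` p -> reg s l ->
  has_chain [set q | [/\ prime_ideal q, q `<=` p & gen s `<=` q]] (size l).
Proof.
move=> pp; elim: l s => [|a l IH] s lp /=.
  by exists (fun=> p); split=> // i _; split.
move=> [ha hl]; have [|q [qX qs]] := IH (a :: s) _ hl.
  move=> x hx; apply: lp; rewrite (@gen_eq _ (l ++ a :: s)) // => y.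
  by rewrite !(mem_cat, inE) -orbA orbCA.
have [pq0 q0p gq0] := qX 0%N (leq0n _).
(* A prime that avoids [W] lies inside [q 0] and does not contain [a]. *)
pose W : set A := [set x | exists i t, ~ q 0%N t /\ x = a ^+ i * t].
have [idq0 q01 q0M] := pq0.
have sub : gen s `<=` q 0%N.
  by move=> x hx; apply: gq0; apply: (gen_cons_in (b := 0)); rewrite mulr0 subr0.
have [||x hx [i [t [nt e]]]|q' [pq' sq' q'W]] := @exists_prime_avoiding _ (gen s) W (ideal_gen_ideal _).
- by exists 0%N, 1; rewrite mulr1.
- move=> _ _ [i [t [nt ->]]] [i' [t' [nt' ->]]]; exists (i + i')%N, (t * t').
  by rewrite exprD mulrACA; split=> // /q0M[].
- apply: nt; apply: sub; elim: i x e hx => [|i IHi] x e; first by rewrite e mul1r.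
  by rewrite e exprS -mulrA => /ha; exact: IHi.
exists (fun i => if i is j.+1 then q j else q'); split=> -[|i] hi.
- split=> // x hx; apply: q0p; apply: contrapT => nx; apply: (q'W x hx).
  by exists 0%N, x; rewrite mul1r.
- have [h1 h2 h3] := qX i hi; split=> // x hx; apply: h3.
  by apply: (gen_cons_in (b := 0)); rewrite mulr0 subr0.
- split=> [x hx|e].
    apply: contrapT => nx; apply: (q'W x hx).
    by exists 0%N, x; rewrite mul1r.
  have : q' a by apply: e; apply: gq0; apply: ideal_gen_in; rewrite /= inE eqxx.
  by move=> /q'W; apply; exists 1%N, 1; rewrite mulr1.
- exact: qs.
Qed.

End IdealGen.

(** * Heights and monomial ideals *)

Section ChainDim.
Variable A : comNzRingType.
Implicit Type X : set (set A).

(** [supremum] is a choice among suprema, so one has to be exhibited: +oo if the lengths are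
    unbounded, the maximal length otherwise. *)
Lemma le_chain_dim X l : has_chain X l -> (l%:Z%:E <= chain_dim X)%E.
Proof.
move=> hl; rewrite /chain_dim; set E := [set _ | _ in _].
have El : E l%:Z%:E by exists l.
suff [s [sub ssup]] : supremums E !=set0.
  by apply: ge_supremum_Nmem => //; exists s.
have [h|/existsNP[b hb]] := pselect (forall b, exists2 l', (b <= l')%N & has_chain X l').
  exists +oo%E; split=> [y _|y hy]; first by rewrite leey.
  case: y hy => [r||] hy //.
    have [l' lr hl'] := h `|r|.+1%N; have : (l'%:Z%:E <= r%:E)%E by apply: hy; exists l'.
    by rewrite lee_fin; lia.
  by have := hy _ El.
have ex : exists l', `[< has_chain X l' >] by exists l; exact/asboolP.
have bd l' : `[< has_chain X l' >] -> (l' <= b)%N.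
  by move=> /asboolP hl'; rewrite leqNgt; apply/negP => lt; apply: hb; exists l' => //; exact: ltnW.
exists (ex_maxn ex bd)%:Z%:E; case: ex_maxnP => N /asboolP hN Nmax; split.
  by move=> _ [l' hl' <-]; rewrite lee_fin lez_nat; apply: Nmax; exact/asboolP.
by move=> y hy; apply: hy; exists N.
Qed.

Lemma le_height (I : set A) h : (forall p, prime_ideal p -> I `<=` p ->
    has_chain [set q | prime_ideal q /\ q `<=` p] h) -> (h%:Z%:E <= height I)%E.
Proof.
(* An empty set of primes and a missing infimum both lead to the default +oo. *)
move=> hp; rewrite /height /infimum; case: eqVneq => [_|_]; first by rewrite leey.
case: xgetP => [y -> [_ glb]|_]; last by rewrite leey.
by apply: glb => _ [p [pp Ip] <-]; apply: le_chain_dim; exact: hp.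
Qed.

End ChainDim.

Section Monomials.
Variables (A : comNzRingType) (good : set A).
Hypothesis goodM : forall x y, good x -> good y -> good (x * y).
Hypothesis nak : forall s a, (forall t, t \in s -> good t) -> good a ->
  forall L, ideal L -> (forall c, L c -> exists2 c', L c' & gen s (c - a * c')) ->
  L `<=` gen s.

Lemma regP (s l : seq A) : reg s l <->
  forall k, (k < size l)%N -> forall c, gen (take k l ++ s) (l`_k * c) -> gen (take k l ++ s) c.
Proof.
have cc b k s' l' : gen (take k.+1 (b :: l') ++ s') = gen (take k l' ++ b :: s').
  by apply: gen_eq => y; rewrite /= !(mem_cat, inE) orbCA.
elim: l s => [|b l IH] s //=; split=> [[h1 /IH h2] [|k] hk c|h].
- by rewrite take0; exact: h1.
- by rewrite cc; exact: h2.
split=> [c|]; first by have := h 0%N isT c; rewrite take0.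
by apply/IH => k hk c; have := h k.+1 hk c; rewrite cc.
Qed.

Lemma gen_take_codom (d : nat) (x : 'I_d -> A) (k : nat) :
  gen (take k (codom x) ++ [::]) = ideal_gen (x @` [set j : 'I_d | (j < k)%N]).
Proof.
rewrite cats0 codomE -map_take; congr ideal_gen.
have tE (j : 'I_d) : (j \in take k (enum 'I_d)) = (j < k)%N.
  rewrite -(mem_map val_inj) map_take val_enum_ord take_iota mem_iota /= add0n.
  by have := ltn_ord j; lia.
apply/seteqP; split=> [_ /= /mapP[j hj ->]|_ [j /= hj <-]].
  by exists j => //=; rewrite -tE.
by apply/mapP; exists j => //; rewrite tE.
Qed.

Lemma regular_sequenceP (d : nat) (x : 'I_d -> A) :
  regular_sequence x <-> reg [::] (codom x) /\ ~ ideal_gen (range x) 1.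
Proof.
have sz : size (codom x) = d by rewrite size_codom card_ord.
have nt (i : 'I_d) : (codom x)`_i = x i.
  by rewrite codomE (nth_map i) ?size_enum_ord // nth_ord_enum.
split=> -[h1 h2]; split=> //.
  apply/regP => k; rewrite sz => hk c; rewrite gen_take_codom.
  by rewrite -[k]/(val (Ordinal hk)) nt; exact: h1.
move=> i c; rewrite -(gen_take_codom x i) -nt.
by move/regP: h1; apply; rewrite sz.
Qed.

Variables (d n : nat) (x : 'I_d -> A) (a : 'I_n -> 'I_d -> nat).
Hypotheses (x_good : forall j, good (x j)) (x_reg : regular_sequence x).

Let g (i : 'I_n) : A := \prod_j x j ^+ a i j.
Let I : set A := ideal_gen (range g).
Hypothesis I1 : ~ I 1.

Let codom_good t : t \in codom x -> good t. Proof. by case/codomP => j ->. Qed.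

Let support i : exists j, (0 < a i j)%N.
Proof.
apply: contrapT => /forallNP h; apply: I1; apply: ideal_gen_in; exists i => //.
by rewrite /g big1 // => j _; have /negP := h j; rewrite -eqn0Ngt => /eqP ->.
Qed.

Definition covers (C : {set 'I_d}) := [forall i, [exists j in C, (0 < a i j)%N]].

Let xs (C : {set 'I_d}) : seq A := [seq x j | j <- enum 'I_d & j \in C].

Let size_xs C : size (xs C) = #|C|.
Proof. by rewrite size_map cardE; congr size; rewrite enumT. Qed.

Let regx : reg [::] (codom x). Proof. by case/regular_sequenceP: x_reg. Qed.

Let xs_reg C : reg [::] (xs C).
Proof.
apply: (reg_subseq nak _ codom_good _ regx) => //.
exists [seq x j | j <- enum 'I_d & j \notin C]; rewrite -map_cat codomE.
by rewrite perm_map // perm_sym; apply/permPl; exact: perm_filterC.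
Qed.

Lemma covers_gen C : covers C -> I `<=` gen (xs C).
Proof.
move=> cC; have [_ _ gM] := ideal_gen_ideal [set` xs C].
apply: ideal_gen_min => [|_ [i _ <-]]; first exact: ideal_gen_ideal.
have /existsP[j /andP[jC aj]] := forallP cC i.
rewrite /g (bigD1 j) //= -(prednK aj) exprSr -mulrA mulrCA mulrC; apply: gM.
by apply: ideal_gen_in => /=; apply: map_f; rewrite mem_filter jC mem_enum.
Qed.

Lemma prime_covers p : prime_ideal p -> I `<=` p ->
  exists2 C, covers C & has_chain [set q | prime_ideal q /\ q `<=` p] #|C|.
Proof.
move=> pp Ip; pose C : {set 'I_d} := finset (fun j => `[< p (x j) >]).
have [idp p1 pM] := pp; exists C.
  apply/forallP => i; have : p (g i) by apply: Ip; apply: ideal_gen_in; exists i.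
  move=> pg; suff : exists2 j, p (x j) & (0 < a i j)%N.
    by move=> [j pj aj]; apply/existsP; exists j; rewrite inE aj andbT; exact/asboolP.
  apply: contrapT => hn; apply: (p1).
  have : forall z, p (z * g i) -> p z; last by apply; rewrite mul1r.
  rewrite /g; apply: (big_ind (fun y => forall z, p (z * y) -> p z)) => [z|y y' h h' z|j _ z].
  - by rewrite mulr1.
  - by rewrite mulrA => /h'/h.
  have [->|aj] := posnP (a i j); first by rewrite mulr1.
  move=> /pM[//|/(prime_exp pp) pj]; exfalso; apply: hn; by exists j.
have := reg_chain pp _ (xs_reg C); rewrite size_xs => h.
have [|q [qX qs]] := h.
  rewrite cats0; apply: ideal_gen_min => // _ /mapP[j + ->].
  by rewrite mem_filter inE => /andP[/asboolP].
by exists q; split=> // i hi; have [] := qX i hi.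
Qed.

(** [P] need not contain 1, so the empty product is kept apart. *)
Let prod_or1 (P : set A) (e : 'I_d -> nat) : (forall y z, P y -> P z -> P (y * z)) ->
  (forall j, (0 < e j)%N -> P (x j)) ->
  \prod_j x j ^+ e j = 1 \/ P (\prod_j x j ^+ e j).
Proof.
move=> PM hx; have KM y z : y = 1 \/ P y -> z = 1 \/ P z -> y * z = 1 \/ P (y * z).
  move=> [->|hy] [->|hz]; rewrite ?mul1r ?mulr1; [by left|by right|by right|].
  by right; exact: PM.
apply: (big_ind (fun z => z = 1 \/ P z)) => [|y z|j _]; [by left|exact: KM|].
have [->|ej] := posnP (e j); first by left.
elim: (e j) => [|m IH]; first by left.
by rewrite exprS; apply: KM => //; right; exact: hx.
Qed.

Let g_neq1 i : g i <> 1.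
Proof. by move=> e; apply: I1; apply: ideal_gen_in; exists i. Qed.

Let g_good i : good (g i).
Proof. by have [/(@g_neq1 i)|//] := prod_or1 (P := good) (e := a i) goodM (fun j _ => x_good j). Qed.

(** In a sequence with one variable per monomial, the variables are replaced by the monomials one at
    a time. The choice [c] stays arbitrary during the induction, because every variable of the next
    monomial has to fit in its place. *)
Lemma disjoint_monomials_reg : (forall i i' j, (0 < a i j)%N -> (0 < a i' j)%N -> i = i') ->
  reg [::] (codom g).
Proof.
move=> dis; pose y m (c : 'I_n -> 'I_d) (i : 'I_n) := if (i < m)%N then g i else x (c i).
have y_good m c i : good (y m c i) by rewrite /y; case: ifP.
have my_good m c (s : seq 'I_n) t : t \in map (y m c) s -> good t by case/mapP => i _ ->.
have /choice[c0 c0P] := support.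
suff h m c : (m <= n)%N -> (forall i, (0 < a i (c i))%N) -> reg [::] (map (y m c) (enum 'I_n)).
  have := h n c0 (leqnn n) c0P; rewrite codomE (eq_map (g := g)) // => i.
  by rewrite /y ltn_ord.
elim: m c => [|m IH] c hm cP.
  have -> : map (y 0%N c) (enum 'I_n) = map x (codom c) by rewrite codomE -map_comp.
  apply: (reg_perm nak _ _ _ (xs_reg [set j in codom c])) => //.
    by move=> t /mapP[j _ ->].
  apply: perm_map; apply: uniq_perm.
  - by rewrite filter_uniq // enum_uniq.
  - by apply/injectiveP => i i' e; apply: (dis i i' (c i)) => //; rewrite e.
  - by move=> j; rewrite mem_filter mem_enum andbT inE.
pose i0 := Ordinal hm; pose R := rem i0 (enum 'I_n).
have pR : perm_eq (enum 'I_n) (i0 :: R) by apply: perm_to_rem; rewrite mem_enum.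
have nR i : i \in R -> i != i0.
  by rewrite /R mem_rem_uniq ?enum_uniq // inE => /andP[].
apply: (reg_perm nak (l := g i0 :: map (y m.+1 c) R)) => //.
- by move=> t; rewrite inE => /orP[/eqP ->|/my_good].
- by rewrite perm_sym (perm_trans (perm_map _ pR)) //= /y /= ltnSn.
have hj j : (0 < a i0 j)%N -> reg [::] (x j :: map (y m.+1 c) R).
  move=> aj; pose c' i := if i == i0 then j else c i.
  have c'P i : (0 < a i (c' i))%N by rewrite /c'; case: eqP => [->|].
  have -> : x j :: map (y m.+1 c) R = map (y m c') (i0 :: R).
    rewrite map_cons; congr (_ :: _); first by rewrite /y /= ltnn /c' eqxx.
    apply/eq_in_map => i /nR ne.
    rewrite /y /c' (negbTE ne) ltnS; have : (i : nat) != m by exact: ne.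
    by case: ltngtP.
  by apply: (reg_perm nak _ (my_good m c' _) _ (IH c' (ltnW hm) c'P)) => //; exact: perm_map.
have [|e|[//]] := prod_or1 (P := fun z => good z /\ reg [::] (z :: map (y m.+1 c) R))
  (e := a i0) _ (fun j aj => conj (x_good j) (hj j aj)).
  move=> u v [gu ru] [gv rv]; split; first exact: goodM.
  by apply: (reg_mul goodM nak) => //; exact: my_good.
by case: (g_neq1 e).
Qed.

Variables (B : comNzRingType) (X : set (set B)).
Hypothesis cover_chain : forall s : seq A, (forall t, t \in s -> good t) ->
  I `<=` gen s -> has_chain X (n - size s).

Let covers_chain C : covers C -> has_chain X (n - #|C|).
Proof.
move=> cC; rewrite -size_xs; apply: cover_chain; last exact: covers_gen.
by move=> t /mapP[j _ ->].
Qed.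

Lemma monomial_dim_bound : (n%:Z%:E - height I <= chain_dim X)%E.
Proof.
have cT : covers [set: 'I_d]%SET.
  by apply/forallP => i; have [j aj] := support i; apply/existsP; exists j; rewrite inE aj.
(* A cover of least size gives both lower bounds at once, for the height and for the support. *)
case: (arg_minnP (fun C : {set 'I_d} => #|C|) cT) => C cC Cmin.
have hI : (#|C|%:Z%:E <= height I)%E.
  apply: le_height => p pp Ip; have [C' /Cmin le ch] := prime_covers pp Ip.
  exact: has_chain_le le ch.
apply: le_trans (le_chain_dim (covers_chain cC)).
apply: (le_trans (leeB (lexx _) hI)); rewrite -EFinB lee_fin.
have sub_le (p q : nat) : p%:Z - q%:Z <= (p - q)%N%:Z. by lia.
exact: sub_le.
Qed.

Lemma monomial_dim_gt0 : ~ regular_sequence g -> (0 < chain_dim X)%E.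
Proof.
move=> ng; have /existsNP[i /existsNP[i' /existsNP[j]]] :
    ~ forall i i' j, (0 < a i j)%N -> (0 < a i' j)%N -> i = i'.
  by move=> /disjoint_monomials_reg rg; apply: ng; apply/regular_sequenceP.
move=> /not_implyP[aj /not_implyP[aj' /eqP ne]].
have /choice[c cP] := support.
(* The two monomials that share [j] both choose it, so [i] can be left out when the cover is
   counted. *)
pose c' l := if (l == i) || (l == i') then j else c l.
have c'P l : (0 < a l (c' l))%N by rewrite /c'; case: eqP => [->|] //=; case: eqP => [->|].
pose C := (c' @: ([set: 'I_n] :\ i))%SET.
have cC : covers C.
  apply/forallP => l; apply/existsP; exists (c' l); rewrite c'P andbT.
  have [->|nl] := eqVneq l i; last by apply: imset_f; rewrite !inE nl.
  apply/imsetP; exists i'; first by rewrite !inE eq_sym ne.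
  by rewrite /c' !eqxx orbT.
have Cn : (#|C| < n)%N.
  apply: leq_ltn_trans (leq_imset_card _ _) _.
  by rewrite cardsDS ?subsetT // cards1 cardsT card_ord subn1 prednK // (leq_ltn_trans _ (ltn_ord i)).
apply: lt_le_trans (le_chain_dim (covers_chain cC)).
by rewrite lte_fin ltz_nat subn_gt0.
Qed.

End Monomials.

(** * Graded polynomial rings *)

Section GradedPolynomials.
Variables (k : fieldType) (r : nat) (w : 'I_r -> nat).
Hypothesis w_gt0 : forall i, (0 < w i)%N.
Variable eps : {rmorphism {mpoly k[r]} -> k}.
Hypothesis epsE : forall q, eps q = q@_0%MM.

Local Notation A := {mpoly k[r]}.
Implicit Types (p q : A).

Let wt (mon : 'X_{1..r}) : nat := (\sum_(i < r) w i * mon i)%N.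

Let wtD m1 m2 : wt (m1 + m2) = (wt m1 + wt m2)%N.
Proof. by rewrite -big_split; apply: eq_bigr => i _; rewrite mnmDE mulnDr. Qed.

Let wgrading_monomial c mon : wgrading w (wt mon)%:Z (c *: 'X_[mon] : A).
Proof. by move=> mon' /msuppZ_le; rewrite msuppX inE => /eqP ->. Qed.

Lemma wgrading_span (P : set A) : P 0 -> (forall x y, P x -> P y -> P (x + y)) ->
  (forall a x, wgrading w a x -> P x) -> forall x, P x.
Proof.
move=> P0 PD PG; elim/mpolyind => // c mon p _ _ IH; apply: PD => //.
by apply: (PG (wt mon)%:Z); exact: wgrading_monomial.
Qed.

Lemma wgrading_ge0 a p : wgrading w a p -> p != 0 -> 0 <= a.
Proof.
move=> hp; rewrite -msupp_eq0; case E : (msupp p) => [//|mon s] _.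
by rewrite -(hp mon) // E inE eqxx.
Qed.

Lemma wgradingM a b p q : wgrading w a p -> wgrading w b q -> wgrading w (a + b) (p * q).
Proof.
move=> hp hq mon /msuppM_le/allpairsP[[m1 m2] /= [/hp <- /hq <- ->]].
by rewrite -PoszD -wtD.
Qed.

Lemma wgrading_X i : wgrading w (w i)%:Z ('X_i : A).
Proof.
have <- : wt U_(i) = w i.
  rewrite /wt (bigD1 i) //= mnm1E eqxx muln1 big1 ?addn0 // => j /negbTE ne.
  by rewrite mnm1E eq_sym ne muln0.
by rewrite -['X_i]scale1r; exact: wgrading_monomial.
Qed.

Lemma weigh_wgrading a p : wgrading w a p -> weigh k w p = p%:P * 'X^`|a|%N.
Proof.
move=> hp; rewrite {1 2}(mpolyE p) !rmorph_sum mulr_suml big_seq [RHS]big_seq.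
apply: eq_bigr => mon /hp ea; rewrite /= weighZ weigh_monomial -ea absz_nat.
by rewrite mulrA -polyCM mul_mpolyC.
Qed.

Lemma augmentation_gen q : eps q = 0 -> exists c : 'I_r -> A, q = \sum_i c i * 'X_i.
Proof.
suff [c e] : exists c : 'I_r -> A, q = (q@_0)%:MP + \sum_i c i * 'X_i.
  by rewrite epsE => q0; exists c; rewrite {1}e q0 mpolyC0 add0r.
elim/mpolyind: q => [|c mon p _ _ [b IH]].
  by exists (fun=> 0); rewrite mcoeff0 mpolyC0 big1 ?addr0 // => i _; rewrite mul0r.
rewrite mcoeffD mcoeffZ mcoeffX.
have [->|ne] := eqVneq mon 0%MM.
  exists b; rewrite mulr1 mpolyX0 mpolyCD -addrA -IH; congr (_ + _).
  by rewrite -mul_mpolyC mulr1.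
have [i hi] : exists i, (0 < mon i)%N.
  apply: contrapT => /forallNP h; case/eqP: ne; apply/mnmP => i; rewrite mnm0E.
  by have /negP := h i; rewrite -eqn0Ngt => /eqP.
have sE : \sum_j (if j == i then c *: 'X_[mon - U_(i)] else 0) * 'X_j = c *: 'X_[mon] :> A.
  rewrite (bigD1 i) //= eqxx big1 ?addr0 => [|j /negbTE ->]; last by rewrite mul0r.
  rewrite -scalerAl -mpolyXD submK //; apply/mnm_lepP => j; rewrite mnm1E.
  by case: eqVneq => [<-|].
exists (fun j => b j + (if j == i then c *: 'X_[mon - U_(i)] else 0)).
under eq_bigr do rewrite mulrDl.
by rewrite big_split /= sE mulr0 add0r {1}IH [LHS]addrC -addrA.
Qed.

Definition graded_good : set A := [set z | homogeneous (wgrading w) z /\ eps z = 0].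

Lemma graded_goodM x y : graded_good x -> graded_good y -> graded_good (x * y).
Proof.
move=> [[a xa] x0] [[b yb] _]; split; last by rewrite rmorphM x0 mul0r.
by exists (a + b); exact: wgradingM.
Qed.

Let gen_coef s j t : (forall x, x \in s -> homogeneous (wgrading w) x) ->
  gen s j -> gen s (weigh k w j)`_t.
Proof.
move=> sh /gen_combination[c ->]; have idg := ideal_gen_ideal [set` s].
rewrite rmorph_sum coef_sum; apply: ideal_sum => // i _.
have [b /weigh_wgrading e] := sh _ (mem_nth 0 (ltn_ord i)).
rewrite (rmorphM (weigh k w)) e mulrA coefMXn; have [g0 _ gM] := idg; case: ifP => _ //.
by rewrite coefMC; apply: gM; apply: ideal_gen_in => /=; exact: mem_nth.
Qed.

(** Iteration puts [c] into the multiples of [a ^+ N] modulo [gen s]. A nonzero [a] has positive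
    weight, so for large [N] the weight components of [c] are those of a member of [gen s], which
    has homogeneous generators. *)
Lemma graded_nakayama_ideal s a : (forall t, t \in s -> graded_good t) -> graded_good a ->
  forall L : set A, ideal L -> (forall c, L c -> exists2 c', L c' & gen s (c - a * c')) ->
  L `<=` gen s.
Proof.
move=> gs [[b ab] a0] L _ hL c Lc; have idg := ideal_gen_ideal [set` s].
have [g0 gD gM] := idg.
have iter_c N : exists2 c', L c' & gen s (c - a ^+ N * c').
  elim: N => [|N [c' Lc' h]]; first by exists c => //; rewrite mul1r subrr.
  have [c'' Lc'' h'] := hL c' Lc'; exists c'' => //.
  have -> : c - a ^+ N.+1 * c'' = (c - a ^+ N * c') + a ^+ N * (c' - a * c'').
    by rewrite exprSr; ring.
  by apply: gD => //; exact: gM.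
have [a00|an0] := eqVneq a 0.
  by have [c' _] := iter_c 1%N; rewrite expr1 a00 mul0r subr0.
have b_gt0 : (0 < `|b|)%N.
  case E : (msupp a) => [|mon u]; first by move/eqP: E; rewrite msupp_eq0 (negbTE an0).
  have ms : mon \in msupp a by rewrite E inE eqxx.
  rewrite -(ab mon ms) absz_nat lt0n; apply: contraL ms => /eqP s0.
  suff -> : mon = 0%MM by rewrite mcoeff_msupp -epsE a0 eqxx.
  apply/mnmP => i; rewrite mnm0E; apply/eqP; rewrite -leqn0.
  have : (w i * mon i <= 0)%N by rewrite -s0 (bigD1 i) //= leq_addr.
  by rewrite leqn0 muln_eq0 (gtn_eqF (w_gt0 i)) /= => /eqP ->.
have [c' _ h] := iter_c (size (weigh k w c)); rewrite -[c](weigh_at1 w) horner_coef.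
apply: ideal_sum => // i _; rewrite expr1n mulr1.
have := gen_coef i (fun x hx => (gs x hx).1) h.
rewrite rmorphB coefB rmorphM rmorphXn (weigh_wgrading ab) exprMn -exprM mulrAC coefMXn.
have -> : (i < `|b| * size (weigh k w c))%N by apply: leq_trans (ltn_ord i) (leq_pmull _ b_gt0).
by rewrite subr0.
Qed.

Section DGModules.
Variables (n : nat) (f : 'I_n -> A).
Hypothesis f_hom : forall i, homogeneous (wgrading w) (f i).

Let z (m : nat) : A := if insub m is Some i then 'X_(i : 'I_r) else 0.

(** Induction on the internal degree of the components of a cycle: it is bounded below on [F], and
    multiplication by a variable strictly raises it. *)
Lemma graded_nakayama (F : dgmod (wgrading w) f) : finite_free F -> nakayama_for r z F.
Proof.
move=> /(finite_free_basis wgrading_span)[u [b [dg [ad [coord [cP cE ce bG cG]]]]]].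
move=> i hZ v hv dv; pose comp t := component (cx_direct F) t.
have compD t : {morph comp t : x y / x + y} := componentD (cx_direct F) t.
have comp0 t : comp t 0 = 0 := component0 (cx_direct F) t.
have comp_in t x : cx_gr F t.1 t.2 (comp t x) := component_in (cx_direct F) t x.
pose a0 : int := - \sum_j `|ad j|.
have low a x : a < a0 -> comp (i, a) x = 0.
  move=> ha; rewrite (cE x) (big_morph _ (compD _) (comp0 _)) big1 // => j _.
  move: (coord x j); apply: wgrading_span => [|p q hp hq|e q hq].
  - by rewrite scale0r.
  - by rewrite scalerDl compD hp hq addr0.
  have [->|q0] := eqVneq q 0; first by rewrite scale0r.
  have e0 := wgrading_ge0 hq q0.
  apply: (@component_other _ _ _ (cx_direct F) (dg j, e + ad j)).
    exact: cx_scale hq (bG j).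
  apply/eqP => -[_ ea]; have : `|ad j| <= \sum_j `|ad j| by rewrite (bigD1 j) //= lerDl sumr_ge0.
  by rewrite /a0 in ha; lia.
pose B : set F := [set x | exists2 y, hdeg F (i + 1) y & x = cx_d F y].
have B0 : B 0 by exists 0; [exact: hdeg0|rewrite linear0].
have BD x y : B x -> B y -> B (x + y).
  by move=> [x' hx ->] [y' hy ->]; exists (x' + y'); [exact: hdegD|rewrite linearD].
have BZ q x : B x -> B (q *: x).
  by move=> [x' hx ->]; exists (q *: x'); [exact: (hdegZ wgrading_span)|rewrite linearZ].
have comp_d t x : comp t (cx_d F x) = cx_d F (comp (t.1 + 1, t.2) x).
  have := @component_morph _ _ _ _ _ _ (cx_direct F) (cx_direct F) (cx_d F)
    (fun t : int * int => (t.1 - 1, t.2)) (linear0 _) (linearD _) _ _ (t.1 + 1, t.2) x.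
  rewrite /= addrK -surjective_pairing; apply; last by move=> t' y; exact: cx_d_deg.
  by move=> [s1 s2] [t1 t2] /= [/addIr -> ->].
have comp_X l t x : comp t ('X_l *: x) = 'X_l *: comp (t.1, t.2 - (w l)%:Z) x.
  have := @component_morph _ _ _ _ _ _ (cx_direct F) (cx_direct F) (fun x => 'X_l *: x)
    (fun t : int * int => (t.1, (w l)%:Z + t.2)) (scaler0 _ _) (scalerDr _) _ _
    (t.1, t.2 - (w l)%:Z) x.
  rewrite /= addrC subrK -surjective_pairing; apply.
    by move=> [s1 s2] [t1 t2] /= [-> /addrI ->].
  by move=> t' y; apply: cx_scale; exact: wgrading_X.
have cycB N a x : a < a0 + N%:Z -> hdeg F i x -> cx_d F x = 0 -> B (comp (i, a) x).
  elim: N a x => [|N IH] a x ha hx dx; first by rewrite low // -[a0]addr0.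
  have [y [c [hy hc dc ->]]] := hZ x hx dx.
  rewrite compD comp_d; apply: (BD).
    by exists (comp (i + 1, a) y) => //; exact: (hdeg_in (comp_in (i + 1, a) y)).
  rewrite (big_morph _ (compD _) (comp0 _)); apply: big_ind => // l _.
  rewrite /z valK comp_X; apply: BZ; apply: IH => //=.
  by have := w_gt0 l; lia.
have [s _ ->] := component_sum (cx_direct F) v.
apply: (big_ind B) => // -[i' a] _; have [->|ne] := eqVneq i' i.
  by apply: (cycB `|(a - a0 + 1)%R|%N) => //; lia.
suff -> : component (cx_direct F) (i', a) v = 0 by [].
move: v hv {dv}; apply: (hdeg_ind (P := fun v => comp (i', a) v = 0)) => // [x y hx hy|a' x hx].
  by rewrite compD hx hy addr0.
apply: (@component_other _ _ _ (cx_direct F) (i, a')) => //.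
by apply: contra ne => /eqP[->].
Qed.

End DGModules.
End GradedPolynomials.

(** * Noetherian local rings *)

Section Submodules.
Variables (Q : comNzRingType) (V : lmodType Q).

Lemma submodule_sum P (T : Type) (r : seq T) (F : T -> V) : submodule P ->
  (forall t, P (F t)) -> P (\sum_(t <- r) F t).
Proof. by case=> P0 PD _ h; apply: big_ind. Qed.

Definition spans (s : seq V) (Z : set V) : Prop :=
  (forall x, x \in s -> Z x) /\
  forall x, Z x -> forall P, submodule P -> (forall y, y \in s -> P y) -> P x.

Lemma spans_combination s Z x : spans s Z -> Z x ->
  exists c : 'I_(size s) -> Q, x = \sum_i c i *: s`_i.
Proof.
move=> [_ sZ] Zx.
apply: (sZ x Zx [set x | exists c : 'I_(size s) -> Q, x = \sum_i c i *: s`_i]) => [|y ys].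
  split=> [|y z [c ->] [c' ->]|q y [c ->]].
  - by exists (fun=> 0); rewrite big1 // => i _; rewrite scale0r.
  - by exists (fun i => c i + c' i); rewrite -big_split; apply: eq_bigr => i _; rewrite scalerDl.
  - by exists (fun i => q * c i); rewrite scaler_sumr; apply: eq_bigr => i _; rewrite scalerA.
have lt : (index y s < size s)%N by rewrite index_mem.
exists (fun j => (j == Ordinal lt)%:R).
rewrite (bigD1 (Ordinal lt)) //= eqxx scale1r nth_index // big1 ?addr0 // => j /negbTE ->.
by rewrite scale0r.
Qed.

Hypothesis noethQ : noetherian Q.

(** Induction on the number of coordinates that may be nonzero: generators of the ideal of values of
    the last one are lifted, and its kernel falls under the induction hypothesis. *)
Lemma noetherian_submodule (r : nat) (phi : nat -> V -> Q) (Z : set V) :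
  (forall j q x y, phi j (q *: x + y) = q * phi j x + phi j y) ->
  (forall x, (forall j, (j < r)%N -> phi j x = 0) -> x = 0) ->
  submodule Z -> exists s, spans s Z.
Proof.
move=> phiP phi_inj mZ.
have phi0 j : phi j 0 = 0.
  by have := phiP j (-1) 0 0; rewrite scaler0 addr0 mulN1r addNr.
have phiD j x y : phi j (x + y) = phi j x + phi j y.
  by have := phiP j 1 x y; rewrite scale1r mul1r.
have phiZ j q x : phi j (q *: x) = q * phi j x.
  by rewrite -[q *: x]addr0 phiP phi0 addr0.
suff h u : (u <= r)%N -> forall Z, submodule Z ->
    (forall x, Z x -> forall j, (u <= j < r)%N -> phi j x = 0) -> exists s, spans s Z.
  by apply: (h r) => // x _ j /andP[h1 h2]; have := leq_trans h2 h1; rewrite ltnn.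
elim: u => [|u IH] hu {mZ}Z mZ Zv; have [Z0 ZD ZZ] := mZ.
  exists [::]; split=> // x /Zv hx P [P0 _ _] _.
  by have -> : x = 0 by apply: phi_inj => j hj; exact: hx.
pose Z' : set V := [set x | Z x /\ phi u x = 0].
have mZ' : submodule Z'.
  split=> [|x y [hx x0] [hy y0]|q x [hx x0]]; first by [].
    by split; [exact: ZD|rewrite phiD x0 y0 addr0].
  by split; [exact: ZZ|rewrite phiZ x0 mulr0].
have [|s' [s'Z s'P]] := IH (ltnW hu) Z' mZ'.
  move=> x [Zx x0] j /andP[]; rewrite leq_eqVlt => /orP[/eqP <- //|uj jr].
  by apply: Zv => //; rewrite uj.
pose J : set Q := [set a | exists2 x, Z x & phi u x = a].
have [t tJ] : exists t : seq Q, J = ideal_gen [set` t].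
  apply: noethQ; split=> [|_ _ [x hx <-] [y hy <-]|a _ [x hx <-]]; first by exists 0.
    by exists (x + y); [exact: ZD|rewrite phiD].
  by exists (a *: x); [exact: ZZ|rewrite phiZ].
have /choice[xt xtP] : forall a, exists x, a \in t -> Z x /\ phi u x = a.
  move=> a; have [at_|_] := boolP (a \in t); last by exists 0.
  have [x hx <-] : J a by rewrite tJ; exact: ideal_gen_in.
  by exists x.
exists (s' ++ map xt t); split=> [x|x Zx P mP Pg].
  by rewrite mem_cat => /orP[/s'Z[]//|/mapP[a /xtP[ha _] ->]].
have [_ PD PZ] := mP.
have [y [Zy Py ey]] : exists y, [/\ Z y, P y & phi u y = phi u x].
  have : J (phi u x) by exists x.
  rewrite tJ => h; apply: (h [set a | exists y, [/\ Z y, P y & phi u y = a]]) => [|a at_].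
    split=> [|_ _ [y [hy py <-]] [z [hz pz <-]]|a _ [y [hy py <-]]].
    - by exists 0; split=> //; case: mP.
    - by exists (y + z); split; [exact: ZD|exact: PD|rewrite phiD].
    - by exists (a *: y); split; [exact: ZZ|exact: PZ|rewrite phiZ].
  have [hx ex] := xtP a at_; exists (xt a); split=> //.
  by apply: Pg; rewrite mem_cat map_f ?orbT.
rewrite -[x](subrK y); apply: PD => //; apply: s'P => [|//|z zs'].
  split; first by apply: ZD => //; rewrite -scaleN1r; exact: ZZ.
  by rewrite phiD -scaleN1r phiZ ey mulN1r subrr.
by apply: Pg; rewrite mem_cat zs'.
Qed.

End Submodules.

Section LocalRings.
Variables (Q : comNzRingType) (m : set Q).
Hypotheses (noethQ : noetherian Q) (locQ : local_ring m).
Variables (k : fieldType) (eps : {rmorphism Q -> k}).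
Hypothesis epsm : quotient_map m eps.

Lemma local_unit q : eps q = 1 -> exists q', q' * q = 1.
Proof.
move=> q1; apply: contrapT => /forallNP h.
pose L : set Q := [set x | exists c, x = c * q].
have idL : ideal L.
  split=> [|_ _ [c ->] [c' ->]|a _ [c ->]]; first by exists 0; rewrite mul0r.
    by exists (c + c'); rewrite mulrDl.
  by exists (a * c); rewrite mulrA.
have [|M [idM LM M1 Mmax]] := @exists_maximal_avoiding _ L [set 1] idL.
  by move=> x [c ->] /= e; exact: h c e.
have maxM : maximal_ideal M.
  split=> // [/M1|J idJ J1 MJ]; first exact.
  by apply/seteqP; split=> //; apply: Mmax => // x Jx /= x1; apply: J1; rewrite -x1.
have /(epsm.2 q) : m q.
  by rewrite -(locQ.2 M maxM); apply: LM; exists 1; rewrite mul1r.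
by rewrite q1 => /eqP; rewrite oner_eq0.
Qed.

Lemma local_nakayama_ideal s a : eps a = 0 ->
  forall L : set Q, ideal L -> (forall c, L c -> exists2 c', L c' & gen s (c - a * c')) ->
  L `<=` gen s.
Proof.
move=> a0 L idL hL; have [t tL] := noethQ idL; have idg := ideal_gen_ideal [set` s].
rewrite tL; apply: ideal_gen_min => // x /= xt.
have tn (i : 'I_(size t)) : L t`_i by rewrite tL; apply: ideal_gen_in; exact: mem_nth.
have /choice[c cE] (i : 'I_(size t)) : exists c : nat -> Q,
    gen s (t`_i - a * \sum_(j < size t) c j * t`_j).
  have [c' Lc' h] := hL _ (tn i); have [|c e] := @gen_combination _ t c'; first by rewrite /gen -tL.
  by exists c; rewrite -e.
have lt : (index x t < size t)%N by rewrite index_mem.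
rewrite -(nth_index 0 xt) -[index x t]/(val (Ordinal lt)).
have [g0 gD gM] := idg.
apply: (nakayama local_unit (V := Q^o) g0 gD gM (t := fun i : 'I_(size t) => t`_i)
  (c := fun i j => a * c i j)) => [i j|i]; first by rewrite rmorphM a0 mul0r.
have := cE i; congr (gen s (_ - _)); rewrite mulr_sumr; apply: eq_bigr => j _.
by rewrite mulrA.
Qed.

Section DGModules.
Variables (n : nat) (f : 'I_n -> Q) (e : nat) (z : nat -> Q).
Hypothesis z_eps : forall j, eps (z j) = 0.

Lemma ungraded_span (P : set Q) : P 0 -> (forall x y, P x -> P y -> P (x + y)) ->
  (forall a x, @ungraded Q a x -> P x) -> forall x, P x.
Proof. by move=> _ _ h x; exact: (h ord0). Qed.

(** The cycles of degree [i] are finitely generated, and the determinant argument applies to their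
    generators modulo boundaries. *)
Lemma local_nakayama (F : dgmod (@ungraded Q) f) : finite_free F -> nakayama_for e z F.
Proof.
move=> /(finite_free_basis ungraded_span)[u [b [dg [ad [coord [cP cE ce bG cG]]]]]].
move=> i hZ v hv dv; pose Z : set F := [set x | hdeg F i x /\ cx_d F x = 0].
have mZ : submodule Z.
  split=> [|x y [hx dx] [hy dy]|q x [hx dx]].
  - by split; [exact: hdeg0|rewrite linear0].
  - by split; [exact: hdegD|rewrite linearD dx dy addr0].
  - by split; [exact: (hdegZ ungraded_span)|rewrite linearZ /= dx scaler0].
pose phi (j : nat) (x : F) : Q := if insub j is Some l then coord x l else 0.
have [||s sZ] := @noetherian_submodule _ _ noethQ u phi Z _ _ mZ.
- by move=> j q x y; rewrite /phi; case: insub => [l|]; rewrite ?cP // mulr0 addr0.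
- move=> x hx; rewrite (cE x) big1 // => j _.
  by have := hx j (ltn_ord j); rewrite /phi valK => ->; rewrite scale0r.
pose B : set F := [set x | exists2 y, hdeg F (i + 1) y & x = cx_d F y].
have mB : submodule B.
  split=> [|x y [x' hx ->] [y' hy ->]|q x [x' hx ->]].
  - by exists 0; [exact: hdeg0|rewrite linear0].
  - by exists (x' + y'); [exact: hdegD|rewrite linearD].
  - by exists (q *: x'); [exact: (hdegZ ungraded_span)|rewrite linearZ].
have [B0 BD BZ] := mB.
have /choice[c cB] (l : 'I_(size s)) : exists c : 'I_(size s) -> Q,
    (forall j, eps (c j) = 0) /\ B (s`_l - \sum_j c j *: s`_j).
  have [hl dl] := sZ.1 _ (mem_nth 0 (ltn_ord l)).
  have [y [c [hy hc dc ->]]] := hZ _ hl dl.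
  have /choice[q qE] j : exists q : 'I_(size s) -> Q, c j = \sum_l q l *: s`_l.
    exact: (spans_combination sZ (conj (hc j) (dc j))).
  exists (fun l => \sum_(j < e) z j * q j l); split=> [j|].
    by rewrite rmorph_sum big1 // => a _; rewrite rmorphM z_eps mul0r.
  suff -> : \sum_(j < e) z j *: c j = \sum_l (\sum_(j < e) z j * q j l) *: s`_l.
    by rewrite addrK; exists y.
  under eq_bigr do rewrite qE scaler_sumr.
  rewrite exchange_big; apply: eq_bigr => a _; rewrite scaler_suml.
  by apply: eq_bigr => j _; rewrite scalerA.
have Bs := nakayama local_unit B0 BD BZ (fun i j => (cB i).1 j) (fun i => (cB i).2).
have [a ->] := spans_combination sZ (conj hv dv).
by apply: (submodule_sum _ mB) => j; apply: BZ; exact: Bs.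
Qed.

End DGModules.
End LocalRings.

(** * Completion *)

(** By induction, products of [N] factors vanish modulo [J] and [a]. So each block of [N] factors
    contributes a factor [a] modulo [J], and [p] blocks suffice when [a ^+ p] is in [J]. *)
Lemma products_vanish (R : comNzRingType) (J : set R) (t : seq R) : ideal J ->
  (forall a, a \in t -> exists N, J (a ^+ N)) ->
  exists N, forall s, (N <= size s)%N -> (forall x, x \in s -> gen t x) -> J (\prod_(x <- s) x).
Proof.
elim: t J => [|a t IH] J idJ hJ; have [J0 JD JM] := idJ.
  exists 1%N => -[|x s] // _ hs; rewrite big_cons mulrC; apply: JM.
  by have [|c ->] := @gen_combination _ [::] x; [apply: hs; rewrite inE eqxx|rewrite big_ord0].
have [p pJ] := hJ a (mem_head a t).
have [|N hN] := IH (ext_ideal J a) (ext_idealP a idJ).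
  move=> b bt; have [|q hq] := hJ b; first by rewrite inE bt orbT.
  by exists q, 0, (b ^+ q); rewrite mulr0 add0r.
have step s : (N <= size s)%N -> (forall x, x \in s -> gen (a :: t) x) ->
    exists u v, J u /\ \prod_(x <- s) x = u + a * v.
  move=> hs sx; have /choice[b bE] : forall x, exists b, x \in s -> gen t (x - a * b).
    move=> x; have [xs|_] := boolP (x \in s); last by exists 0.
    by have [b hb] := gen_cons (sx x xs); exists b.
  have [|y /mapP[x xs ->]|v [u [Ju e]]] := hN (map (fun x => x - a * b x) s).
  - by rewrite size_map.
  - exact: bE.
  have [v' e'] : exists v', \prod_(x <- s) x = \prod_(x <- s) (x - a * b x) + a * v'.
    elim: (s) => [|x s' [v' IHs]]; first by exists 0; rewrite !big_nil mulr0 addr0.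
    exists (b x * (\prod_(x <- s') x) + (x - a * b x) * v').
    by rewrite !big_cons IHs; ring.
  exists u, (v + v'); split=> //; rewrite e' -(big_map _ xpredT id) e; ring.
exists (N * p)%N => s hs sx.
suff [u [v [Ju ->]]] : exists u v, J u /\ \prod_(x <- s) x = u + a ^+ p * v.
  by apply: JD => //; rewrite mulrC; exact: JM.
elim: p s hs sx {pJ} => [|p IHp] s hs sx.
  by exists 0, (\prod_(x <- s) x); rewrite add0r mul1r.
rewrite -(cat_take_drop N s) big_cat.
have szt : size (take N s) = N by rewrite size_takel //; lia.
have [||u [v [Ju ->]]] := step (take N s); first by rewrite szt.
  by move=> x /mem_take; exact: sx.
have [||u' [v' [Ju' ->]]] := IHp (drop N s); first by rewrite size_drop; lia.
  by move=> x /mem_drop; exact: sx.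
exists ((u' + a ^+ p * v') * u + (a * v) * u'), (v * v'); split.
  by apply: JD; exact: JM.
by rewrite /= exprS; ring.
Qed.

Section Completion.
Variables (R : comNzRingType) (m : set R).
Hypotheses (noethR : noetherian R) (locR : local_ring m).
Variables (k : fieldType) (eps : {rmorphism R -> k}).
Hypothesis epsm : quotient_map m eps.

(* Maximality of L makes z span the socle of V/L, so V/L is m-power torsion. *)
Lemma torsion_quotient (V : lmodType R) (L0 : set V) (z : V) : submodule L0 -> ~ L0 z ->
  exists L, [/\ submodule L, L0 `<=` L, ~ L z &
    forall y, exists N, forall q, ideal_exp m N q -> L (q *: y)].
Proof.
move=> mL0 nz; have [|L [mL L0L Lz Lmax]] := @maximal_submodule_avoiding _ V L0 [set z] mL0.
  by move=> x Lx /= e; apply: nz; rewrite -e.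
have {}Lz : ~ L z by move=> /Lz; apply.
have [LO LD LZ] := mL.
(* By maximality every submodule strictly above [L] contains [z]. *)
have cyc y : ~ L y -> exists q, L (z - q *: y).
  move=> ny; pose J : set V := [set x | exists q, L (x - q *: y)].
  have mJ : submodule J.
    split=> [|u v [q hq] [q' hq']|a u [q hq]].
    - by exists 0; rewrite scale0r subr0.
    - by exists (q + q'); rewrite scalerDl opprD addrACA; exact: LD.
    - by exists (a * q); rewrite -scalerA -scalerBr; exact: LZ.
  have [//|nJ] := pselect (J z); exfalso; apply: ny.
  apply: (Lmax J mJ) => [x Lx|x Jx /= e|]; first by exists 0; rewrite scale0r subr0.
    by apply: nJ; rewrite -e.
  by exists 1; rewrite scale1r subrr.
have mz s : m s -> L (s *: z).
  move=> ms; apply: contrapT => /cyc[q]; rewrite scalerA -{1}[z]scale1r -scalerBl => h.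
  have [|u e] := local_unit locR epsm (q := 1 - q * s).
    by rewrite rmorphB rmorph1 rmorphM (epsm.2 s).2 // mulr0 subr0.
  by apply: Lz; rewrite -[z]scale1r -e -scalerA; exact: LZ.
(* The ideals [A j] stabilize at some [N]. If [s ^+ N *: y] were outside [L], then [z] would be a
   multiple of it modulo [L]; as [s *: z] is in [L], stabilization would put [z] into [L]. *)
have pow s y : m s -> exists N, L (s ^+ N *: y).
  move=> ms; pose A j : set R := [set q | L ((q * s ^+ j) *: y)].
  have Amono i j : (i <= j)%N -> A i `<=` A j.
    by move=> /subnKC <- q h; rewrite /A /= exprD mulrA mulrC -scalerA; apply: LZ.
  pose U : set R := [set q | exists j, A j q].
  have [|g gU] := noethR (J := U).
    split=> [|q q' [i hi] [j hj]|a q [i hi]].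
    - by exists 0%N; rewrite /A /= mul0r scale0r.
    - exists (maxn i j); rewrite /A /= mulrDl scalerDl.
      by apply: LD; [apply: (Amono i)|apply: (Amono j)]; rewrite ?leq_maxl ?leq_maxr.
    - by exists i; rewrite /A /= -mulrA -scalerA; exact: LZ.
  have /choice[j jP] : forall q, exists j, q \in g -> A j q.
    move=> q; have [qg|_] := boolP (q \in g); last by exists 0%N.
    by have [j hj] : U q by [rewrite gU; exact: ideal_gen_in]; exists j.
  pose N := (\max_(q <- g) j q)%N; exists N; apply: contrapT => /cyc[q h].
  have idA i : ideal (A i).
    split=> [|q1 q2|a q1]; rewrite /A /= ?mul0r ?scale0r ?mulrDl ?scalerDl //; first exact: LD.
    by move=> h'; rewrite -mulrA -scalerA; exact: LZ.
  have : U q.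
    exists N.+1; rewrite /A /= exprS mulrCA -scalerA -scalerA.
    have -> : q *: (s ^+ N *: y) = z - (z - q *: (s ^+ N *: y)) by rewrite opprB addrC subrK.
    rewrite scalerBr -scaleNr; apply: LD; first exact: mz.
    exact: LZ.
  rewrite gU => Uq; have : A N q.
    apply: Uq; first exact: idA.
    move=> q' qg; apply: (Amono (j q')); last exact: jP.
    by rewrite /N (big_rem q') //= leq_maxl.
  rewrite /A /= -scalerA => Aq; apply: Lz.
  by rewrite -[z](subrK (q *: (s ^+ N *: y))); exact: LD.
exists L; split=> // y; pose J : set R := [set q | L (q *: y)].
have idJ : ideal J.
  split=> [|q1 q2|a q1]; rewrite /J /= ?scale0r ?scalerDl //; first exact: LD.
  by move=> h; rewrite -scalerA; exact: LZ.
have [t mt] : exists t : seq R, m = gen t by apply: noethR; case: locR.1.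
have [|N hN] := products_vanish (t := t) idJ.
  move=> a at_; have [|N hN] := pow a y; last by exists N.
  by rewrite mt; exact: ideal_gen_in.
exists N => q hq; apply: (hq J idJ) => _ [x mx ->].
have := hN (codom x); rewrite size_codom card_ord leqnn codomE big_map big_enum; apply=> //.
by move=> b /mapP[i _ ->]; rewrite -mt.
Qed.

End Completion.

(** * The action of the completion on a torsion quotient *)

Section CompletedQuotient.
Variables (R Rhat : comNzRingType) (m : set R) (c : {rmorphism R -> Rhat}).
Variable phi : Rhat -> nat -> R.
Hypotheses (phiS : forall b n, ideal_exp m n (phi b n.+1 - phi b n))
  (phiP : forall b b' n, ideal_exp m n (phi (b + b') n - (phi b n + phi b' n)) /\
                         ideal_exp m n (phi (b * b') n - phi b n * phi b' n))
  (phic : forall a n, ideal_exp m n (phi (c a) n - a)).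
Variables (V : lmodType R) (L : set V) (mL : submodule L).

Definition kills (n : nat) (y : V) : Prop := forall q, ideal_exp m n q -> L (q *: y).

Hypothesis tors : forall y, exists n, kills n y.

Let L0 : L 0. Proof. by case: mL. Qed.
Let LD x y : L x -> L y -> L (x + y). Proof. by case: mL => _ + _; apply. Qed.
Let LZ q x : L x -> L (q *: x). Proof. by case: mL => _ _; apply. Qed.
Let LB x y : L x -> L y -> L (x - y).
Proof. by move=> hx hy; apply: LD => //; rewrite -scaleN1r; exact: LZ. Qed.

Let idm n : ideal (ideal_exp m n). Proof. exact: ideal_gen_ideal. Qed.

Let expS n : ideal_exp m n.+1 `<=` ideal_exp m n.
Proof.
apply: ideal_gen_min => [|_ [y my ->]]; first exact: idm.
rewrite big_ord_recl; have [_ _] := idm n; apply.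
by apply: ideal_gen_in; exists (fun i => y (lift ord0 i)).
Qed.

Let exp_le i j : (i <= j)%N -> ideal_exp m j `<=` ideal_exp m i.
Proof.
move=> /subnKC <-; elim: (j - i)%N => [|d IH] q; first by rewrite addn0.
by rewrite addnS => /expS/IH.
Qed.

Let kills_le i j y : (i <= j)%N -> kills i y -> kills j y.
Proof. by move=> ij h q /(exp_le ij)/h. Qed.

Let kills_two x y : exists n, kills n x /\ kills n y.
Proof.
have [i hi] := tors x; have [j hj] := tors y; exists (maxn i j).
by split; [apply: kills_le hi|apply: kills_le hj]; rewrite ?leq_maxl ?leq_maxr.
Qed.

Let killsZ n q y : kills n y -> kills n (q *: y).
Proof. by move=> h a /h; rewrite scalerA mulrC -scalerA; exact: LZ. Qed.

Let killsD n x y : kills n x -> kills n y -> kills n (x + y).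
Proof. by move=> hx hy q hq; rewrite scalerDr; apply: LD; [exact: hx|exact: hy]. Qed.

Let phi_le b i j : (i <= j)%N -> ideal_exp m i (phi b j - phi b i).
Proof.
move=> /subnKC <-; elim: (j - i)%N => [|d IH].
  by rewrite addn0 subrr; case: (idm i).
rewrite addnS -(subrK (phi b (i + d)%N) (phi b _)) -addrA; have [_ D _] := idm i.
apply: (D) => //; apply: (exp_le (leq_addr d i)); exact: phiS.
Qed.

Let phi_kills b i j y : kills i y -> kills j y -> L (phi b i *: y - phi b j *: y).
Proof.
rewrite -scalerBl => ki kj; have [ij|ji] := leqP i j; last by apply: kj; apply: phi_le; exact: ltnW.
by rewrite -opprB; apply: ki; apply: (idealN (idm i)); exact: phi_le.
Qed.

Let rep (y : V) : V := xget 0 [set x | L (y - x)].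

Let repP y : L (y - rep y).
Proof. by rewrite /rep; case: xgetP => // /(_ y) /=; rewrite subrr. Qed.

Let rep_eq x y : L (x - y) -> rep x = rep y.
Proof.
move=> h; congr xget; apply/seteqP; split=> u /= hu.
  by have := LB hu h; rewrite opprB addrC addrA subrK.
by have := LD h hu; rewrite addrA subrK.
Qed.

Definition quo : Type := {y : V | rep y == y}.
HB.instance Definition _ := Choice.copy quo {y : V | rep y == y}.

Definition cl (y : V) : quo := exist _ (rep y) (introT eqP (esym (rep_eq (repP y)))).

Let clP x y : L (x - y) -> cl x = cl y.
Proof. by move=> h; apply: val_inj; exact: rep_eq. Qed.

Let cl_L x y : cl x = cl y -> L (x - y).
Proof.
move=> /(congr1 val) /= e; have := LB (repP x) (repP y).
by rewrite e opprB addrA subrK.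
Qed.

Let clK (t : quo) : cl (val t) = t.
Proof. by apply: val_inj; apply/eqP; exact: (valP t). Qed.

Let cl_surj (t : quo) : exists y, t = cl y. Proof. by exists (val t); rewrite clK. Qed.

Let qadd (s t : quo) : quo := cl (val s + val t).
Let qopp (s : quo) : quo := cl (- val s).

Let LN x : L x -> L (- x). Proof. by move=> h; rewrite -scaleN1r; exact: LZ. Qed.

Let qaddE x y : qadd (cl x) (cl y) = cl (x + y).
Proof.
apply: clP => /=; have -> : rep x + rep y - (x + y) = - ((x - rep x) + (y - rep y)).
  by rewrite !opprD !opprK addrACA [- x + _]addrC [- y + _]addrC addrACA.
by apply: LN; exact: LD.
Qed.

Let qoppE x : qopp (cl x) = cl (- x).
Proof. by apply: clP => /=; rewrite opprK addrC; exact: repP. Qed.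

Fact qaddA : associative qadd.
Proof.
move=> s t u; have [x ->] := cl_surj s; have [y ->] := cl_surj t; have [z ->] := cl_surj u.
by rewrite !qaddE addrA.
Qed.

Fact qaddC : commutative qadd.
Proof. by move=> s t; rewrite /qadd addrC. Qed.

Fact qadd0 : left_id (cl 0) qadd.
Proof. by move=> s; have [x ->] := cl_surj s; rewrite qaddE add0r. Qed.

Fact qaddN : left_inverse (cl 0) qopp qadd.
Proof. by move=> s; have [x ->] := cl_surj s; rewrite qoppE qaddE addNr. Qed.

HB.instance Definition _ := GRing.isZmodule.Build quo qaddA qaddC qadd0 qaddN.

Let clD x y : cl (x + y) = cl x + cl y. Proof. by rewrite -qaddE. Qed.

(** [b] acts through its approximation modulo a power of [m] that annihilates the class; by
    [phi_kills] the result does not depend on the power. *)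
Definition act (b : Rhat) (t : quo) : quo := cl (phi b (sval (cid (tors (val t)))) *: val t).

Let actE n b y : kills n y -> act b (cl y) = cl (phi b n *: y).
Proof.
move=> kn; rewrite /act; case: cid => /= N kN; apply: clP.
have kr : kills n (rep y).
  have e : y - (y - rep y) = rep y by rewrite opprB addrC subrK.
  by rewrite -e => q hq; rewrite scalerBr; apply: LB; [exact: kn|exact: LZ].
have -> : phi b N *: rep y - phi b n *: y
        = (phi b N *: rep y - phi b n *: rep y) - phi b n *: (y - rep y).
  by rewrite scalerBr opprB addrA subrK.
by apply: LB; [exact: phi_kills|exact: LZ].
Qed.

Fact actA a b t : act a (act b t) = act (a * b) t.
Proof.
have [y ->] := cl_surj t; have [n kn] := tors y.
rewrite (actE b kn) (actE a (killsZ _ kn)) (actE (a * b) kn); apply: clP.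
rewrite scalerA -scalerBl; apply: kn; rewrite -opprB; apply: (idealN (idm n)).
by have [] := phiP a b n.
Qed.

Fact act1 : left_id 1 act.
Proof.
move=> t; have [y ->] := cl_surj t; have [n kn] := tors y; rewrite (actE 1 kn); apply: clP.
by rewrite -{2}[y]scale1r -scalerBl; apply: kn; rewrite -(rmorph1 c); exact: phic.
Qed.

Fact actDr : right_distributive act +%R.
Proof.
move=> a s t; have [x ->] := cl_surj s; have [y ->] := cl_surj t.
have [n [kx ky]] := kills_two x y.
by rewrite -clD (actE a (killsD kx ky)) (actE a kx) (actE a ky) -clD scalerDr.
Qed.

Fact actDl t : {morph act^~ t : a b / a + b}.
Proof.
move=> a b; have [y ->] := cl_surj t; have [n kn] := tors y.
rewrite (actE _ kn) (actE a kn) (actE b kn) -clD -scalerDl; apply: clP.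
by rewrite -scalerBl; apply: kn; have [] := phiP a b n.
Qed.

HB.instance Definition _ := GRing.Zmodule_isLmodule.Build Rhat quo actA act1 actDr actDl.

Lemma completed_quotient : exists (P : lmodType Rhat) (g : {linear V -> P | c \; *:%R}),
  forall y, g y = 0 <-> L y.
Proof.
have clZ : linear_for (c \; *:%R) cl.
  move=> q x y; have [n kn] := tors x.
  rewrite clD /=; congr (_ + _); rewrite -[RHS]/(act (c q) (cl x)) (actE _ kn).
  by apply: clP; rewrite -scalerBl -opprB scaleNr; apply: LN; apply: kn; exact: phic.
pose mx := GRing.isLinear.Build R V quo (c \; *:%R) cl clZ.
pose g : {linear V -> quo | c \; *:%R} := HB.pack cl mx.
exists quo, g => y; split=> [/cl_L|Ly]; first by rewrite subr0.
by apply: clP; rewrite subr0.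
Qed.

End CompletedQuotient.

(** The map from [M] to a torsion quotient that kills boundaries but not [z] extends to [N] by
    universality, so the image of [z] cannot be a boundary. *)
Theorem homology_nonzero_completion (R Rhat : comNzRingType) (m : set R) (k : fieldType)
    (eps : {rmorphism R -> k}) (c : {rmorphism R -> Rhat}) (D : zmodType) (grR : D -> set R)
    (grS : D -> set Rhat) (M : complex grR) (N : complex grS) :
  noetherian R -> local_ring m -> quotient_map m eps -> adic_completion m c ->
  base_change c M N -> homology_nonzero M -> homology_nonzero N.
Proof.
move=> noeth loc epsm [phi [phiS phiP phic _ _]] [b [_ bd univ]] [z [dz nz]].
pose L0 : set M := [set x | exists y, x = cx_d M y].
have mL0 : submodule L0.
  split=> [|_ _ [x ->] [y ->]|q _ [x ->]]; first by exists 0; rewrite linear0.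
    by exists (x + y); rewrite linearD.
  by exists (q *: x); rewrite linearZ.
have [L [mL L0L Lz tors]] := torsion_quotient noeth loc epsm mL0 nz.
have [P [g gL]] := completed_quotient phiS phiP phic mL tors.
have [h [hb _]] := univ P g.
pose g0 : {linear M -> P | c \; *:%R} := \0.
(* Both maps vanish on the image of [M]; uniqueness in the universal property makes them equal. *)
pose u0 : {linear N -> P} := \0; pose u1 : {linear N -> P} := h \o cx_d N.
have u1_0 y : u1 y = 0.
  have [h0 [_ h0u]] := univ P g0; rewrite (h0u u1) => [|x]; first by rewrite -(h0u u0).
  by rewrite /u1 /= -bd hb; apply/gL; apply: L0L; exists x.
exists (b z); split=> [|[y e]]; first by rewrite -bd dz linear0.
by apply: Lz; apply/gL; rewrite -hb e; exact: u1_0.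
Qed.

(** * The bound on the dimension of the support *)

Section Assembly.
Variables (D : zmodType) (Q : comNzRingType) (gr : D -> set Q).
Hypothesis gr_span : forall P : set Q, P 0 -> (forall x y, P x -> P y -> P (x + y)) ->
  (forall a x, gr a x -> P x) -> forall x, P x.
Variables (n : nat) (f : 'I_n -> Q).
Hypothesis f_hom : forall i, homogeneous gr (f i).
Variables (k : fieldType) (eps : {rmorphism Q -> k}).

Lemma homology_not_acyclic (A : comNzRingType) (grA : D -> set A) (pi : {rmorphism Q -> A})
    (N : complex grA) (G : dgmod gr f) :
  restriction_of pi N G -> homology_nonzero N ->
  (forall l v, dg_e G l v = 0) /\ ~ kacyclic (fun=> True) (kmod_of G).
Proof.
move=> [u [[u' uK u'K] uP _ ud ue]] [z [dz nz]]; split=> [l v|ac].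
  by rewrite -[v]u'K ue.
have uD x y : u (x + y) = u x + u y.
  by have := uP 1 x y; rewrite rmorph1 !scale1r.
have u0 : u 0 = 0 by apply: (addIr (u 0)); rewrite -uD !add0r.
apply: nz; suff [y e] : exists y, u z = cx_d G y.
  by exists (u' y); apply: (can_inj uK); rewrite ud u'K.
have dG := hdeg_direct gr_span G.
have dc i : cx_d G (component dG i (u z)) = 0.
  rewrite -(component_morph dG dG (u := cx_d G) (sh := fun i => i - 1)).
  - by rewrite -ud dz u0 component0.
  - exact: linear0.
  - exact: linearD.
  - exact: addIr.
  - by move=> t x; exact: hdeg_d.
have [s _ ->] := component_sum dG (u z).
apply: (big_ind (fun v => exists y, v = cx_d G y)) => [|_ _ [x ->] [y ->]|i _].
- by exists 0; rewrite linear0.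
- by exists (x + y); rewrite linearD.
have [|y _ e] := ac i I (component dG i (u z)) _ (dc i); last by exists y.
exact: (component_in dG i (u z)).
Qed.

(** The homogeneous core of a prime over the annihilator still lies over it, because the annihilator
    is homogeneous. *)
Lemma homogeneous_support_chain (F : dgmod gr f) l : finite_free F ->
  has_chain [set p | prime_ideal p /\ ann_Ext eps F `<=` p] l ->
  has_chain [set p | prime_ideal p /\ exists2 q, Supp_Ext eps F q & q `<=` p] l.
Proof.
move=> /(finite_free_basis gr_span)[r [b [dg [ad [coord bB]]]]] [p [pX ps]].
exists p; split=> // i /pX[pp annp]; split=> //; have [idp _ _] := pp.
exists (homogeneous_core (p i)); last exact: homogeneous_core_sub.
split=> [|s hs d]; first exact: homogeneous_core_prime.
apply: annp; apply/(ann_ExtP gr_span f_hom eps bB).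
apply: (mx_ann_homogeneous (op_mx_deg gr_span f_hom eps bB) (d_mx_deg gr_span f_hom eps bB)).
by apply/(ann_ExtP gr_span f_hom eps bB).
Qed.

Hypothesis eps_surj : forall x, exists q, eps q = x.
Variables (e : nat) (z : nat -> Q).
Hypothesis z_gen : forall q, eps q = 0 -> exists c : nat -> Q, q = \sum_(j < e) c j * z j.
Hypothesis nakF : forall F : dgmod gr f, finite_free F -> nakayama_for e z F.
Variable good : set Q.
Hypotheses (goodM : forall x y, good x -> good y -> good (x * y))
  (good_eps : forall x, good x -> eps x = 0).
Hypothesis nak : forall s a, (forall t, t \in s -> good t) -> good a ->
  forall L, ideal L -> (forall c, L c -> exists2 c', L c' & gen s (c - a * c')) ->
  L `<=` gen s.
Variable m : set Q.
Hypotheses (m_good : forall x, homogeneous gr x -> m x -> good x)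
  (m_eps : forall x, m x -> eps x = 0).

Theorem monomial_support_bound (I : set Q) (A : comNzRingType) (grA : D -> set A)
    (pi : {rmorphism Q -> A}) (N : complex grA) V :
  I `<=` ideal_exp m 2 -> minimal_generators gr I f ->
  minimally_generated_by_monomials gr m I n ->
  homology_nonzero N -> cohomological_support gr f eps pi N V ->
  (n%:Z%:E - height I <= support_dim V)%E /\
  (~ complete_intersection gr I -> (0 < support_dim V)%E).
Proof.
move=> Im [_ If _] [d [x [g [xm xreg gmon [ghom Ig _]]]]] hN [G [F [rG qGF fF ->]]].
have [G0 Gac] := homology_not_acyclic rG hN.
have idker : ideal [set q | eps q = 0].
  split=> /= [|a b a0 b0|a b b0]; first exact: rmorph0.
    by rewrite rmorphD a0 b0 addr0.
  by rewrite rmorphM b0 mulr0.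
have I1 : ~ I 1.
  move=> /Im h; have : eps 1 = 0; last by rewrite rmorph1 => /eqP; rewrite oner_eq0.
  apply: (h _ idker) => _ [y my ->] /=.
  by rewrite big_ord_recl rmorphM m_eps // mul0r.
have chain (s : seq Q) : (forall t, t \in s -> good t) -> I `<=` gen s ->
    has_chain [set p | prime_ideal p /\ exists2 q, Supp_Ext eps F q & q `<=` p] (n - size s).
  move=> sg Is; apply: homogeneous_support_chain => //.
  have /choice[bf fE] (l : 'I_n) : exists c : nat -> Q, f l = \sum_(i < size s) c i * s`_i.
    by apply: gen_combination; apply: Is; rewrite If; apply: ideal_gen_in; exists l.
  apply: (support_chain gr_span f_hom eps_surj z_gen (h := size s) (x := fun i => s`_i)
    (bf := fun l i => if insub l is Some j then bf j i else 0) _ _ G0 Gac qGF fF (nakF fF)).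
    move=> i; have [lt|ge] := ltnP i (size s); last by rewrite nth_default // rmorph0.
    by apply: good_eps; apply: sg; exact: mem_nth.
  by move=> l; rewrite fE; apply: eq_bigr => i _; rewrite valK.
have /choice[a aE] : forall i, exists a : 'I_d -> nat, g i = \prod_j x j ^+ a j by exact: gmon.
have eI : I = ideal_gen (range (fun i => \prod_j x j ^+ a i j)).
  by rewrite {1}Ig; congr ideal_gen; apply/seteqP; split=> _ [i _ <-]; exists i; rewrite // aE.
have xgood j : good (x j) by have [] := xm j; exact: m_good.
rewrite eI in I1 chain *; split.
  exact: (monomial_dim_bound nak xgood xreg I1 chain).
move=> nci; apply: (monomial_dim_gt0 goodM nak xgood xreg I1 chain) => greg; apply: nci.
exists n, (fun i => \prod_j x j ^+ a i j); split=> // i.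
by rewrite -aE.
Qed.

End Assembly.

Theorem theorem2 :
  (* local case *)
  (forall (k : fieldType)
     (R : comNzRingType) (mR : set R) (epsR : {rmorphism R -> k})
     (hR : noetherian R) (hmR : local_ring mR) (hkR : quotient_map mR epsR)
     (Rhat : comNzRingType) (c : {rmorphism R -> Rhat})
     (hc : adic_completion mR c)
     (Q : comNzRingType) (m : set Q) (eps : {rmorphism Q -> k})
     (hQ : regular_local_ring m) (hk : quotient_map m eps)
     (I : set Q) (hI : ideal I) (hIm : I `<=` ideal_exp m 2)
     (pi : {rmorphism Q -> Rhat}) (hpi : quotient_map I pi)
     (n : nat) (f : 'I_n -> Q) (hf : minimal_generators (@ungraded Q) I f)
     (hmon : minimally_generated_by_monomials (@ungraded Q) m I n)
     (M : complex (@ungraded R)) (hM : homology_nonzero M) (hMfg : homology_fg M)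
     (N : complex (@ungraded Rhat)) (hN : base_change c M N)
     (V : set (set {mpoly k[n]})) (hV : cohomological_support (@ungraded Q) f eps pi N V),
     ((Posz n)%:E - height I <= support_dim V)%E /\
     (~ complete_intersection (@ungraded Q) I -> (0 < support_dim V)%E))
  /\
  (* graded case *)
  (forall (k : fieldType) (r : nat) (w : 'I_r -> nat)
     (hw : forall i, (0 < w i)%N)
     (m : set {mpoly k[r]}) (hm : m = ideal_gen (range (fun i : 'I_r => 'X_i)))
     (eps : {rmorphism {mpoly k[r]} -> k})
     (heps : forall q, eps q = q@_0%MM)
     (I : set {mpoly k[r]}) (hI : homogeneous_ideal (wgrading w) I)
     (hIm : I `<=` ideal_exp m 2)
     (R : comNzRingType) (pi : {rmorphism {mpoly k[r]} -> R})
     (hpi : quotient_map I pi)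
     (n : nat) (f : 'I_n -> {mpoly k[r]})
     (hf : minimal_generators (wgrading w) I f)
     (hmon : minimally_generated_by_monomials (wgrading w) m I n)
     (M : complex (fun a => pi @` wgrading w a))
     (hM : homology_nonzero M) (hMfg : homology_fg M)
     (V : set (set {mpoly k[n]})) (hV : 
        cohomological_support (wgrading w) f eps pi M V),
     ((Posz n)%:E - height I <= support_dim V)%E /\
     (~ complete_intersection (wgrading w) I -> (0 < support_dim V)%E)).
Proof.
split.
- move=> k R mR epsR hR hmR hkR Rhat c hc Q m eps hQ hk I hI hIm pi hpi n f hf hmon.
  move=> M hM hMfg N hN V hV.
  have [noeth loc _] := hQ; have [[idm _ _] _] := loc.
  (* Finitely many generators of the maximal ideal serve as the elements [z]. *)
  have [s ms] := noeth m idm.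
  have sm (j : nat) : eps s`_j = 0.
    have [lt|ge] := ltnP j (size s); last by rewrite nth_default // rmorph0.
    by apply/hk.2; rewrite ms; apply: ideal_gen_in; exact: mem_nth.
  have [fh _ _] := hf.
  have z_gen q : eps q = 0 -> exists c : nat -> Q, q = \sum_(j < size s) c j * s`_j.
    by move=> /hk.2; rewrite ms; exact: gen_combination.
  pose good := [set x : Q | eps x = 0].
  have goodM x y : good x -> good y -> good (x * y).
    by rewrite /good /= rmorphM => -> _; rewrite mul0r.
  have nak t a : (forall b, b \in t -> good b) -> good a -> forall L : set Q, ideal L ->
      (forall b, L b -> exists2 b', L b' & gen t (b - a * b')) -> L `<=` gen t.
    by move=> _ ga L idL; exact: (local_nakayama_ideal noeth loc hk ga idL).
  have nakF (F : dgmod (@ungraded Q) f) : finite_free F ->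
      nakayama_for (size s) (fun j => s`_j) F.
    by move=> fF; exact: (local_nakayama noeth loc hk sm fF).
  apply: (monomial_support_bound (@ungraded_span Q) fh hk.1 z_gen nakF goodM _ nak _ _
    hIm hf hmon _ hV) => // [x _ /hk.2 //|x /hk.2 //|].
  exact: (homology_nonzero_completion hR hmR hkR hc hN hM).
move=> k r w hw m hm eps heps I hI hIm R pi hpi n f hf hmon M hM hMfg V hV.
have [fh _ _] := hf.
have m_eps x : m x -> eps x = 0.
  rewrite hm => h; apply: (h [set q | eps q = 0]) => [|_ [i _ <-]] /=.
    split=> /= [|a b a0 b0|a b b0]; first exact: rmorph0.
      by rewrite rmorphD a0 b0 addr0.
    by rewrite rmorphM b0 mulr0.
  by rewrite heps mcoeffX mnm1_eq0.
have eps_surj x : exists q, eps q = x.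
  by exists x%:MP; rewrite heps mcoeffC eqxx mulr1.
pose z (j : nat) : {mpoly k[r]} := if insub j is Some i then 'X_(i : 'I_r) else 0.
have z_gen q : eps q = 0 -> exists c : nat -> {mpoly k[r]}, q = \sum_(j < r) c j * z j.
  move=> /(augmentation_gen heps)[c ->].
  exists (fun j => if insub j is Some i then c i else 0).
  by apply: eq_bigr => i _; rewrite /z valK.
apply: (monomial_support_bound (@wgrading_span _ _ _) fh eps_surj z_gen _
  (@graded_goodM _ _ w eps) _ (graded_nakayama_ideal hw heps) _ m_eps hIm hf hmon hM hV).
- by move=> F; exact: graded_nakayama.
- by move=> x [].
- by move=> x hx /m_eps.
Qed.
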